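(* Let $u\in H^2_{\ell,0}(\Omega)$ be the $H^2$ strong solution of the oblique derivative problem: $A:D^2u=f$ a.e. in $\Omega$, $\ell\cdot\nabla u=c$ on $\partial\Omega$ for some (a priori unknown) constant $c$, and $\int_\Omega u\,\mathrm{d}x=0$. Then $u$ satisfies the numerical scheme, i.e. $$b_h(u,v_h)=l_h(v_h)\qquad\text{for all }v_h\in V^\ell_{h,0}.$$
   Context: **Data.** $\Omega\subset\mathbb{R}^2$ is a bounded domain with $C^2$ boundary, a closed curve parametrized by arc length $\varphi$; a dot denotes the derivative with respect to $\varphi$. $\ell=(\ell_1,\ell_2):\partial\Omega\to\mathbb{R}^2$ is a $C^1$ unit vector field, $\frac{\partial v}{\partial\ell}:=\ell_1\partial_1v+\ell_2\partial_2v$, $\frac{\partial v}{\partial\ell^\perp}:=-\ell_2\partial_1v+\ell_1\partial_2v$. $A\in L^\infty(\Omega;\mathbb{R}^{2\times2})$ is uniformly elliptic ($\underline\nu|\xi|^2\le\xi^tA(x)\xi\le\bar\nu|\xi|^2$ for all $\xi\in\mathbb{R}^2$, a.e. $x$, with $\underline\nu,\bar\nu>0$), and $\varepsilon\in(0,1]$ is a constant for which the Cordes condition $|A|^2/(\operatorname{tr}A)^2\le1/(1+\varepsilon)$ holds a.e. in $\Omega$ ($|\cdot|$ the Frobenius norm). $\gamma:=\operatorname{tr}A/|A|^2$, $f\in L^2(\Omega)$, $A:B:=\sum_{i,j}A_{ij}B_{ij}$. $H^2_{\ell,0}(\Omega):=\{v\in H^2(\Omega):\ell\cdot\nabla v\text{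 is constant on }\partial\Omega,\ \int_\Omega v\,\mathrm{d}x=0\}$. **Triangulation.** A closed set $K\subset\mathbb{R}^2$ is a curved triangle if $K=F_K(\hat K)$, where $\hat K$ is a fixed straight reference triangle and $F_K=\tilde F_K+\Phi_K$ is a $C^1$ map, with $\tilde F_K(\hat x)=B_K\hat x+b_K$ an invertible affine map and $\sup_{\hat x\in\hat K}\|D\Phi_K(\hat x)B_K^{-1}\|<1$. $\mathcal{T}_h$ is an exact conforming triangulation of $\Omega$: a conforming partition of $\overline\Omega$ into curved triangles such that each element has at most one truly curved edge, any truly curved edge lies on $\partial\Omega$, and all other edges are straight; for each straight edge $F$ of $K$, $F_K$ restricted to the corresponding edge of $\hat K$ is affine onto $F$. The maps $F_K$ are of class $C^2$. $\mathcal{F}_h^\partial$ is the set of edges contained in $\partial\Omega$, $\mathcal{F}_h^i$ the set of interior edges. **Finite element spaces** ($k\ge3$). $P_K:=\{\hat v\circ F_K^{-1}:\hat v\in\mathcal{P}_k(\hat K)\}$, where $\mathcal{P}_k$ denotes polynomials of total degree $\le k$; $V_h:=\{v\in H^1(\Omega):v|_K\in P_K\ \forall K\in\mathcal{T}_h,\ v\text{ is }C^1\text{ at all vertices}\}$ (''$C^1$ at a vertex'': values of $v|_K$ and $\nabla(v|_K)$ there agree for all $K$ containing it); $V^\ell_{h,0}:=\{v_h\in V_h:\int_\Omega v_h\,\mathrm{d}x=0,\ \nabla v_h(x_i)\cdot\ell(x_i)\text{ has the same value for all boundary vertices }x_i\}$. **Forms.** For an interior edge $F=\partial K^+\cap\partial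 K^-$, $[\frac{\partial v}{\partial n}]:=\frac{\partial v^+}{\partial n^+}+\frac{\partial v^-}{\partial n^-}$ with $v^\pm=v|_{K^\pm}$ and $n^\pm$ the unit outward normal of $K^\pm$; $t_F$ is a fixed unit tangent of $F$. Define $$s_h(w,v):=-2\sum_{F\in\mathcal{F}_h^i}\int_F\Big[\frac{\partial w}{\partial n}\Big]\frac{\partial^2v}{\partial t_F^2}\,\mathrm{d}s+2\sum_{F\in\mathcal{F}_h^\partial}\int_F\dot{\Big(\frac{\partial w}{\partial\ell}\Big)}\frac{\partial v}{\partial\ell^\perp}\,\mathrm{d}s,$$ $$b_h(w,v):=\sum_{K\in\mathcal{T}_h}\int_K\gamma (A:D^2w)\,\Delta v\,\mathrm{d}x+\frac{2-\sqrt{1-\varepsilon}}{2}s_h(w,v),\qquad l_h(v):=\sum_{K\in\mathcal{T}_h}\int_K\gamma f\,\Delta v\,\mathrm{d}x,$$ for $v\in V_h$ and $w\in V_h+H^2_{\ell,0}(\Omega)$. The numerical scheme is: find $u_h\in V^\ell_{h,0}$ with $b_h(u_h,v_h)=l_h(v_h)$ for all $v_h\in V^\ell_{h,0}$. *)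

(* Defs.v *)
From HB Require Import structures.
From mathcomp Require Import all_boot all_order all_algebra.
From mathcomp Require Import all_classical all_reals all_analysis.

Set Implicit Arguments.
Unset Strict Implicit.
Unset Printing Implicit Defensive.

Import Order.TTheory GRing.Theory Num.Theory numFieldNormedType.Exports.
Local Open Scope classical_set_scope.
Local Open Scope ring_scope.

(* The library norm on R * R is the sup norm: it is used for the topology and
   for differentiability only, Euclidean lengths are given by enorm. *)
Notation plane R := (R * R)%type (only parsing).

Notation leb2 R := (@lebesgue_measure R \x @lebesgue_measure R)%E.

Section Plane.
Variable R : realType.
Implicit Types (x y : plane R) (U : set (plane R)).

Definition coord (m : 'I_2) x : R := if m == ord0 then x.1 else x.2.

Definition ebase (m : 'I_2) : plane R :=
  if m == ord0 then (1, 0) else (0, 1).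

Definition dotp x y : R := x.1 * y.1 + x.2 * y.2.

Definition enorm x : R := Num.sqrt (dotp x x).

Definition mulP (B : 'M[R]_2) x : plane R :=
  (B ord0 ord0 * x.1 + B ord0 ord_max * x.2,
   B ord_max ord0 * x.1 + B ord_max ord_max * x.2).

Definition segment x y : set (plane R) :=
  [set (1 - t) *: x + t *: y | t in `[0, 1]].

Definition bdry U : set (plane R) := closure U `\` U°.

Fixpoint Ck (n : nat) U (g : plane R -> R) : Prop :=
  match n with
  | 0 => forall x, U x -> {for x, continuous g}
  | n'.+1 => (forall x, U x -> differentiable g x) /\
             forall m : 'I_2, Ck n' U (fun x => 'D_(ebase m) g x)
  end.

Definition smooth (g : plane R -> R) : Prop := forall n, Ck n setT g.

Definition Ck1 (n : nat) (g : R -> R) : Prop :=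
  (forall m s, (m < n)%N -> derivable (derive1n m g) s 1) /\
  (forall m, (m <= n)%N -> continuous (derive1n m g)).

Definition smooth1 (g : R -> R) : Prop := forall n, Ck1 n g.

Definition curveCk (n : nat) (g : R -> plane R) : Prop :=
  forall m : 'I_2, Ck1 n (fun s => coord m (g s)).

Definition mapCk (n : nat) U (g : plane R -> plane R) : Prop :=
  forall m : 'I_2, Ck n U (fun x => coord m (g x)).

Definition compactly_supported_in (T : topologicalType) (U : set T)
    (psi : T -> R) : Prop :=
  exists C : set T, [/\ compact C, C `<=` U & forall z, ~ C z -> psi z = 0].

Definition L2 (d : measure_display) (T : measurableType d)
    (mu : {measure set T -> \bar R}) (D : set T) (g : T -> R) : Prop :=
  measurable_fun D g /\ mu.-integrable D (fun z => (g z ^+ 2)%:E).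

Definition Linfty U (g : plane R -> R) : Prop :=
  measurable_fun U g /\
  exists M : R, {ae leb2 R, forall x, U x -> `|g x| <= M}.

Definition weak_partial U (m : 'I_2) (w g : plane R -> R) : Prop :=
  forall psi, smooth psi -> compactly_supported_in U psi ->
    \int[leb2 R]_(x in U) (w x * 'D_(ebase m) psi x)
    = - \int[leb2 R]_(x in U) (g x * psi x).

(* A representative of the weak derivative in L^2(U); it is unique almost
   everywhere on U.  Junk value 0 if there is none. *)
Definition wpart U (m : 'I_2) (w : plane R -> R) : plane R -> R :=
  xget (fun _ => 0) [set g | L2 (leb2 R) U g /\ weak_partial U m w g].

Definition H1 U (w : plane R -> R) : Prop :=
  L2 (leb2 R) U w /\
  forall m : 'I_2, exists g, L2 (leb2 R) U g /\ weak_partial U m w g.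

Definition H2 U (w : plane R -> R) : Prop :=
  H1 U w /\ forall m : 'I_2, H1 U (wpart U m w).

Definition hess U (w : plane R -> R) (x : plane R) : 'M[R]_2 :=
  \matrix_(m, n) wpart U n (wpart U m w) x.

(* gam is parametrized by arc length on J.  g is the L^2-limit, on the arc
   gam(J), of the restrictions of smooth functions that converge to w in
   H^1(U). *)
Definition is_trace U (gam : R -> plane R) (J : set R)
    (w g : plane R -> R) : Prop :=
  [/\ H1 U w, L2 (@lebesgue_measure R) J (g \o gam) &
    exists phi : nat -> plane R -> R,
      [/\ forall n, smooth (phi n),
          (\int[leb2 R]_(x in U) ((phi n x - w x) ^+ 2)%:E)%E
            @[n --> \oo] --> 0%E,
          forall m : 'I_2,
            (\int[leb2 R]_(x in U)
               (('D_(ebase m) (phi n) x - wpart U m w x) ^+ 2)%:E)%E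
            @[n --> \oo] --> 0%E &
          (\int[@lebesgue_measure R]_(s in J)
             ((phi n (gam s) - g (gam s)) ^+ 2)%:E)%E
            @[n --> \oo] --> 0%E]].

Definition is_grad_trace U (gam : R -> plane R) (J : set R)
    (w : plane R -> R) (G : plane R -> plane R) : Prop :=
  forall m : 'I_2,
    is_trace U gam J (wpart U m w) (fun x => coord m (G x)).

(* chi is the L-periodic arc length parametrization of the boundary; the
   orientation is left free.  The local defining function rho expresses that
   Omega has C^2 boundary. *)
Definition C2_domain (Omega : set (plane R)) (L : R) (chi : R -> plane R)
    : Prop :=
  [/\ [/\ open Omega, connected Omega, bounded_set Omega & Omega !=set0],
      forall x, bdry Omega x -> exists (rho : plane R -> R) V,
        [/\ open V, V x, Ck 2 V rho,
            exists m : 'I_2, 'D_(ebase m) rho x != 0 &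
            forall y, V y -> (Omega y <-> rho y < 0)] &
      [/\ 0 < L, curveCk 2 chi,
          forall s, enorm (derive1 chi s) = 1,
          forall s, chi (s + L) = chi s &
          {in `[0, L[ &, injective chi} /\ range chi = bdry Omega]].

Definition C1_unit_field (chi : R -> plane R) (ell : plane R -> plane R)
    : Prop :=
  curveCk 1 (ell \o chi) /\ forall s, enorm (ell (chi s)) = 1.

Definition frobsq (M : 'M[R]_2) : R :=
  \sum_(i < 2) \sum_(j < 2) M i j ^+ 2.

Definition frobdot (M N : 'M[R]_2) : R :=
  \sum_(i < 2) \sum_(j < 2) M i j * N i j.

Definition uniformly_elliptic (Omega : set (plane R))
    (A : plane R -> 'M[R]_2) (nu_lo nu_hi : R) : Prop :=
  [/\ 0 < nu_lo, 0 < nu_hi &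
    {ae leb2 R, forall x, Omega x -> forall xi : 'cV[R]_2,
       nu_lo * \sum_(i < 2) xi i ord0 ^+ 2
         <= (xi^T *m A x *m xi) ord0 ord0
         <= nu_hi * \sum_(i < 2) xi i ord0 ^+ 2}].

Definition cordes (Omega : set (plane R)) (A : plane R -> 'M[R]_2) (eps : R)
    : Prop :=
  {ae leb2 R, forall x, Omega x ->
     frobsq (A x) / (\tr (A x)) ^+ 2 <= 1 / (1 + eps)}.

Definition gamma_coef (A : plane R -> 'M[R]_2) (x : plane R) : R :=
  \tr (A x) / frobsq (A x).

Definition oblique_const (Omega : set (plane R)) (L : R)
    (chi : R -> plane R) (ell : plane R -> plane R) (u : plane R -> R)
    (c : R) : Prop :=
  exists G, is_grad_trace Omega chi `[0, L[ u G /\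
    {ae @lebesgue_measure R, forall s, 0 <= s < L ->
       dotp (ell (chi s)) (G (chi s)) = c}.

Definition H2ell0 (Omega : set (plane R)) (L : R) (chi : R -> plane R)
    (ell : plane R -> plane R) (u : plane R -> R) : Prop :=
  [/\ H2 Omega u,
      exists c, oblique_const Omega L chi ell u c &
      \int[leb2 R]_(x in Omega) u x = 0].

Record mesh := Mesh {
  nel : nat ;
  refv : 'I_3 -> plane R ;
  Fmap : 'I_nel -> plane R -> plane R
}.

Section Mesh.
Variable T : mesh.
Implicit Types (i j : 'I_(nel T)) (p q : 'I_3) (e : 'I_(nel T) * 'I_3).

Definition Khat : set (plane R) :=
  [set x | exists l : 'I_3 -> R,
     [/\ forall p, 0 <= l p, \sum_(p < 3) l p = 1 &
         x = \sum_(p < 3) l p *: refv T p]].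

Definition nondegenerate : Prop :=
  let a := refv T (inord 1) - refv T ord0 in
  let b := refv T (inord 2) - refv T ord0 in
  a.1 * b.2 - a.2 * b.1 != 0.

Definition elem i : set (plane R) := @Fmap T i @` Khat.

(* The p-th edge joins the vertices p and p + 1 (mod 3). *)
Definition refedge p (t : R) : plane R :=
  (1 - t) *: refv T p + t *: refv T (ordS p).

Definition edge e : set (plane R) :=
  [set @Fmap T e.1 (refedge e.2 t) | t in `[0, 1]].

Definition vertex i p : plane R := @Fmap T i (refv T p).

(* Being of class C^2 on the closed triangle Khat is understood as being the
   restriction of a C^2 map on a neighbourhood. *)
Definition curved_triangle i : Prop :=
  (exists U, [/\ open U, Khat `<=` U & mapCk 2 U (@Fmap T i)]) /\
  (exists (B : 'M[R]_2) (b : plane R),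
     let Phi x := @Fmap T i x - (mulP B x + b) in
     B \in unitmx /\
     exists c : R, c < 1 /\ forall x, Khat x -> forall xi,
       enorm ('d Phi x (mulP (invmx B) xi)) <= c * enorm xi).

Definition straight e : Prop := exists x y, edge e = segment x y.

Definition exact_conforming (Omega : set (plane R)) : Prop :=
  [/\ nondegenerate /\ (forall i, curved_triangle i),
      \bigcup_i elem i = closure Omega /\
      (forall i j, i != j -> (elem i)° `&` (elem j)° = set0),
      forall i j, i != j ->
        [\/ elem i `&` elem j = set0,
            exists p q, vertex i p = vertex j q /\
                        elem i `&` elem j = [set vertex i p] |
            exists p q, edge (i, p) = edge (j, q) /\
                        elem i `&` elem j = edge (i, p)],
      (forall i p q, ~ straight (i, p) -> ~ straight (i, q) -> p = q) /\
      (forall e, ~ straight e -> edge e `<=` bdry Omega) &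
      forall i p, straight (i, p) -> forall t, 0 <= t <= 1 ->
        @Fmap T i (refedge p t)
        = (1 - t) *: vertex i p + t *: vertex i (ordS p)].

Definition boundary_edge (Omega : set (plane R)) e : bool :=
  `[< edge e `<=` bdry Omega >].

(* An interior edge is listed once, as the pair of its two occurrences
   K+ = E.1.1 and K- = E.2.1, with K+ of smaller index. *)
Definition interior_edge (E : ('I_(nel T) * 'I_3) * ('I_(nel T) * 'I_3))
    : bool :=
  (E.1.1 < E.2.1)%N && `[< edge E.1 = edge E.2 >].

Definition polyk (k : nat) (c : nat -> nat -> R) (x : plane R) : R :=
  \sum_(i < k.+1) \sum_(j < k.+1 - i) c i j * x.1 ^+ i * x.2 ^+ j.

(* Gradient of the restriction of v to the element i, extended by continuity
   to the closed element. *)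
Definition gradK i (v : plane R -> R) (x : plane R) : plane R :=
  (lim ('D_(ebase ord0) v y @[y --> within (elem i)° (nbhs x)]),
   lim ('D_(ebase ord_max) v y @[y --> within (elem i)° (nbhs x)])).

(* Elements are given by their continuous representative on closure Omega, so
   that the values at the vertices agree by construction. *)
Definition Vh (Omega : set (plane R)) (k : nat) (v : plane R -> R) : Prop :=
  [/\ H1 Omega v,
      forall i, exists c, forall x, Khat x ->
        v (@Fmap T i x) = polyk k c x &
      forall i j p, elem j (vertex i p) ->
        gradK i v (vertex i p) = gradK j v (vertex i p)].

Definition Vhell0 (Omega : set (plane R)) (ell : plane R -> plane R)
    (k : nat) (v : plane R -> R) : Prop :=
  [/\ Vh Omega k v,
      \int[leb2 R]_(x in Omega) v x = 0 &
      exists c, forall i p, bdry Omega (vertex i p) ->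
        dotp (gradK i v (vertex i p)) (ell (vertex i p)) = c].

Definition edge_len e : R := enorm (vertex e.1 (ordS e.2) - vertex e.1 e.2).

Definition edge_tangent e : plane R :=
  (edge_len e)^-1 *: (vertex e.1 (ordS e.2) - vertex e.1 e.2).

(* Arc length parametrization of a straight edge by `[0, edge_len e]. *)
Definition edge_param e (s : R) : plane R :=
  vertex e.1 e.2 + s *: edge_tangent e.

(* Outward unit normal at a point near which the boundary of K is straight. *)
Definition is_outer_normal (K : set (plane R)) (x n : plane R) : Prop :=
  enorm n = 1 /\ \forall y \near x, K y <-> dotp n (y - x) <= 0.

Definition is_normal_jump (E : ('I_(nel T) * 'I_3) * ('I_(nel T) * 'I_3))
    (w J : plane R -> R) : Prop :=
  let gam := edge_param E.1 in
  let len := edge_len E.1 in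
  exists (np nm : plane R) (Gp Gm : plane R -> plane R),
    [/\ forall s, 0 < s < len ->
          is_outer_normal (elem E.1.1) (gam s) np /\
          is_outer_normal (elem E.2.1) (gam s) nm,
        is_grad_trace (elem E.1.1)° gam `[0, len] w Gp,
        is_grad_trace (elem E.2.1)° gam `[0, len] w Gm &
        forall x, J x = dotp (Gp x) np + dotp (Gm x) nm].

(* For w in H^2 of both elements the traces exist and are unique almost
   everywhere on the edge, hence so is the jump; 0 is a junk value. *)
Definition normal_jump (E : ('I_(nel T) * 'I_3) * ('I_(nel T) * 'I_3))
    (w : plane R -> R) : plane R -> R :=
  xget (fun _ => 0) [set J | is_normal_jump E w J].

(* Arc length parameters, in one period, of the points of a boundary edge. *)
Definition bdry_params (L : R) (chi : R -> plane R) e : set R :=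
  `[0, L[ `&` (chi @^-1` edge e).

Definition weak_arc_derivative (chi : R -> plane R) e (g h : plane R -> R)
    : Prop :=
  let J := (chi @^-1` edge e)° in
  forall psi : R -> R, smooth1 psi -> compactly_supported_in J psi ->
    \int[@lebesgue_measure R]_(s in J) (g (chi s) * derive1 psi s)
    = - \int[@lebesgue_measure R]_(s in J) (h (chi s) * psi s).

Definition is_dot_oblique (L : R) (chi : R -> plane R)
    (ell : plane R -> plane R) e (w h : plane R -> R) : Prop :=
  L2 (@lebesgue_measure R) (bdry_params L chi e) (h \o chi) /\
  exists G, is_grad_trace (elem e.1)° chi (bdry_params L chi e) w G /\
    weak_arc_derivative chi e (fun x => dotp (ell x) (G x)) h.

(* The derivative with respect to arc length, along the boundary edge e, of
   the trace of ell . grad w.  It exists and is unique almost everywhere for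
   w in the sum of V_h and H^2_{ell,0}; 0 is a junk value. *)
Definition dot_oblique (L : R) (chi : R -> plane R)
    (ell : plane R -> plane R) e (w : plane R -> R) : plane R -> R :=
  xget (fun _ => 0) [set h | is_dot_oblique L chi ell e w h].

Definition oblique_perp (ell : plane R -> plane R) i (v : plane R -> R)
    (x : plane R) : R :=
  - (ell x).2 * (gradK i v x).1 + (ell x).1 * (gradK i v x).2.

Definition s_h (Omega : set (plane R)) (L : R) (chi : R -> plane R)
    (ell : plane R -> plane R) (w v : plane R -> R) : R :=
  - 2 * \sum_(E | interior_edge E)
      \int[@lebesgue_measure R]_(s in `[0, edge_len E.1])
        (let t := edge_tangent E.1 in
         normal_jump E w (edge_param E.1 s)
         * 'D_t (fun x => 'D_t v x) (edge_param E.1 s))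
  + 2 * \sum_(e | boundary_edge Omega e)
      \int[@lebesgue_measure R]_(s in bdry_params L chi e)
        (dot_oblique L chi ell e w (chi s) * oblique_perp ell e.1 v (chi s)).

(* Second derivatives on an element are weak derivatives in its interior;
   they are only meaningful there, and the boundary of an element is a null
   set. *)
Definition b_h (Omega : set (plane R)) (L : R) (chi : R -> plane R)
    (ell : plane R -> plane R) (A : plane R -> 'M[R]_2) (eps : R)
    (w v : plane R -> R) : R :=
  \sum_(i < nel T)
    \int[leb2 R]_(x in (elem i)°)
      (gamma_coef A x * frobdot (A x) (hess (elem i)° w x)
       * \tr (hess (elem i)° v x))
  + (2 - Num.sqrt (1 - eps)) / 2 * s_h Omega L chi ell w v.

Definition l_h (A : plane R -> 'M[R]_2) (f v : plane R -> R) : R :=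
  \sum_(i < nel T)
    \int[leb2 R]_(x in (elem i)°)
      (gamma_coef A x * f x * \tr (hess (elem i)° v x)).

End Mesh.
End Plane.

(* Main.v *)
(** Only the consistency of the jump terms has to be shown: the volume terms
    agree because the weak Hessian of [u] on the interior of an element is a.e.
    that on [Omega].

    A trace along an arc satisfies Green's formula near each point where the
    domain is one side of a graph, so a trace is determined a.e. by the weak
    derivatives.  At an interior edge both elements are half planes locally;
    adding the two Green formulas gives the definition of the weak derivative
    of the components of [grad u] on [Omega], so the two traces agree and the
    jump vanishes a.e.  At a boundary edge the element and [Omega] coincide near
    every point of the open edge: [F_K] is injective on the reference triangle
    and open in its interior (because [sup |D Phi_K B_K^-1| < 1]), so that the
    element is relatively open and closed in the connected local part of
    [Omega].  Hence the trace of [grad u] from the element is the one from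
    [Omega], [ell . grad u = c] there, and its arc derivative vanishes. *)

Require Import Defs.
From HB Require Import structures.
From mathcomp Require Import all_boot all_order all_algebra.
From mathcomp Require Import all_classical all_reals all_analysis.
From mathcomp Require Import measurable_realfun ring lra.
Import Order.TTheory GRing.Theory Num.Theory numFieldNormedType.Exports.
Local Open Scope classical_set_scope.
Local Open Scope ring_scope.

Set Implicit Arguments.
Unset Strict Implicit.
Unset Printing Implicit Defensive.

(** [normal_jump] and [dot_oblique] are choices among candidates, with default [0], so it is enough
    that every candidate vanishes a.e. A candidate comes with an approximating sequence of smooth
    functions; Green's formula holds for these and passes to the limit against a fixed test
    function. To compare the traces from two domains, both formulas are written in one window around
    a curve point, with the same graph direction [m] and the same parameters; the boundary integrals
    then differ only by the sign [sg] telling on which side the domain lies. Windows are taken away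
    from finitely many parameters, and rational intervals glue the local statements into one that
    holds a.e. Charts of the boundary come from the monotonicity of a defining function along a
    coordinate direction, and openness of the element maps from a minimization. At an interior edge
    the half-plane shape of the elements is read off the outer normals that a candidate jump
    contains. *)

Local Notation coord := Defs.coord.
Local Notation nondegenerate := Defs.nondegenerate.

(** * Integrals, null sets and Dynkin systems *)

Section IntegralGeneralities.
Context d (T : measurableType d) (R : realType).
Variable mu : {measure set T -> \bar R}.
Implicit Types (D : set T).

Import HBNNSimple.

(** The integral is a supremum over simple functions below [f], and each of them is dominated by
    [+oo] on a null set and [0] elsewhere. No measurability of [f] is assumed, which suits the edge
    integrands, whose measurability is not established. *)
Let ge0_integral_ae0 D (f : T -> \bar R) :
  (forall x, D x -> (0 <= f x)%E) -> {ae mu, forall x, D x -> f x = 0%E} ->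
  (\int[mu]_(x in D) f x = 0)%E.
Proof.
move=> f0 [N [mN N0 fN]].
apply/eqP; rewrite eq_le integral_ge0// andbT.
rewrite ge0_integralE//; apply: ub_ereal_sup => _ [h /= hf <-].
have <- : (\int[mu]_(x in N) (+oo)%E = 0)%E by rewrite integral_cst// N0 mule0.
rewrite (_ : sintegral mu h = \int[mu]_x (h x)%:E)%E; last first.
  by rewrite -integralT_nnsfun.
rewrite [leRHS]integral_mkcond; apply: ge0_le_integral => //.
- by move=> x _; rewrite lee_fin.
- exact/measurable_EFinP.
- by apply/(measurable_restrictT _ mN).1; exact: measurable_cst.
- move=> x _; rewrite patchE; case: ifPn => xN; first by rewrite leey.
  apply: (le_trans (hf x)); rewrite patchE; case: ifPn => // xD.
  have [->//|fx0] := eqVneq (f x) 0%E.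
  exfalso; move/negP: xN; apply; apply/mem_set/fN => /= H.
  by move/eqP: fx0; apply; apply: H; exact/set_mem.
Qed.

Lemma ae_impl (P Q : T -> Prop) : (forall x, P x -> Q x) ->
  {ae mu, forall x, P x} -> {ae mu, forall x, Q x}.
Proof. by move=> PQ; apply: filterS. Qed.

Lemma ae_conj (P Q : T -> Prop) : {ae mu, forall x, P x} -> {ae mu, forall x, Q x} ->
  {ae mu, forall x, P x /\ Q x}.
Proof. by move=> aP aQ; apply: filterS (filterI aP aQ). Qed.

Lemma integral_ae0 D (f : T -> \bar R) :
  {ae mu, forall x, D x -> f x = 0%E} -> (\int[mu]_(x in D) f x = 0)%E.
Proof.
move=> f0; rewrite integralE !ge0_integral_ae0 ?sube0//.
- by apply: filterS f0 => x fx /fx; rewrite funenegE => ->; rewrite oppe0 maxxx.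
- by apply: filterS f0 => x fx /fx; rewrite funeposE => ->; rewrite maxxx.
Qed.

Lemma Rintegral_ae0 D (f : T -> R) :
  {ae mu, forall x, D x -> f x = 0} -> \int[mu]_(x in D) f x = 0.
Proof.
move=> f0; rewrite /Rintegral integral_ae0//.
by apply: filterS f0 => x fx /fx ->.
Qed.

Lemma ae_eq_Rintegral D (f g : T -> R) : measurable D ->
  measurable_fun D f -> measurable_fun D g ->
  {ae mu, forall x, D x -> f x = g x} ->
  \int[mu]_(x in D) f x = \int[mu]_(x in D) g x.
Proof.
move=> mD mf mg fg; rewrite /Rintegral; congr fine; apply: ae_eq_integral => //.
- exact/measurable_EFinP.
- exact/measurable_EFinP.
- by apply: filterS fg => x fgx /fgx ->.
Qed.

Lemma Rintegral_restrict_subset D E (f : T -> R) : E `<=` D ->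
  (forall x, D x -> ~ E x -> f x = 0) ->
  \int[mu]_(x in D) f x = \int[mu]_(x in E) f x.
Proof.
move=> ED f0; rewrite Rintegral_mkcond [RHS]Rintegral_mkcond.
congr (Rintegral _ _); apply/funext => x; rewrite !patchE.
case: ifPn => xD; case: ifPn => xE => //.
- by apply: f0; [exact/set_mem|move=> /mem_set; apply/negP].
- by exfalso; move/negP: xD; apply; apply/mem_set/ED/set_mem.
Qed.

Lemma Rintegral_ae_subset D E (f : T -> R) : measurable D -> measurable E -> E `<=` D ->
  measurable_fun D f -> {ae mu, forall x, D x -> ~ E x -> f x = 0} ->
  \int[mu]_(x in D) f x = \int[mu]_(x in E) f x.
Proof.
move=> mD mE ED mf f0.
have mfE : measurable_fun D (f \_ E).
  apply: (measurable_restrict f mE mD).1; rewrite setIidr//.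
  exact: measurable_funS mf.
rewrite (@ae_eq_Rintegral D f (f \_ E))//.
  rewrite (@Rintegral_restrict_subset D E)//.
    by apply: eq_Rintegral => x xE; rewrite patchE xE.
  by move=> x _ Ex; rewrite patchE ifF//; apply/negP => /set_mem.
apply: ae_impl f0 => x f0 Dx; rewrite patchE; case: ifPn => // /negP xE.
by apply: f0 => // Ex; apply: xE; exact/mem_set.
Qed.

(** For integrable [f] the sets with vanishing integral form a Dynkin system, so a generating
    pi-system suffices. The map [p] will be the identity or a coordinate projection, which lets the
    plane be treated one coordinate at a time. *)
Lemma integral_dynkin d' (T' : measurableType d') (G : set (set T'))
    (p : T -> T') D (f : T -> \bar R) :
  @measurable _ T' = <<s G >> -> setI_closed G -> measurable_fun setT p ->
  measurable D -> mu.-integrable D f ->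
  (\int[mu]_(x in D) f x = 0)%E ->
  (forall A, G A -> \int[mu]_(x in D `&` p @^-1` A) f x = 0)%E ->
  forall A, measurable A -> (\int[mu]_(x in D `&` p @^-1` A) f x = 0)%E.
Proof.
move=> mG GI mp mD intf fD fG.
have mpA A : measurable A -> measurable (D `&` p @^-1` A).
  by move=> mA; apply: measurableI => //; rewrite -[X in measurable X]setTI; exact: mp.
have := @dynkin_induction _ T' G
  (fun A => \int[mu]_(x in D `&` p @^-1` A) f x = 0)%E mG GI.
rewrite -mG; apply.
- by rewrite preimage_setT setIT.
- by move=> A /fG.
- move=> A mA fA.
  have : (\int[mu]_(x in (D `&` p @^-1` A) `|` (D `&` p @^-1` (~` A))) f x = 0)%E.
    by rewrite -setIUr -preimage_setU setUv preimage_setT setIT.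
  rewrite integral_setU ?fA ?add0e//.
  + exact: mpA.
  + by apply: mpA; exact: measurableC.
  + rewrite -setIUr -preimage_setU setUv preimage_setT setIT.
    exact: measurable_int intf.
  + apply/disj_setPS; rewrite preimage_setC => x /= [[_ ?] [_ ?]].
    by contradiction.
- move=> F mF tF fF; rewrite preimage_bigcup setI_bigcupr integral_bigcup.
  + by apply: eseries0 => i _ _; exact: fF.
  + apply: trivIset_setIl => i j _ _ [x [Fi Fj]].
    by apply: tF => //; exists (p x).
  + by move=> k; exact: mpA.
  + apply: integrableS intf => //; last by move=> x [? _ []].
    by apply: bigcup_measurable => k _; exact: mpA.
Qed.

End IntegralGeneralities.

(** * Null sets and open sets of the plane *)

(* The type of [lebesgue_measure] carries the same sigma-algebra as [R], under
   another display. *)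
Notation mplane R := (measurableTypeR R * measurableTypeR R)%type (only parsing).

Section PlaneSets.
Variable R : realType.
Implicit Types (U : set (plane R)) (q : (R * R) * (R * R)).
Local Notation mu := (@lebesgue_measure R).

Definition obox q : set (plane R) := `]q.1.1, q.1.2[ `*` `]q.2.1, q.2.2[.
Definition cbox q : set (plane R) := `[q.1.1, q.1.2] `*` `[q.2.1, q.2.2].

Lemma obox_cbox q : obox q `<=` cbox q.
Proof.
by move=> x /= [x1 x2]; split; exact: subset_itv_oo_cc.
Qed.

Lemma open_obox q : open (obox q).
Proof.
have -> : obox q = (fst @^-1` `]q.1.1, q.1.2[) `&` (snd @^-1` `]q.2.1, q.2.2[).
  by [].
apply: openI; apply: open_comp => //= x _; first exact: cvg_fst.
exact: cvg_snd.
Qed.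

Lemma compact_cbox q : compact (cbox q).
Proof. by apply: compact_setX; exact: segment_compact. Qed.

Lemma measurable_obox q : measurable (obox q : set (mplane R)).
Proof. by apply: measurableX; exact: measurable_itv. Qed.

Lemma leb2_obox_fin q : (leb2 R (obox q) < +oo)%E.
Proof.
rewrite product_measure1E; [|exact: measurable_itv..].
have fin (a b : R) : (mu `]a, b[%classic < +oo)%E.
  by rewrite lebesgue_measure_itv; case: ifP => _; rewrite ltry.
apply: lte_mul_pinfty; [exact: measure_ge0| |exact: fin].
by rewrite ge0_fin_numE; [exact: fin|exact: measure_ge0].
Qed.

Lemma nbhs_obox (x : plane R) U : nbhs x U ->
  exists2 e, 0 < e & cbox ((x.1 - e, x.1 + e), (x.2 - e, x.2 + e)) `<=` U.
Proof.
move=> /nbhs_ballP [e /= e0 xeU]; exists (e / 2); first by rewrite divr_gt0.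
move=> y [] /=; rewrite !in_itv /= => y1 y2; apply: xeU; split => /=;
  rewrite /ball /= ltr_distl; lra.
Qed.

Lemma open_cover_obox U : open U -> exists q : nat -> (R * R) * (R * R),
  (forall n, cbox (q n) `<=` U) /\ U = \bigcup_n obox (q n).
Proof.
move=> oU.
(* Boxes with rational corners. An index that codes no box, or a box not inside [U], gets the empty
   box with sides from [1] to [0]. *)
pose r (n : nat) : (R * R) * (R * R) := if @unpickle ((rat * rat) * (rat * rat))%type n is Some s then
  ((ratr s.1.1, ratr s.1.2), (ratr s.2.1, ratr s.2.2)) else ((1, 0), (1, 0)).
pose q n := if `[<cbox (r n) `<=` U>] then r n else ((1, 0), (1, 0)) : (R * R) * (R * R).
have q0 : cbox ((1, 0), (1, 0)) `<=` U.
  by move=> x [] /=; rewrite in_itv/=; lra.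
have qU n : cbox (q n) `<=` U by rewrite /q; case: asboolP.
exists q; split => //; apply/seteqP; split; last first.
  by move=> x [n _ /obox_cbox]; exact: qU.
move=> x Ux; have [e e0 eU] := nbhs_obox (open_nbhs_nbhs (conj oU Ux)).
have [a1] : exists a, ratr a \in `]x.1 - e, x.1[ by apply: rat_in_itvoo; lra.
have [b1] : exists a, ratr a \in `]x.1, x.1 + e[ by apply: rat_in_itvoo; lra.
have [a2] : exists a, ratr a \in `]x.2 - e, x.2[ by apply: rat_in_itvoo; lra.
have [b2] : exists a, ratr a \in `]x.2, x.2 + e[ by apply: rat_in_itvoo; lra.
rewrite !in_itv /= => hb2 ha2 hb1 ha1.
exists (pickle ((a1, b1), (a2, b2))) => //.
rewrite /q /r pickleK /=; case: asboolP => [_|[]].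
  by split => /=; rewrite in_itv /=; lra.
apply: subset_trans eU => y []; rewrite /= !in_itv /= => y1 y2.
by split => /=; rewrite in_itv /=; lra.
Qed.

Lemma open_measurable_plane U : open U -> measurable (U : set (mplane R)).
Proof.
move=> /open_cover_obox [q [_ ->]].
by apply: bigcupT_measurable => n; exact: measurable_obox.
Qed.

Lemma ae_bigcup_in d (T : measurableType d) (m : {measure set T -> \bar R})
    (D : nat -> set T) (P : T -> Prop) :
  (forall n, {ae m, forall x, D n x -> P x}) ->
  {ae m, forall x, (\bigcup_n D n) x -> P x}.
Proof.
move=> /ae_foralln; apply: filterS => x Dx [n _ Dnx]; exact: Dx Dnx.
Qed.

End PlaneSets.

(** * Functions whose integrals over half-open intervals or rectangles vanish *)

Section FundamentalSets.
Variable R : realType.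
Local Notation mu := (@lebesgue_measure R).

Lemma ocitv_setI_closed : setI_closed (@ocitv R).
Proof.
move=> _ _ [[a b] _ <-] [[c e] _ <-]; exists (Num.max a c, Num.min b e) => //=.
apply/seteqP; split => x /=; rewrite !in_itv /= gt_max le_min.
  by move=> /andP[/andP[-> ->] /andP[-> ->]].
by move=> [/andP[-> ->] /andP[-> ->]].
Qed.

Lemma ae0_of_ocitv a b (f : R -> R) : mu.-integrable `]a, b[ (EFin \o f) ->
  (forall c e, \int[mu]_(x in `]a, b[ `&` `]c, e]) f x = 0) ->
  {ae mu, forall x, `]a, b[%classic x -> f x = 0}.
Proof.
move=> intf f0; have mab : measurable (`]a, b[%classic : set R) by exact: measurable_itv.
have f0E c e : (\int[mu]_(x in `]a, b[ `&` `]c, e]) (f x)%:E = 0)%E.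
  rewrite -[LHS]fineK; first by move: (f0 c e); rewrite /Rintegral => ->.
  apply: integrable_fin_num; first by apply: measurableI => //; exact: measurable_itv.
  apply: integrableS intf => //; apply: measurableI => //; exact: measurable_itv.
have Df := @integral_dynkin _ _ _ mu _ R (@ocitv R) id `]a, b[ (EFin \o f) erefl
  ocitv_setI_closed (@measurable_id _ _ _) mab intf.
have : ae_eq mu `]a, b[%classic (EFin \o f) (cst 0%E).
  apply: integral_ae_eq => // E Eab mE; rewrite integral0.
  rewrite -(setIidr Eab); apply: Df => //.
  - by have := f0E a b; rewrite setIidl// => x /=; rewrite !in_itv/=; lra.
  - by move=> _ [[c e] _ <-]; exact: f0E.
by apply: filterS => x fx /fx [].
Qed.

(** Two one-dimensional Dynkin arguments replace first one and then the other half-open side by an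
    arbitrary measurable set; the resulting rectangles are a pi-system generating the product
    sigma-algebra. *)
Lemma ae0_of_ocitv2 q (f : plane R -> R) :
  (leb2 R).-integrable (obox q) (EFin \o f) ->
  (forall c e c' e',
    \int[leb2 R]_(x in obox q `&` (`]c, e] `*` `]c', e'])) f x = 0) ->
  {ae leb2 R, forall x, obox q x -> f x = 0}.
Proof.
move=> intf f0; have mq := measurable_obox q.
have f0E c e c' e' :
    (\int[leb2 R]_(x in obox q `&` (`]c, e] `*` `]c', e'])) (f x)%:E = 0)%E.
  have mI : measurable (obox q `&` (`]c, e] `*` `]c', e']) : set (mplane R)).
    by apply: measurableI => //; apply: measurableX; exact: measurable_itv.
  rewrite -[LHS]fineK; first by move: (f0 c e c' e'); rewrite /Rintegral => ->.
  apply: integrable_fin_num => //; apply: integrableS intf => //.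
have f1 (A : set (measurableTypeR R)) c' e' : measurable A ->
    (\int[leb2 R]_(x in obox q `&` (A `*` `]c', e'])) (f x)%:E = 0)%E.
  have mqq : measurable (obox q `&` snd @^-1` `]c', e'] : set (mplane R)).
    by rewrite -setTX; apply: measurableI => //; apply: measurableX => //.
  have Df := @integral_dynkin _ _ _ (leb2 R) _ (measurableTypeR R) (@ocitv R) fst
    (obox q `&` snd @^-1` `]c', e']) (EFin \o f) erefl
    ocitv_setI_closed measurable_fst mqq (integrableS mq mqq (@subIsetl _ _ _) intf).
  have XE B : obox q `&` (B `*` `]c', e']) = obox q `&` snd @^-1` `]c', e'] `&` fst @^-1` B.
    by apply/seteqP; split => x /=; [move=> [? [? ?]]|move=> [[? ?] ?]].
  move=> mA; rewrite XE; apply: Df => //; last first.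
    by move=> _ [[c e] _ <-]; rewrite -XE; exact: f0E.
  have := f0E q.1.1 q.1.2 c' e'; congr (_ = _); congr integral.
  apply/seteqP; split => x /=; first by move=> [? [? ?]].
  by move=> [[x1 x2] ?]; split => //; split => //; exact: subset_itv_oo_oc.
have f2 (A B : set (measurableTypeR R)) : measurable A -> measurable B ->
    (\int[leb2 R]_(x in obox q `&` (A `*` B)) (f x)%:E = 0)%E.
  move=> mA mB.
  have mqq : measurable (obox q `&` fst @^-1` A : set (mplane R)).
    by rewrite -setXT; apply: measurableI => //; apply: measurableX => //.
  have Df := @integral_dynkin _ _ _ (leb2 R) _ (measurableTypeR R) (@ocitv R) snd
    (obox q `&` fst @^-1` A) (EFin \o f) erefl
    ocitv_setI_closed measurable_snd mqq (integrableS mq mqq (@subIsetl _ _ _) intf).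
  have XE B' : obox q `&` (A `*` B') = obox q `&` fst @^-1` A `&` snd @^-1` B'.
    by apply/seteqP; split => x /=; [move=> [? [? ?]]|move=> [[? ?] ?]].
  rewrite XE; apply: Df => //; last first.
    by move=> _ [[c e] _ <-]; rewrite -XE; exact: f1.
  have := f1 A q.2.1 q.2.2 mA; congr (_ = _); congr integral.
  apply/seteqP; split => x /=; first by move=> [? [? ?]].
  by move=> [[x1 x2] ?]; split => //; split => //; exact: subset_itv_oo_oc.
have Df := @integral_dynkin _ _ _ (leb2 R) _ _ _ id (obox q) (EFin \o f)
  (@measurable_prod_measurableType _ _ (measurableTypeR R) (measurableTypeR R)) _ (@measurable_id _ _ _) mq intf.
have : ae_eq (leb2 R) (obox q) (EFin \o f) (cst 0%E).
  apply: integral_ae_eq => // E Eq mE; rewrite integral0.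
  rewrite -(setIidr Eq); apply: Df => //.
  - move=> _ _ [A1 mA1 [B1 mB1 <-]] [A2 mA2 [B2 mB2 <-]]; rewrite -setXI.
    by exists (A1 `&` A2); [exact: measurableI|exists (B1 `&` B2) => //; exact: measurableI].
  - by have := f2 setT setT measurableT measurableT; rewrite setXTT setIT.
  - by move=> _ [A mA [B mB <-]]; exact: f2.
by apply: filterS => x fx /fx [].
Qed.

End FundamentalSets.

(** * Test functions *)

Section SmoothFunctions.
Variable R : realType.
Implicit Types (g h : R -> R) (p : {poly R}).

(** The derivatives are existential, so closure under sums and products is an induction on [n]
    without formulas for higher derivatives. *)
Fixpoint nderivable (n : nat) g : Prop :=
  if n is n'.+1 then exists g' : R -> R, (forall x, is_derive x (1 : R) g (g' x : R)) /\ nderivable n' g'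
  else True.

Lemma nderivableW n g : nderivable n.+1 g -> nderivable n g.
Proof.
elim: n g => // n IH g [g' [dg Dg]]; exists g'; split => //; exact: IH.
Qed.

Lemma nderivable_cst n (c : R) : nderivable n (fun=> c).
Proof.
elim: n c => // n IH c; exists (fun=> 0); split => // x; exact: is_derive_cst.
Qed.

Lemma nderivableD n g h : nderivable n g -> nderivable n h -> nderivable n (fun x => g x + h x).
Proof.
elim: n g h => // n IH g h [g' [dg Dg]] [h' [dh Dh]].
exists (fun x => g' x + h' x); split; last exact: IH.
by move=> x; exact: is_deriveD.
Qed.

Lemma nderivableM n g h : nderivable n g -> nderivable n h -> nderivable n (fun x => g x * h x).
Proof.
elim: n g h => // n IH g h Dg Dh; have [g' [dg Dg']] := Dg.
have [h' [dh Dh']] := Dh.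
exists (fun x => g x * h' x + h x * g' x); split.
  by move=> x; exact: is_deriveM.
by apply: nderivableD; apply: IH => //; exact: nderivableW.
Qed.

Lemma nderivable_affine n g (a b : R) : nderivable n g -> nderivable n (fun x => g (a * x + b)).
Proof.
elim: n g => // n IH g [g' [dg Dg]].
exists (fun x => g' (a * x + b) * a); split; last first.
  by apply: nderivableM; [exact: IH|exact: nderivable_cst].
move=> x; apply: is_derive1_comp.
have H : is_derive x (1 : R) (fun y : R => a * y + b) (a *: (1 : R) + 0).
  by apply: is_deriveD; apply: is_deriveZ.
by apply: (is_derive_eq H); rewrite addr0 /GRing.scale /= mulr1.
Qed.

(** The functions p(1/x) exp(-1/x), extended by [0]: a family closed under differentiation, the
    derivative belonging to the polynomial X^2 (p - p'). *)
Definition expinv p (x : R) : R :=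
  if 0 < x then p.[x^-1] * expR (- x^-1) else 0.

(** With y = 1/x >= 1 and m = [size p], |p(y)| is at most a constant times y^m, whereas exp(-y) is
    at most (m+2)!/y^(m+2); a factor x^2 is left. Hence the difference quotient at the origin tends
    to [0]. *)
Let expinv_bound p : exists2 C, 0 <= C &
  forall x : R, `|x| < 1 -> `|expinv p x| <= C * x ^+ 2.
Proof.
pose m := size p.
exists ((\sum_(i < m) `|p`_i|) * (m.+2)`!%:R).
  by rewrite mulr_ge0// sumr_ge0.
move=> x x1; rewrite /expinv; case: ifPn => x0; last first.
  by rewrite normr0 mulr_ge0 ?sqr_ge0// mulr_ge0// sumr_ge0.
have xlt1 : x < 1 by move: x1; rewrite gtr0_norm.
have y1 : 1 <= x^-1 by rewrite invf_ge1// ltW.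
rewrite normrM (gtr0_norm (expR_gt0 _)).
have pb : `|p.[x^-1]| <= (\sum_(i < m) `|p`_i|) * x^-1 ^+ m.
  rewrite horner_coef (le_trans (ler_norm_sum _ _ _))// mulr_suml.
  apply: ler_sum => i _; rewrite normrM ler_wpM2l// normrX ger0_norm ?invr_ge0 ?(ltW x0)//.
  by apply: ler_weXn2l => //; rewrite ltnW.
have eb : expR (- x^-1) <= (m.+2)`!%:R * x ^+ m.+2.
  have := expR_ge1Dxn m.+1 (ltW (lt_le_trans ltr01 y1)).
  move=> H; rewrite expRN -[leRHS]invrK lef_pV2 ?posrE ?expR_gt0//; last first.
    by rewrite invr_gt0 mulr_gt0 ?exprn_gt0// ltr0n fact_gt0.
  apply: le_trans H; rewrite invfM -exprVn mulrC.
  by rewrite lerDr.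
apply: le_trans (ler_pM (normr_ge0 _) (expR_ge0 _) pb eb) _.
rewrite -!mulrA ler_wpM2l ?sumr_ge0// mulrCA ler_wpM2l//.
by rewrite -addn2 exprD mulrA -exprMn mulVf ?expr1n ?mul1r// gt_eqF.
Qed.

Let is_derive_expinv p (x : R) :
  is_derive x (1 : R) (expinv p) (expinv ('X^2 * (p - p^`())) x).
Proof.
have [x0|x0|->] := ltgtP x 0.
- apply: (@near_eq_is_derive _ _ _ (cst (0 : R))); last first.
    by rewrite /expinv ltNge (ltW x0); exact: is_derive_cst.
  by near=> y; rewrite /expinv ifF//; apply/negbTE; rewrite -leNgt; near: y;
    exact: lt_le_nbhsl.
- apply: (@near_eq_is_derive _ _ _ (fun y : R => p.[y^-1] * expR (- y^-1) : R)).
    by near=> y; rewrite /expinv ifT//; near: y; exact: lt_nbhsr.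
  have xn0 : x != 0 by rewrite gt_eqF.
  have dV : is_derive x (1 : R) (fun y : R => y^-1) (- x ^- 2 *: 1).
    exact: is_deriveV.
  have dp : is_derive x (1 : R) (fun y : R => p.[y^-1]) (p^`().[x^-1] * (- x ^- 2 *: 1)).
    exact: is_derive1_comp.
  have de : is_derive x (1 : R) (fun y : R => expR (- y^-1)) (expR (- x^-1) * - (- x ^- 2 *: 1)).
    apply: is_derive1_comp.
  apply: (is_derive_eq (is_deriveM dp de)).
  rewrite /expinv x0 !hornerE /= /GRing.scale /= exprVn; ring.
- rewrite {2}/expinv ltxx.
  have [C C0 HC] := expinv_bound p.
  have e0 : expinv p 0 = 0 by rewrite /expinv ltxx.
  have c : h^-1 *: (expinv p (h *: 1 + 0) - expinv p 0) @[h --> 0^'] --> (0 : R).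
    apply: norm_cvg0; apply: (@squeeze_cvgr _ _ _ _ (cst 0) (fun h : R => C * `|h|)).
    + near=> h; rewrite normr_ge0 /= e0 subr0 addr0 /GRing.scale /= mulr1 normrM normfV.
      have h1 : `|h| < 1 by near: h; exact: dnbhs0_lt.
      have h0 : h != 0 by near: h; exact: nbhs_dnbhs_neq.
      rewrite ler_pdivrMl ?normr_gt0// mulrCA -expr2 real_normK ?num_real//.
      exact: HC.
    + exact: cvg_cst.
    + rewrite -[X in _ --> X](mulr0 C); apply: cvgMr.
      rewrite -[X in _ --> X](@normr0 _ R); apply: cvg_norm.
      exact: nbhs_dnbhs.
  apply: DeriveDef; first by apply/cvg_ex; exists 0.
  exact/cvg_lim.
Unshelve. all: by end_near. Qed.

Lemma nderivable_expinv n p : nderivable n (expinv p).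
Proof. by elim: n p => // n IH p; eexists; split; [exact: is_derive_expinv|]. Qed.

Definition bump : R -> R := expinv 1.

Lemma bumpE x : bump x = if 0 < x then expR (- x^-1) else 0.
Proof. by rewrite /bump /expinv hornerE mul1r. Qed.

Lemma bump01 x : 0 <= bump x <= 1.
Proof.
rewrite bumpE; case: ifP => [x0|_]; last by rewrite lexx ler01.
by rewrite expR_ge0 -expR0 ler_expR oppr_le0 invr_ge0 ltW.
Qed.

Lemma bump_le0 x : x <= 0 -> bump x = 0.
Proof. by move=> x0; rewrite bumpE ltNge x0. Qed.

Lemma nderivable_bump n : nderivable n bump.
Proof. exact: nderivable_expinv. Qed.

Lemma cvg_bump (c d : R) : 0 < c ->
  bump (n%:R * c - d) @[n --> \oo] --> (1 : R).
Proof.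
move=> c0.
have cy : n%:R * c - d @[n --> \oo] --> +oo.
  apply/cvgryPge => A; near=> n.
  rewrite lerBrDr -ler_pdivrMr//; near: n; exact: nbhs_infty_ger.
suff : bump (n%:R * c - d) @[n --> \oo] --> expR (- 0 : R) by rewrite oppr0 expR0.
have cV : - (n%:R * c - d)^-1 @[n --> \oo] --> (- 0 : R).
  apply: cvgN; apply/(gtr0_cvgV0 _).2 => //.
  by near=> n; near: n; exact: cvgry_gt.
have := cvg_comp _ _ cV (@continuous_expR R (- 0)).
apply: cvg_trans; apply: near_eq_cvg; near=> n.
rewrite bumpE ifT//; near: n; exact: cvgry_gt.
Unshelve. all: by end_near. Qed.

Lemma nderivable_continuous n g : nderivable n.+1 g -> continuous g.
Proof.
move=> [g' [dg _]] x; apply/differentiable_continuous.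
by apply/derivable1_diffP; case: (dg x).
Qed.

Lemma nderivable_smooth1 g : (forall n, nderivable n g) -> smooth1 g.
Proof.
move=> Dg n.
have H m h : nderivable m.+2 h -> (forall i s, (i < m.+1)%N -> derivable (derive1n i h) s 1) /\
    (forall i, (i <= m)%N -> continuous (derive1n i h)).
  elim: m h => [|m IH] h Dh.
    have [h' [dh Dh']] := Dh; split.
      by case=> // s _; case: (dh s).
    by case => // _; exact: nderivable_continuous (nderivableW Dh).
  have [h' [dh Dh']] := Dh.
  have hE : derive1 h = h' by apply/funext => x; rewrite derive1E; case: (dh x).
  have [I1 I2] := IH _ Dh'.
  split=> [[|i] s im|[|i] im].
  - by case: (dh s).
  - by rewrite derive1Sn hE; exact: I1.
  - exact: nderivable_continuous Dh.
  - by rewrite derive1Sn hE; exact: I2.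
have [H1 H2] := H n g (Dg _); split=> [m s mn|m mn]; [apply: H1|exact: H2].
exact: ltnW.
Qed.

End SmoothFunctions.

(** * Partial derivatives along coordinate lines *)

Section PlaneCalculus.
Variable R : realType.
Implicit Types (g : plane R -> R) (x y : plane R) (m : 'I_2).

(* The point with [m]-th coordinate [z] and other coordinate [p]. *)
Definition mkcoord m (p z : R) : plane R := if m == ord0 then (z, p) else (p, z).
Definition ocoord m x : R := if m == ord0 then x.2 else x.1.

Lemma coord_mkcoord m p z : coord m (mkcoord m p z) = z.
Proof. by rewrite /coord /mkcoord; case: (m == ord0). Qed.

Lemma ocoord_mkcoord m p z : ocoord m (mkcoord m p z) = p.
Proof. by rewrite /ocoord /mkcoord; case: (m == ord0). Qed.

Lemma mkcoordK m x : mkcoord m (ocoord m x) (coord m x) = x.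
Proof. by rewrite /coord /ocoord /mkcoord; case: (m == ord0); case: x. Qed.

Lemma mkcoord_shift m p z h : h *: ebase R m + mkcoord m p z = mkcoord m p (h + z).
Proof.
rewrite /mkcoord /ebase; case: (m == ord0);
  by congr pair; rewrite /= /GRing.scale /= ?mulr1 ?mulr0 ?add0r.
Qed.

(** The two difference quotients are the same function of [h], so a partial derivative is a
    derivative in one variable along a coordinate line. *)
Lemma quot_line m g p z :
  (fun h => h^-1 *: (g (h *: ebase R m + mkcoord m p z) - g (mkcoord m p z))) =
  (fun h => h^-1 *: (g (mkcoord m p (h *: 1 + z)) - g (mkcoord m p z))).
Proof. by apply/funext => h; rewrite mkcoord_shift /GRing.scale /= mulr1. Qed.

Lemma derivable_line m g p z :
  derivable g (mkcoord m p z) (ebase R m) = derivable (fun t => g (mkcoord m p t)) z 1.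
Proof. by rewrite /derivable quot_line. Qed.

Lemma derive_line m g p z :
  'D_(ebase R m) g (mkcoord m p z) = 'D_1 (fun t => g (mkcoord m p t)) z.
Proof. by rewrite /derive quot_line. Qed.

Lemma is_derive_line m g p z d :
  is_derive (mkcoord m p z) (ebase R m) g d <-> is_derive z 1 (fun t => g (mkcoord m p t)) d.
Proof.
split=> -[dg gd]; apply: DeriveDef.
- by rewrite -derivable_line.
- by rewrite -derive_line.
- by rewrite derivable_line.
- by rewrite derive_line.
Qed.

Lemma differentiable_fst x : differentiable (fst : plane R -> R) x.
Proof.
by apply: (@linear_differentiable _ _ _ (fst : {linear (plane R) -> R})) => y; exact: cvg_fst.
Qed.

Lemma differentiable_snd x : differentiable (snd : plane R -> R) x.
Proof.
by apply: (@linear_differentiable _ _ _ (snd : {linear (plane R) -> R})) => y; exact: cvg_snd.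
Qed.

Lemma differentiable_Dn n (a : R -> R) t : nderivable n.+1 a -> differentiable a t.
Proof. by move=> [a' [da _]]; apply/derivable1_diffP; case: (da t). Qed.

Lemma differentiable_tensor n (a b : R -> R) x : nderivable n.+1 a -> nderivable n.+1 b ->
  differentiable (fun y : plane R => a y.1 * b y.2) x.
Proof.
move=> Da Db; apply: (@differentiableM _ _ (a \o fst) (b \o snd)).
- by apply: differentiable_comp; [exact: differentiable_fst|exact: differentiable_Dn Da].
- by apply: differentiable_comp; [exact: differentiable_snd|exact: differentiable_Dn Db].
Qed.

(** Partial derivatives of a tensor product are tensor products again. The extra order [n.+1] is
    spent in the base case, where continuity comes from differentiability. *)
Lemma Ck_tensor n (a b : R -> R) : nderivable n.+1 a -> nderivable n.+1 b ->
  Ck n setT (fun x : plane R => a x.1 * b x.2).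
Proof.
elim: n a b => [|n IH] a b Da Db /=.
  by move=> x _; apply: differentiable_continuous; exact: differentiable_tensor Da Db.
split; first by move=> x _; exact: differentiable_tensor Da Db.
have [a' [da Da']] := Da; have [b' [db Db']] := Db.
move=> m; have [->|m0] := eqVneq m ord0.
  rewrite (_ : (fun x => _) = (fun x : plane R => a' x.1 * b x.2)).
    by apply: IH => //; exact: nderivableW.
  apply/funext => -[u v]; have /= -> := derive_line ord0 (fun x => a x.1 * b x.2) v u.
  apply: derive_val; apply: (is_derive_eq (is_deriveM (da u) (is_derive_cst (b v) _ _))).
  by rewrite scaler0 add0r mulrC.
rewrite (_ : (fun x => _) = (fun x : plane R => a x.1 * b' x.2)).
  by apply: IH => //; exact: nderivableW.
apply/funext => -[u v]; have := derive_line m (fun x => a x.1 * b x.2) u v.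
rewrite /mkcoord (negbTE m0) /= => ->.
by apply: derive_val; apply: (is_derive_eq (is_deriveM (is_derive_cst (a u) _ _) (db v)));
  rewrite scaler0 addr0.
Qed.

Lemma smooth_tensor (a b : R -> R) : (forall n, nderivable n a) -> (forall n, nderivable n b) ->
  smooth (fun x : plane R => a x.1 * b x.2).
Proof. by move=> Da Db n; apply: Ck_tensor. Qed.

Lemma measurable_plane (U : set (plane R)) g : open U ->
  (forall x, U x -> {for x, continuous g}) ->
  measurable_fun (U : set (mplane R)) g.
Proof.
move=> oU cg mU; apply: (measurability _ (RGenOpens.measurableE R)); [|exact: mU].
move=> _ [_ [a [b ->] <-]]; apply: open_measurable_plane.
rewrite openE => x [Ux gx]; apply: filterI; first exact: open_nbhs_nbhs.
by apply: cg => //; apply: open_nbhs_nbhs; split => //; exact: interval_open.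
Qed.

End PlaneCalculus.

(** * From test functions to indicator functions *)

Section DominatedZero.
Context d (T : measurableType d) (R : realType).
Variable mu : {measure set T -> \bar R}.

(** Dominated convergence with majorant [|f|]: test functions bounded by [1] that converge to an
    indicator may be replaced by it. *)
Lemma Rintegral_dct0 (D A : set T) (f : T -> R) (psi : nat -> T -> R) :
  measurable D -> measurable A -> mu.-integrable D (EFin \o f) ->
  (forall n, measurable_fun D (psi n)) ->
  (forall n x, D x -> `|psi n x| <= 1) ->
  (forall x, D x -> psi n x @[n --> \oo] --> (\1_A x : R)) ->
  (forall n, \int[mu]_(x in D) (f x * psi n x) = 0) ->
  \int[mu]_(x in D `&` A) f x = 0.
Proof.
move=> mD mA intf mpsi psi1 psicvg psi0.
have mf : measurable_fun D f by apply/measurable_EFinP; exact: measurable_int intf.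
have mfpsi n : measurable_fun D (EFin \o (fun x => f x * psi n x)).
  by apply/measurable_EFinP; exact: measurable_funM.
have [] := @dominated_convergence _ _ _ mu D mD (fun n => EFin \o (fun x => f x * psi n x))
   (EFin \o (fun x => f x * \1_A x)) (EFin \o (fun x => `|f x|)) mfpsi.
- apply/measurable_EFinP; apply: measurable_funM => //.
- apply: aeW => x Dx; apply: cvg_EFin; first by apply: nearW.
  by apply: cvgMr; exact: psicvg.
- by have := integrable_abse intf; congr (integrable _ _ _).
- apply: aeW => x n Dx; rewrite /= lee_fin normrM ler_piMr//; exact: psi1.
move=> intf1 _ cv; rewrite Rintegral_mkcondr.
have fin n : (\int[mu]_(x in D) (f x * psi n x)%:E = 0)%E.
  rewrite -[LHS]fineK; first by have := psi0 n; rewrite /Rintegral => ->.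
  apply: integrable_fin_num => //.
  apply: (le_integrable mD _ _ (integrable_abse intf)); first exact: mfpsi.
  by move=> x Dx /=; rewrite lee_fin normrM normr_id ler_piMr//; exact: psi1.
have /cvg_lim : [sequence (\int[mu]_(x in D) (f x * psi n x)%:E)%E]_n @ \oo --> 0%E.
  by rewrite (_ : [sequence _]_n = cst 0%E); [exact: cvg_cst|exact/funext].
move/cvg_lim : cv => -> // h0; rewrite /Rintegral.
rewrite (_ : (\int[mu]_(x in D) _)%E = 0%E) //.
rewrite -h0//; apply: eq_integral => x _ /=; congr EFin.
by rewrite patchE indicE; case: (x \in A); rewrite ?mulr1 ?mulr0.
Qed.

End DominatedZero.

(** * Smooth approximations of indicators of intervals *)

Section TestFunctions.
Variable R : realType.
Implicit Types (a b c e x : R) (n : nat).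

(** The arguments of [bump] are n(x - a) - 1 and n(b - x) - 1. For n > 0 the shift by [1] keeps the
    support inside [a + 1/n, b - 1/n], compact in ]a, b[, while [theta] tends to [1] at each point
    of ]a, b[. *)
Definition theta a b n x : R := bump (n%:R * x - (n%:R * a + 1)) *
  bump ((- n%:R) * x + (n%:R * b - 1)).

(* Approximates the indicator function of ]c, e]. *)
Definition ocstep c e n x : R := bump (n%:R * x - (n%:R * c + 1)) *
  (1 - bump (n%:R * x - n%:R * e)).

Lemma nderivable_theta a b n k : nderivable k (theta a b n).
Proof. by apply: nderivableM; apply: nderivable_affine; exact: nderivable_bump. Qed.

Lemma nderivable_ocstep c e n k : nderivable k (ocstep c e n).
Proof.
apply: nderivableM; first by apply: nderivable_affine; exact: nderivable_bump.
rewrite (_ : (fun x => _) = (fun x => 1 + (-1) * bump (n%:R * x + (- (n%:R * e))))); last first.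
  by apply/funext => x; rewrite mulN1r.
apply: nderivableD; first exact: nderivable_cst.
by apply: nderivableM; [exact: nderivable_cst|apply: nderivable_affine; exact: nderivable_bump].
Qed.

Lemma theta01 a b n x : 0 <= theta a b n x <= 1.
Proof.
rewrite /theta; set u := bump _; set v := bump _.
have /andP[u0 u1] : 0 <= u <= 1 by exact: bump01.
have /andP[v0 v1] : 0 <= v <= 1 by exact: bump01.
by rewrite mulr_ge0//= mulr_ile1.
Qed.

Lemma ocstep01 a b n x : 0 <= ocstep a b n x <= 1.
Proof.
rewrite /ocstep; set u := bump _; set v := bump _.
have /andP[u0 u1] : 0 <= u <= 1 by exact: bump01.
have /andP[v0 v1] : 0 <= v <= 1 by exact: bump01.
by rewrite mulr_ge0 ?subr_ge0//= mulr_ile1 ?subr_ge0//; lra.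
Qed.

Lemma norm_mul_le1 (u v : R) : `|u| <= 1 -> `|v| <= 1 -> `|u * v| <= 1.
Proof. by move=> u1 v1; rewrite normrM mulr_ile1. Qed.

Lemma norm_theta_le1 a b n x : `|theta a b n x| <= 1.
Proof. by have /andP[t0 t1] := theta01 a b n x; rewrite ger0_norm. Qed.

Lemma norm_ocstep_le1 a b n x : `|ocstep a b n x| <= 1.
Proof. by have /andP[t0 t1] := ocstep01 a b n x; rewrite ger0_norm. Qed.

Lemma theta_supp a b n x : x \notin `[a + n%:R^-1, b - n%:R^-1] -> theta a b n x = 0.
Proof.
case: n => [_|n].
  by rewrite /theta bump_le0 ?mul0r// !mul0r add0r sub0r lerN10.
rewrite in_itv /= => /negP H; rewrite /theta.
have n0 : (0 : R) < n.+1%:R by [].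
have [h|h] := ltP x (a + n.+1%:R^-1).
  rewrite bump_le0 ?mul0r// subr_le0.
  have : n.+1%:R * x < n.+1%:R * (a + n.+1%:R^-1) by rewrite ltr_pM2l.
  by rewrite mulrDr divff ?gt_eqF// => /ltW.
rewrite [X in _ * X]bump_le0 ?mulr0//.
have {}H : b - n.+1%:R^-1 < x by rewrite ltNge; apply/negP => h2; apply: H; rewrite h h2.
have : n.+1%:R * (b - n.+1%:R^-1) < n.+1%:R * x by rewrite ltr_pM2l.
rewrite mulrBr divff ?gt_eqF//; lra.
Qed.

Lemma theta_itv a b n :
  exists a' b' : R, `[a', b'] `<=` `]a, b[%classic /\
    forall x, x \notin `[a', b'] -> theta a b n x = 0.
Proof.
case: n => [|n].
  (* For [n = 0] the function vanishes identically, so the empty interval from [1] to [0] will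
     do. *)
  exists 1, 0; split => [x /=|x _]; first by rewrite in_itv/=; lra.
  by rewrite /theta bump_le0 ?mul0r// !mul0r add0r sub0r lerN10.
exists (a + n.+1%:R^-1), (b - n.+1%:R^-1); split; last by move=> x; exact: theta_supp.
have : (0 : R) < n.+1%:R^-1 by rewrite invr_gt0.
move: (n.+1%:R^-1 : R) => u u0.
move=> x /=; rewrite !in_itv /= => ?; lra.
Qed.

Lemma theta_cvg a b x : a < x < b -> theta a b n x @[n --> \oo] --> (1 : R).
Proof.
move=> /andP[ax xb]; rewrite -[X in _ --> X]mulr1; apply: cvgM.
- rewrite (_ : (fun n => _) = (fun n => bump (n%:R * (x - a) - 1))).
    by apply: cvg_bump; rewrite subr_gt0.
  by apply/funext => n; congr bump; ring.
- rewrite (_ : (fun n => _) = (fun n => bump (n%:R * (b - x) - 1))).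
    by apply: cvg_bump; rewrite subr_gt0.
  by apply/funext => n; congr bump; ring.
Qed.

(** The end points decide the shape: at [c] the first [bump] has argument [-1] and at [e] the second
    has argument [0], so both vanish there, and the limit interval is open at [c] and closed at
    [e]. *)
Lemma ocstep_cvg c e x :
  ocstep c e n x @[n --> \oo] --> (\1_(`]c, e] : set R) x : R).
Proof.
rewrite indicE; have [xc|cx] := leP x c.
  rewrite memNset /=; last by rewrite in_itv /= ltNge xc.
  rewrite (_ : (fun n => _) = cst (0 : R)); first exact: cvg_cst.
  apply/funext => n; rewrite /ocstep bump_le0 ?mul0r//.
  have : n%:R * x <= n%:R * c by rewrite ler_wpM2l.
  by move: (n%:R * x) (n%:R * c) => ? ?; lra.
have B1 : bump (n%:R * x - (n%:R * c + 1)) @[n --> \oo] --> (1 : R).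
  rewrite (_ : (fun n => _) = (fun n => bump (n%:R * (x - c) - 1))).
    by apply: cvg_bump; rewrite subr_gt0.
  by apply/funext => n; congr bump; ring.
have [xe|ex] := leP x e.
  rewrite mem_set /=; last by rewrite in_itv /= cx xe.
  rewrite -[X in _ --> X]mulr1; apply: cvgM => //.
  rewrite (_ : (fun n => _) = cst (1 : R)); first exact: cvg_cst.
  apply/funext => n; rewrite bump_le0 ?subr0//.
  by rewrite subr_le0 ler_wpM2l.
rewrite memNset /=; last by rewrite in_itv /= [x <= e]leNgt ex andbF.
rewrite -[X in _ --> X](mulr0 (1 : R)); apply: cvgM => //.
rewrite -[X in _ --> X](subrr (1 : R)); apply: cvgB; first exact: cvg_cst.
rewrite (_ : (fun n => _) = (fun n => bump (n%:R * (x - e) - 0))).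
  by apply: cvg_bump; rewrite subr_gt0.
by apply/funext => n; congr bump; ring.
Qed.

End TestFunctions.

(** * Weak derivatives *)

Section SquareIntegrable.
Context d (T : measurableType d) (R : realType).
Variable mu : {measure set T -> \bar R}.
Implicit Types (D E : set T) (f g h : T -> R).

Lemma L2_sub D E g : measurable D -> measurable E -> E `<=` D ->
  L2 mu D g -> L2 mu E g.
Proof.
move=> mD mE ED [mg ig]; split; first exact: measurable_funS mg.
exact: integrableS ig.
Qed.

Lemma L2_integrable D g : measurable D -> (mu D < +oo)%E -> L2 mu D g ->
  mu.-integrable D (EFin \o g).
Proof.
move=> mD fD [mg ig].
have i1 : mu.-integrable D (EFin \o cst 1).
  apply: measurable_bounded_integrable => //.
  by exists 1; split => // y y1 x _ /=; rewrite normr1 ltW.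
have := integrableD mD i1 ig.
apply: le_integrable => //; first exact/measurable_EFinP.
move=> x Dx /=; rewrite lee_fin [leRHS]ger0_norm ?addr_ge0 ?sqr_ge0//.
rewrite -(real_normK (num_real (g x))); have := sqr_ge0 (`|g x| - 1); rewrite sqrrB1; have := normr_ge0 (g x); lra.
Qed.

Lemma L2_mul_integrable D f g : measurable D -> L2 mu D f -> L2 mu D g ->
  mu.-integrable D (fun x => (f x * g x)%:E).
Proof.
move=> mD [mf if2] [mg ig2].
have := integrableD mD if2 ig2.
apply: le_integrable => //; first by apply/measurable_EFinP; exact: measurable_funM.
move=> x Dx /=; rewrite lee_fin [leRHS]ger0_norm ?addr_ge0 ?sqr_ge0//.
rewrite ler_norml; have := sqr_ge0 (f x + g x); have := sqr_ge0 (f x - g x).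
by rewrite sqrrB sqrrD; have := sqr_ge0 (f x); have := sqr_ge0 (g x); lra.
Qed.

Lemma L2D D f g : measurable D -> L2 mu D f -> L2 mu D g ->
  L2 mu D (fun x => f x + g x).
Proof.
move=> mD [mf if2] [mg ig2]; split; first exact: measurable_funD.
have := integrableD mD (integrableD mD if2 if2) (integrableD mD ig2 ig2).
apply: le_integrable => //.
  by apply/measurable_EFinP; apply: measurable_funX; exact: measurable_funD.
move=> x Dx /=; rewrite lee_fin !ger0_norm ?addr_ge0 ?sqr_ge0//.
have := sqr_ge0 (f x - g x); rewrite sqrrB sqrrD; lra.
Qed.

Lemma L2Z D (c : R) f : measurable D -> L2 mu D f -> L2 mu D (fun x => c * f x).
Proof.
move=> mD [mf if2]; split; first exact: measurable_funM.
have := integrableZl mD (c ^+ 2) if2.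
apply: eq_integrable => // x _ /=; by rewrite exprMn.
Qed.

Lemma L2B D f g : measurable D -> L2 mu D f -> L2 mu D g ->
  L2 mu D (fun x => f x - g x).
Proof.
move=> mD Lf Lg; have := L2D mD Lf (L2Z (-1) mD Lg).
by congr L2; apply/funext => x; rewrite mulN1r.
Qed.

Lemma L2_bounded D f (M : R) : measurable D -> (mu D < +oo)%E ->
  measurable_fun D f -> (forall x, D x -> `|f x| <= M) -> L2 mu D f.
Proof.
move=> mD fD mf fM; split => //.
apply: measurable_bounded_integrable => //; first exact: measurable_funX.
exists (M ^+ 2); split; first exact: num_real.
move=> y My x Dx /=; apply: ltW; apply: le_lt_trans My.
rewrite normrX lerXn2r ?nnegrE//; first exact: le_trans (normr_ge0 _) (fM _ Dx).
exact: fM.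
Qed.

Lemma L2_ext D f g : measurable D -> measurable_fun D g ->
  {ae mu, forall x, D x -> f x = g x} -> L2 mu D f -> L2 mu D g.
Proof.
move=> mD mg fg [mf if2]; split => //.
have mg2 : measurable_fun D (fun x => (g x ^+ 2)%:E).
  by apply/measurable_EFinP; exact: measurable_funX.
have mf2 : measurable_fun D (fun x => (f x ^+ 2)%:E).
  by apply/measurable_EFinP; exact: measurable_funX.
apply/integrableP; split => //.
move/integrableP : if2 => [_]; congr (_ < _)%E.
apply: ae_eq_integral => //.
- exact: measurableT_comp.
- exact: measurableT_comp.
- by apply: filterS fg => x fgx /fgx ->.
Qed.

Lemma L2_supp D E f : measurable D -> measurable E -> E `<=` D ->
  measurable_fun D f -> (forall x, D x -> ~ E x -> f x = 0) -> L2 mu E f ->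
  L2 mu D f.
Proof.
move=> mD mE ED mf f0 [_ if2]; split => //.
rewrite (integrable_mkcond _ mD); have := (integrable_mkcond (fun x => (f x ^+ 2)%:E) mE).1 if2.
congr (integrable _ _ _); apply/funext => x; rewrite !patchE.
case: ifPn => xE; case: ifPn => xD //.
- by exfalso; move/negP: xD; apply; apply/mem_set/ED/set_mem.
- by rewrite f0 ?expr0n//; [exact/set_mem|move=> /mem_set; apply/negP].
Qed.

Lemma L2_cvg_mul D (fn : nat -> T -> R) f g : measurable D ->
  L2 mu D f -> L2 mu D g -> (forall n, measurable_fun D (fn n)) ->
  (\int[mu]_(x in D) ((fn n x - f x) ^+ 2)%:E)%E @[n --> \oo] --> 0%E ->
  \int[mu]_(x in D) (fn n x * g x) @[n --> \oo] --> \int[mu]_(x in D) (f x * g x).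
Proof.
move=> mD Lf Lg mfn cv.
pose G := \int[mu]_(x in D) (g x ^+ 2).
have G0 : 0 <= G by apply: Rintegral_ge0 => x _; exact: sqr_ge0.
apply/cvgrPdist_le => e e0.
(* The weight in |(f_n - f) g| <= t/2 (f_n - f)^2 + g^2/(2t). The second integral is then G e/(2(G +
   1)) <= e/2, and the first is at most e/2 once the squared distance is below e/t. The [+ 1] keeps
   [t] positive when [G = 0]. *)
pose t := (G + 1) / e.
have t0 : 0 < t by rewrite divr_gt0//; lra.
have /fine_cvgP[cvfin cvR] := cv.
have : \forall n \near \oo, `|0 - fine (\int[mu]_(x in D) ((fn n x - f x) ^+ 2)%:E)%E| < e / t.
  by move/cvgrPdist_lt : cvR; apply; rewrite divr_gt0.
move=> H; near=> n.
have fin : (\int[mu]_(x in D) ((fn n x - f x) ^+ 2)%:E)%E \is a fin_num by near: n.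
have mB : measurable_fun D (fun x => fn n x - f x).
  by apply: measurable_funB => //; exact: Lf.1.
have LB : L2 mu D (fun x => fn n x - f x).
  split => //; apply/integrableP; split.
    by apply/measurable_EFinP; exact: measurable_funX.
  rewrite (eq_integral (fun x => ((fn n x - f x) ^+ 2)%:E)); last first.
    by move=> x _ /=; rewrite ger0_norm// sqr_ge0.
  by rewrite -ge0_fin_numE// integral_ge0// => x _; rewrite lee_fin sqr_ge0.
have ifg : mu.-integrable D (fun x => (f x * g x)%:E) by exact: L2_mul_integrable.
have iBg : mu.-integrable D (fun x => ((fn n x - f x) * g x)%:E) by exact: L2_mul_integrable.
have -> : \int[mu]_(x in D) (fn n x * g x) =
    \int[mu]_(x in D) (f x * g x) + \int[mu]_(x in D) ((fn n x - f x) * g x).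
  rewrite -RintegralD//; apply: eq_Rintegral => x _; ring.
rewrite opprD addNKr normrN.
apply: le_trans (le_normr_Rintegral _ _) _ => //.
pose S := \int[mu]_(x in D) ((fn n x - f x) ^+ 2).
have St : S < e / t.
  have : `|0 - S| < e / t by rewrite /S; near: n; exact: H.
  by rewrite sub0r normrN; apply: le_lt_trans; exact: ler_norm.
have iB2 := LB.2; have ig2 := Lg.2.
have iZB : mu.-integrable D (EFin \o (fun x => t / 2 * (fn n x - f x) ^+ 2)).
  exact: (integrableZl mD (t / 2) iB2).
have iZg : mu.-integrable D (EFin \o (fun x => (2 * t)^-1 * g x ^+ 2)).
  exact: (integrableZl mD (2 * t)^-1 ig2).
have : \int[mu]_(x in D) `|(fn n x - f x) * g x| <=
    \int[mu]_(x in D) (t / 2 * (fn n x - f x) ^+ 2 + (2 * t)^-1 * g x ^+ 2).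
  apply: le_Rintegral => //.
  - by have := integrable_abse iBg; congr (integrable _ _ _).
  - exact: (integrableD mD iZB iZg).
  - move=> x Dx; rewrite normrM; set u := `|_ - _|; set v := `|g x|.
    rewrite -[X in _ <= _ * X + _]real_normK ?num_real// -[X in _ <= _ + _ * X]real_normK ?num_real//.
    rewrite -/u -/v -subr_ge0.
    have -> : t / 2 * u ^+ 2 + (2 * t)^-1 * v ^+ 2 - u * v = (2 * t)^-1 * (t * u - v) ^+ 2.
      by field; rewrite gt_eqF.
    by rewrite mulr_ge0 ?sqr_ge0// invr_ge0 mulr_ge0// ltW.
move=> /le_trans; apply.
rewrite RintegralD// !RintegralZl// -/S -/G.
have : t / 2 * S <= e / 2.
  have : t / 2 * S <= t / 2 * (e / t) by apply: ler_wpM2l; [rewrite divr_ge0// ltW|exact: ltW].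
  have -> // : t / 2 * (e / t) = e / 2 by field; rewrite gt_eqF.
have : (2 * t)^-1 * G <= e / 2.
  rewrite -subr_ge0.
  have -> : e / 2 - (2 * t)^-1 * G = e / 2 * (1 / (G + 1)).
    by rewrite /t; field; rewrite ?gt_eqF//; lra.
  by rewrite mulr_ge0// divr_ge0//; lra.
by lra.
Unshelve. all: by end_near. Qed.

End SquareIntegrable.

Lemma ord2P (i : 'I_2) : i = ord0 \/ i = ord_max.
Proof. by case: i => -[|[|//]] ?; [left|right]; exact: val_inj. Qed.

(** * Uniqueness and locality of weak derivatives *)

Section WeakDerivatives.
Variable R : realType.
Implicit Types (U V : set (plane R)) (f g w psi : plane R -> R) (m n : 'I_2).

Lemma smooth_differentiable psi x : smooth psi -> differentiable psi x.
Proof. by move=> /(_ 1%N) [+ _]; apply. Qed.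

Lemma smooth_continuous psi : smooth psi -> continuous psi.
Proof. by move=> spsi x; exact/differentiable_continuous/smooth_differentiable. Qed.

Lemma smooth_partial psi m : smooth psi -> smooth (fun x => 'D_(ebase R m) psi x).
Proof. by move=> spsi n; have [_] := spsi n.+1; apply. Qed.

Lemma partial_out psi m U x : closed U -> (forall y, ~ U y -> psi y = 0) ->
  ~ U x -> 'D_(ebase R m) psi x = 0.
Proof.
move=> cU psi0 Ux; rewrite -[RHS](derive_cst (0 : R) x (ebase R m)).
apply: near_eq_derive.
have : open_nbhs x (~` U) by split => //; exact: closed_openC.
by move=> /open_nbhs_nbhs; apply: filterS => y; exact: psi0.
Qed.

Lemma csupp_partial psi m U : compactly_supported_in U psi ->
  compactly_supported_in U (fun x => 'D_(ebase R m) psi x).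
Proof.
move=> [C [cC CU psi0]]; exists C; split => // x Cx.
by apply: partial_out Cx => //; apply: compact_closed cC; exact: norm_hausdorff.
Qed.

Lemma csupp_sub psi U V : V `<=` U -> compactly_supported_in V psi ->
  compactly_supported_in U psi.
Proof.
by move=> VU [C [cC CV psi0]]; exists C; split => //; exact: subset_trans VU.
Qed.

Lemma compact_obox (C : set (plane R)) : compact C -> exists q, C `<=` obox q.
Proof.
move=> /compact_bounded [M [_ HM]].
have HC x : C x -> `|x| <= M + 1 by move=> Cx; apply: HM => //; rewrite ltrDl.
exists ((- (M + 2), M + 2), (- (M + 2), M + 2)) => x /HC.
rewrite prod_normE ge_max => /andP[/= x1 x2].
by split => /=; rewrite in_itv /= -ltr_norml; lra.
Qed.

Lemma csupp_bounded psi U : continuous psi -> compactly_supported_in U psi ->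
  exists q M, (forall x, `|psi x| <= M) /\ (forall x, ~ obox q x -> psi x = 0).
Proof.
move=> cpsi [C [cC CU psi0]]; have [q Cq] := compact_obox cC.
have /compact_bounded [M [_ HM]] : compact (psi @` C).
  by apply: continuous_compact => //; exact: continuous_subspaceT.
exists q, (Num.max (M + 1) 0); split.
  move=> x; rewrite le_max; have [Cx|Cx] := pselect (C x).
    by rewrite HM ?ltrDl//; exists x.
  by rewrite psi0// normr0 lexx orbT.
by move=> x qx; apply: psi0 => /Cq.
Qed.

Lemma csupp_L2 psi U V : open V -> continuous psi -> compactly_supported_in U psi ->
  L2 (leb2 R) V psi.
Proof.
move=> oV cpsi /(csupp_bounded cpsi) [q [M [psiM psi0]]].
have mV := open_measurable_plane oV; have mq := measurable_obox q.
have mpsi W : open W -> measurable_fun (W : set (mplane R)) psi.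
  by move=> oW; apply: measurable_plane => // x _; exact: cpsi.
apply: (@L2_supp _ _ _ (leb2 R) _ (V `&` obox q)) => //.
- exact: measurableI.
- exact: mpsi.
- by move=> x Vx H; apply: psi0 => qx; exact: H.
apply: (L2_bounded (M := M)) => //.
- exact: measurableI.
- apply: le_lt_trans (leb2_obox_fin q); apply: le_measure; rewrite ?inE//.
  exact: measurableI.
- by apply: mpsi; apply: openI => //; exact: open_obox.
Qed.

(** In each box of a countable cover the test functions are tensor products of factors
    [theta * ocstep]: [theta] gives compact support in the box, [ocstep] tends to the indicator of a
    half-open interval, and [ae0_of_ocitv2] concludes. *)
Lemma fundamental_plane U f : open U -> L2 (leb2 R) U f ->
  (forall psi, smooth psi -> compactly_supported_in U psi ->
    \int[leb2 R]_(x in U) (f x * psi x) = 0) ->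
  {ae leb2 R, forall x, U x -> f x = 0}.
Proof.
move=> oU Lf f0; have mU := open_measurable_plane oU.
have [q [qU UE]] := open_cover_obox oU.
rewrite UE; apply: ae_bigcup_in => i.
have mq := measurable_obox (q i).
have oqU : obox (q i) `<=` U by apply: subset_trans (qU i); exact: obox_cbox.
have intf : (leb2 R).-integrable (obox (q i)) (EFin \o f).
  by apply: L2_integrable => //; [exact: leb2_obox_fin|exact: (L2_sub mU mq oqU)].
apply: ae0_of_ocitv2 => // c e c' e'.
pose a k (x : R) := theta (q i).1.1 (q i).1.2 k x * ocstep c e k x.
pose b k (x : R) := theta (q i).2.1 (q i).2.2 k x * ocstep c' e' k x.
have Da k j : nderivable j (a k) by apply: nderivableM; [exact: nderivable_theta|exact: nderivable_ocstep].
have Db k j : nderivable j (b k) by apply: nderivableM; [exact: nderivable_theta|exact: nderivable_ocstep].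
pose psi k (x : plane R) := a k x.1 * b k x.2.
have spsi k : smooth (psi k) by exact: smooth_tensor.
have supp k : compactly_supported_in (obox (q i)) (psi k).
  have [a1 [b1 [s1 t1]]] := theta_itv (q i).1.1 (q i).1.2 k.
  have [a2 [b2 [s2 t2]]] := theta_itv (q i).2.1 (q i).2.2 k.
  exists (cbox ((a1, b1), (a2, b2))); split; first exact: compact_cbox.
    by move=> x [/s1 x1 /s2 x2].
  move=> x xb; rewrite /psi /a /b.
  have [x1|x1] := boolP (x.1 \in `[a1, b1]); last by rewrite t1// !mul0r.
  have [x2|x2] := boolP (x.2 \in `[a2, b2]); last by rewrite t2// !mul0r mulr0.
  by exfalso; apply: xb.
apply: (@Rintegral_dct0 _ _ _ (leb2 R) _ _ _ psi) => //.
- by apply: measurableX; exact: measurable_itv.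
- move=> k; apply: measurable_plane; first exact: open_obox.
  by move=> x _; exact: smooth_continuous.
- by move=> k x _; apply: norm_mul_le1; apply: norm_mul_le1;
    [exact: norm_theta_le1|exact: norm_ocstep_le1|exact: norm_theta_le1|exact: norm_ocstep_le1].
- move=> x [x1 x2].
  have -> : (\1_(`]c, e] `*` `]c', e']) x : R) = 1 * \1_(`]c, e] : set R) x.1 * (1 * \1_(`]c', e'] : set R) x.2).
    by rewrite !mul1r !indicE in_setX -natrM mulnb.
  by apply: cvgM; apply: cvgM; [exact: theta_cvg|exact: ocstep_cvg|exact: theta_cvg|exact: ocstep_cvg].
- move=> k; rewrite -[RHS](f0 (psi k) (spsi k) (csupp_sub oqU (supp k))); symmetry.
  apply: Rintegral_restrict_subset => // x _ qx.
  by have [C [_ Cq ->]] := supp k; [rewrite mulr0|move=> /Cq].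
Qed.

Lemma weak_partial_uniq U m w g1 g2 : open U -> L2 (leb2 R) U g1 -> L2 (leb2 R) U g2 ->
  weak_partial U m w g1 -> weak_partial U m w g2 ->
  {ae leb2 R, forall x, U x -> g1 x = g2 x}.
Proof.
move=> oU L1 L2_ w1 w2; have mU := open_measurable_plane oU.
have := @fundamental_plane U (fun x => g1 x - g2 x) oU (L2B mU L1 L2_).
move=> H; have {}H : {ae leb2 R, forall x, U x -> g1 x - g2 x = 0}.
  apply: H => psi spsi cpsi.
  have Lpsi := csupp_L2 oU (smooth_continuous spsi) cpsi.
  have i1 := L2_mul_integrable mU L1 Lpsi.
  have i2 := L2_mul_integrable mU L2_ Lpsi.
  rewrite (_ : \int[leb2 R]_(x in U) _ =
    \int[leb2 R]_(x in U) (g1 x * psi x) - \int[leb2 R]_(x in U) (g2 x * psi x)).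
    by apply/eqP; rewrite subr_eq0 -eqr_opp -w1// -w2.
  rewrite -RintegralB//; apply: eq_Rintegral => x _; by rewrite mulrBl.
by apply: ae_impl H => x Hx /Hx /eqP; rewrite subr_eq0 => /eqP.
Qed.

Lemma weak_partial_sub U V m w g : open U -> open V -> V `<=` U ->
  weak_partial U m w g -> weak_partial V m w g.
Proof.
move=> oU oV VU wg psi spsi cpsi.
have := wg psi spsi (csupp_sub VU cpsi).
have [C [_ CV psi0]] := cpsi; have [C' [_ CV' psi0']] := csupp_partial m cpsi.
have -> : \int[leb2 R]_(x in U) (w x * 'D_(ebase R m) psi x) =
    \int[leb2 R]_(x in V) (w x * 'D_(ebase R m) psi x).
  apply: Rintegral_restrict_subset => // x _ Vx.
  by rewrite psi0' ?mulr0// => /CV'.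
have -> // : \int[leb2 R]_(x in U) (g x * psi x) = \int[leb2 R]_(x in V) (g x * psi x).
apply: Rintegral_restrict_subset => // x _ Vx.
by rewrite psi0 ?mulr0// => /CV.
Qed.

Lemma weak_partial_ext U m w w' g : open U ->
  measurable_fun (U : set (mplane R)) w -> measurable_fun (U : set (mplane R)) w' ->
  {ae leb2 R, forall x, U x -> w x = w' x} ->
  weak_partial U m w g -> weak_partial U m w' g.
Proof.
move=> oU mw mw' ww' wg psi spsi cpsi; rewrite -wg//.
have mU := open_measurable_plane oU.
have mpsi : measurable_fun (U : set (mplane R)) (fun x => 'D_(ebase R m) psi x).
  by apply: measurable_plane => // x _; apply: smooth_continuous; exact: smooth_partial.
apply: ae_eq_Rintegral => //; [exact: measurable_funM|exact: measurable_funM|].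
by apply: ae_impl ww' => x H /H ->.
Qed.

Lemma wpartP U m w : (exists g, L2 (leb2 R) U g /\ weak_partial U m w g) ->
  L2 (leb2 R) U (wpart U m w) /\ weak_partial U m w (wpart U m w).
Proof. by move=> ex; apply: (@xgetPex _ (fun=> 0) _ ex). Qed.

(** This holds without any existence hypothesis because the default value of [wpart] is a
    constant. *)
Lemma measurable_wpart U m w : measurable_fun (U : set (mplane R)) (wpart U m w).
Proof.
rewrite /wpart; case: xgetP => [g _ [[]]//|_]; exact: measurable_cst.
Qed.

Lemma H1_sub U V w : open U -> open V -> V `<=` U -> H1 U w -> H1 V w.
Proof.
move=> oU oV VU [Lw Hw]; have mU := open_measurable_plane oU.
have mV := open_measurable_plane oV; split; first exact: (L2_sub mU mV VU).
move=> m; have [g [Lg wg]] := Hw m; exists g; split; first exact: (L2_sub mU mV VU).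
exact: weak_partial_sub wg.
Qed.

Lemma H1_ext U w w' : open U -> measurable_fun (U : set (mplane R)) w' ->
  {ae leb2 R, forall x, U x -> w x = w' x} -> H1 U w -> H1 U w'.
Proof.
move=> oU mw' ww' [Lw Hw]; split; first exact: (L2_ext (open_measurable_plane oU) mw' ww').
move=> m; have [g [Lg wg]] := Hw m; exists g; split => //.
by apply: weak_partial_ext ww' wg => //; exact: Lw.1.
Qed.

(** The function may change on a null set together with the domain. This is what second derivatives
    require: [wpart V m w] is only a.e. equal to [wpart U m w] before it is differentiated again. *)
Lemma wpart_local U V m w w' : open U -> open V -> V `<=` U ->
  measurable_fun (V : set (mplane R)) w' ->
  {ae leb2 R, forall x, V x -> w x = w' x} -> H1 U w ->
  {ae leb2 R, forall x, V x -> wpart V m w' x = wpart U m w x}.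
Proof.
move=> oU oV VU mw' ww' Hw.
have Hw' : H1 V w' by apply: H1_ext ww' _ => //; exact: H1_sub Hw.
have [Lg' wg'] := wpartP (Hw'.2 m); have [Lg wg] := wpartP (Hw.2 m).
apply: (weak_partial_uniq oV Lg' _ wg').
  by apply: L2_sub Lg => //; exact: open_measurable_plane.
apply: weak_partial_ext ww' _ => //.
  by have := (H1_sub oU oV VU Hw).1.1.
exact: weak_partial_sub wg.
Qed.

Lemma wpart_sub U V m w : open U -> open V -> V `<=` U -> H1 U w ->
  {ae leb2 R, forall x, V x -> wpart V m w x = wpart U m w x}.
Proof.
move=> oU oV VU Hw; apply: wpart_local => //; last exact: aeW.
by have := (H1_sub oU oV VU Hw).1.1.
Qed.

Lemma wpart2_sub U V m n w : open U -> open V -> V `<=` U -> H2 U w ->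
  {ae leb2 R, forall x, V x ->
    wpart V n (wpart V m w) x = wpart U n (wpart U m w) x}.
Proof.
move=> oU oV VU [Hw HD]; apply: wpart_local => //; first exact: measurable_wpart.
by apply: ae_impl (wpart_sub m oU oV VU Hw) => x H /H.
Qed.

Lemma hess_sub U V w : open U -> open V -> V `<=` U -> H2 U w ->
  {ae leb2 R, forall x, V x -> hess V w x = hess U w x}.
Proof.
move=> oU oV VU Hw.
have H m n := wpart2_sub m n oU oV VU Hw.
have := ae_conj (ae_conj (H ord0 ord0) (H ord0 ord_max)) (ae_conj (H ord_max ord0) (H ord_max ord_max)).
apply: ae_impl => x [[h1 h2] [h3 h4]] Vx; apply/matrixP => i j; rewrite !mxE.
have [-> | ->] := ord2P i; have [-> | ->] := ord2P j.
- exact: h1 Vx.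
- exact: h2 Vx.
- exact: h3 Vx.
- exact: h4 Vx.
Qed.

End WeakDerivatives.

(** * Green's formula for a domain bounded by a graph *)

Section LineIntegrals.
Variable R : realType.
Local Notation mu := (@lebesgue_measure R).

Lemma FTC_C1 (f f' : R -> R) a b : a <= b -> (forall x, is_derive x (1 : R) f (f' x)) ->
  continuous f' -> (\int[mu]_(x in `[a, b]) (f' x)%:E = (f b - f a)%:E)%E.
Proof.
rewrite le_eqVlt => /predU1P[<- _ _|ab df cf'].
  by rewrite subrr set_itv1 integral_set1.
have cf : continuous f.
  by move=> x; apply/differentiable_continuous/derivable1_diffP; case: (df x).
rewrite (@continuous_FTC2 _ f' f)//.
- exact: continuous_subspaceT.
- split; first by move=> x _; case: (df x).
  + exact: (cvg_at_right_filter (cf a)).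
  + exact: (cvg_at_left_filter (cf b)).
- by move=> x _; rewrite derive1E; case: (df x).
Qed.

Lemma continuous_integrable_oo (f : R -> R) a b : continuous f ->
  mu.-integrable `]a, b[ (EFin \o f).
Proof.
move=> cf; apply: (@integrableS _ _ _ mu `[a, b]%classic).
- exact: measurable_itv.
- exact: measurable_itv.
- exact: subset_itv_oo_cc.
- apply: continuous_compact_integrable; first exact: segment_compact.
  exact: continuous_subspaceT.
Qed.

(** One-dimensional Green's formula. Only the end point [h] contributes, because [f] vanishes at the
    other end of the half-line, [lo] for [sg = 1] and [hi] for [sg = -1]. *)
Lemma integral_supp_half (f f' : R -> R) (P : set R) (sg lo h hi : R) :
  sg = 1 \/ sg = -1 -> lo < h < hi ->
  (forall x, is_derive x (1 : R) f (f' x)) -> continuous f' ->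
  (forall z, ~ (lo < z < hi) -> f z = 0 /\ f' z = 0) ->
  (forall z, lo < z < hi -> (P z <-> 0 < sg * (h - z))) ->
  (\int[mu]_z ((f' \_ P) z)%:E = (sg * f h)%:E)%E.
Proof.
move=> sg1 /andP[loh hhi] df cf' f0 Ph.
have mf' A : measurable A -> measurable_fun A (EFin \o f').
  move=> mA; apply/measurable_EFinP; apply: measurable_funTS.
  exact: continuous_measurable_fun.
case: sg1 => sgE; subst sg.
- transitivity (\int[mu]_(z in `[lo, h[) (f' z)%:E)%E.
    rewrite [RHS]integral_mkcond; apply: eq_integral => z _; rewrite !patchE.
    case: ifPn => zP; case: ifPn => // zI.
    + have [zlh|zlh] := pselect (lo < z < hi); last by have [_ ->] := f0 z zlh.
      exfalso; move/negP: zI; apply; apply/mem_set => /=; rewrite in_itv /=.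
      by move/set_mem/Ph: zP => /(_ zlh); lra.
    + have [zlh|zlh] := pselect (lo < z < hi); last by have [_ ->] := f0 z zlh.
      exfalso; move/negP: zP; apply; apply/mem_set/Ph => //.
      by move/set_mem: zI => /=; rewrite in_itv /=; lra.
  rewrite integral_itv_bndo_bndc; last by apply: mf'; exact: measurable_itv.
  rewrite (FTC_C1 (ltW loh) df cf') (_ : f lo = 0) ?subr0 ?mul1r//.
  by have [] := f0 lo; rewrite ?ltxx.
- transitivity (\int[mu]_(z in `]h, hi]) (f' z)%:E)%E.
    rewrite [RHS]integral_mkcond; apply: eq_integral => z _; rewrite !patchE.
    case: ifPn => zP; case: ifPn => // zI.
    + have [zlh|zlh] := pselect (lo < z < hi); last by have [_ ->] := f0 z zlh.
      exfalso; move/negP: zI; apply; apply/mem_set => /=; rewrite in_itv /=.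
      by move/set_mem/Ph: zP => /(_ zlh); lra.
    + have [zlh|zlh] := pselect (lo < z < hi); last by have [_ ->] := f0 z zlh.
      exfalso; move/negP: zP; apply; apply/mem_set/Ph => //.
      by move/set_mem: zI => /=; rewrite in_itv /=; lra.
  rewrite integral_itv_obnd_cbnd; last by apply: mf'; exact: measurable_itv.
  rewrite (FTC_C1 (ltW hhi) df cf') (_ : f hi = 0) ?sub0r ?mulN1r//.
  by have [] := f0 hi; rewrite ?ltxx ?andbF.
Qed.

(** * Monotone change of variables, with [tau] the sign of the derivative *)

Section Substitution.
Variables (p : R -> R) (a b tau : R).
Hypothesis ab : a < b.
Hypothesis tau1 : tau = 1 \/ tau = -1.
Hypothesis dp : forall s, derivable p s 1.
Hypothesis cp' : continuous (derive1 p).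
Hypothesis p'0 : forall s, a <= s <= b -> 0 < tau * derive1 p s.

Let cp : continuous p.
Proof. by move=> x; apply/differentiable_continuous/derivable1_diffP. Qed.

Let cpab : {within `[a, b], continuous p}.
Proof. exact: continuous_subspaceT. Qed.

Let dpLR : derivable_oo_LRcontinuous p a b.
Proof.
split; first by move=> x _; exact: dp.
- by apply: cvg_at_right_filter; exact: cp.
- by apply: cvg_at_left_filter; exact: cp.
Qed.

Lemma graph_homo x y : a <= x -> x < y -> y <= b -> tau * p x < tau * p y.
Proof.
case: tau1 => tE; rewrite tE ?mul1r ?mulN1r => ax xy yb.
- apply: (@gtr0_derive1_incr _ p a b) => // z zab.
  by have := @p'0 z; rewrite tE mul1r; apply; exact: subset_itv_oo_cc zab.
- rewrite ltrN2; apply: (@ltr0_derive1_decr _ p a b) => // z zab.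
  have : 0 < tau * derive1 p z by apply: p'0; exact: subset_itv_oo_cc zab.
  by rewrite tE mulN1r oppr_gt0.
Qed.

Lemma graph_homo_inv x y : a <= x <= b -> a <= y <= b ->
  (tau * p x < tau * p y) = (x < y).
Proof.
move=> /andP[ax xb] /andP[ay yb]; have [xy|yx|->] := ltgtP x y.
- exact: graph_homo.
- by apply/negbTE; rewrite -leNgt ltW// graph_homo.
- by rewrite ltxx.
Qed.

Lemma graph_inj x y : a <= x <= b -> a <= y <= b -> p x = p y -> x = y.
Proof.
move=> xab yab pxy; have := graph_homo_inv xab yab; have := graph_homo_inv yab xab.
by rewrite pxy ltxx; case: ltgtP.
Qed.

Lemma graph_image : p @` `[a, b] =
  if tau == 1 then `[p a, p b]%classic else `[p b, p a]%classic.
Proof.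
have aab : a <= a <= b by rewrite lexx ltW.
have bab : a <= b <= b by rewrite lexx ltW.
apply/seteqP; split.
- move=> _ [s /= + <-]; rewrite in_itv /= => sab.
  have h1 : tau * p a <= tau * p s by rewrite leNgt graph_homo_inv// -leNgt; case/andP: sab.
  have h2 : tau * p s <= tau * p b by rewrite leNgt graph_homo_inv// -leNgt; case/andP: sab.
  case: tau1 h1 h2 => ->; rewrite ?eqxx ?mul1r ?mulN1r ?lerN2 /=.
    by move=> h1 h2; rewrite in_itv /= h1.
  by rewrite ifF /= ?in_itv /=; [move=> -> ->|apply/negbTE/eqP; lra].
- have H y : Num.min (p a) (p b) <= y <= Num.max (p a) (p b) -> (p @` `[a, b]) y.
    by move=> /(IVT (ltW ab) cpab) [c cab <-]; exists c.
  case: tau1 => tE y; rewrite tE ?eqxx /=.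
    have pab : p a < p b by have := graph_homo (lexx a) ab (lexx b); rewrite tE !mul1r.
    by rewrite in_itv /= => yab; apply: H; rewrite (min_l (ltW pab)) (max_r (ltW pab)).
  have pab : p b < p a by have := graph_homo (lexx a) ab (lexx b); rewrite tE !mulN1r ltrN2.
  rewrite ifF /=; last by apply/negbTE/eqP; lra.
  by rewrite in_itv /= => yab; apply: H; rewrite (min_r (ltW pab)) (max_l (ltW pab)).
Qed.

Lemma graph_image_oo y :
  (exists2 s, a < s < b & p s = y) <-> tau * p a < tau * y < tau * p b.
Proof.
have aab : a <= a <= b by rewrite lexx ltW.
have bab : a <= b <= b by rewrite lexx ltW.
split=> [[s /andP[sa sb] <-]|yab].
  by rewrite !graph_homo_inv ?sa ?sb// !ltW.
have : (p @` `[a, b]) y.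
  rewrite graph_image; case: tau1 yab => ->; rewrite ?eqxx ?mul1r ?mulN1r ?ltrN2 /=.
    by rewrite in_itv /= => /andP[? ?]; rewrite !ltW.
  rewrite ifF; last by apply/negbTE/eqP; lra.
  by rewrite /= in_itv /= => /andP[? ?]; rewrite !ltW.
move=> [s /=]; rewrite in_itv /= => sab ps; exists s => //.
by move: yab; rewrite -ps !graph_homo_inv.
Qed.

Definition pinv (y : R) : R := xget a [set s | a <= s <= b /\ p s = y].

Lemma pinvK : {in `[a, b], cancel p pinv}.
Proof.
move=> s; rewrite in_itv /= => sab; rewrite /pinv.
by case: xgetP => [t _ [tab pt]|/(_ s) []]; [exact: graph_inj|].
Qed.

Lemma continuous_pinv : {within p @` `[a, b], continuous pinv}.
Proof.
rewrite graph_image; case: tau1 => tE; rewrite tE ?eqxx.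
  exact: (segment_can_le_continuous (ltW ab) cpab pinvK).
rewrite ifF; last by apply/negbTE/eqP; lra.
exact: (segment_can_ge_continuous (ltW ab) cpab pinvK).
Qed.

(** The factor [tau * derive1 p] is |p'|, which gives one formula for increasing and decreasing
    [p]. *)
Lemma integral_graph (G : R -> R) : {within p @` `[a, b], continuous G} ->
  (\int[mu]_(y in p @` `[a, b]) (G y)%:E =
   \int[mu]_(s in `[a, b]) (G (p s) * (tau * derive1 p s))%:E)%E.
Proof.
rewrite graph_image; case: tau1 => tE; rewrite tE ?eqxx => cG.
- rewrite (@integration_by_substitution_increasing _ p G a b (ltW ab))//.
  + by apply: eq_integral => s _ /=; rewrite mul1r.
  + move=> x y; rewrite !in_itv /= => xab yab xy.
    by move: (graph_homo_inv xab yab); rewrite tE !mul1r xy.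
  + by apply/cvg_ex; exists (derive1 p a); apply: cvg_at_right_filter; exact: cp'.
  + by apply/cvg_ex; exists (derive1 p b); apply: cvg_at_left_filter; exact: cp'.
- move: cG; rewrite ifF; last by apply/negbTE/eqP; lra.
  move=> cG; rewrite (@integration_by_substitution_decreasing _ p G a b (ltW ab))//.
  + by apply: eq_integral => s _ /=; rewrite mulN1r.
  + move=> x y; rewrite !in_itv /= => xab yab xy.
    by move: (graph_homo_inv yab xab); rewrite tE !mulN1r ltrN2 xy.
  + by apply/cvg_ex; exists (derive1 p a); apply: cvg_at_right_filter; exact: cp'.
  + by apply/cvg_ex; exists (derive1 p b); apply: cvg_at_left_filter; exact: cp'.
Qed.

End Substitution.

End LineIntegrals.

Section Green.
Variable R : realType.
Local Notation mu := (@lebesgue_measure R).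
Implicit Types (U : set (plane R)) (gam : R -> plane R) (m : 'I_2).

(* Below [gam], at a parameter in ]a, b[, the line in the direction [m] meets
   [U] on one side only, given by [sg], as long as the [m]-th coordinate stays
   in ]lo, hi[; [tau] is the sign of the derivative of the other coordinate. *)
Record local_graph U gam m (sg tau a b lo hi : R) : Prop := LocalGraph {
  lg_ab : a < b ;
  lg_sg : sg = 1 \/ sg = -1 ;
  lg_tau : tau = 1 \/ tau = -1 ;
  lg_derivable : forall s, derivable (fun s => ocoord m (gam s)) s 1 ;
  lg_continuous' : continuous (derive1 (fun s => ocoord m (gam s))) ;
  lg_continuous : continuous (fun s => coord m (gam s)) ;
  lg_sign : forall s, a <= s <= b -> 0 < tau * derive1 (fun s => ocoord m (gam s)) s ;
  lg_range : forall s, a < s < b -> lo < coord m (gam s) < hi ;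
  lg_side : forall s z, a < s < b -> lo < z < hi ->
    (U (mkcoord m (ocoord m (gam s)) z) <-> 0 < sg * (coord m (gam s) - z))
}.

(** An open rectangle. One side is given as the image of ]a, b[ under the other coordinate of [gam],
    so that membership yields a curve parameter. *)
Definition gbox gam m (a b lo hi : R) : set (plane R) :=
  [set x | (exists2 s, a < s < b & ocoord m x = ocoord m (gam s)) /\ lo < coord m x < hi].

Lemma fubini_line m (f : plane R -> \bar R) : (leb2 R).-integrable setT f ->
  (\int[leb2 R]_x f x = \int[mu]_y \int[mu]_z f (mkcoord m y z))%E.
Proof.
move=> intf; rewrite /mkcoord; case: (m == ord0).
  by rewrite -(integral21_prod_meas1 intf).
by rewrite -(integral12_prod_meas1 intf).
Qed.

Lemma csupp_integrable psi U V : open V -> continuous psi ->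
  compactly_supported_in U psi -> (leb2 R).-integrable V (EFin \o psi).
Proof.
move=> oV cpsi cs; have [q [M [psiM psi0]]] := csupp_bounded cpsi cs.
have mV := open_measurable_plane oV; have mq := measurable_obox q.
have mVq : measurable (V `&` obox q : set (mplane R)) by exact: measurableI.
have : (leb2 R).-integrable (V `&` obox q) (EFin \o psi).
  apply: L2_integrable => //.
    by apply: le_lt_trans (leb2_obox_fin q); apply: le_measure; rewrite ?inE.
  by apply: L2_sub (csupp_L2 oV cpsi cs) => // x [].
rewrite (integrable_mkcond _ mVq) (integrable_mkcond _ mV).
congr (integrable _ _ _); apply/funext => x; rewrite !patchE.
rewrite in_setI; case: (x \in V) => //=; case: ifPn => // xq.
by rewrite /= psi0// => xq'; move/negP: xq; apply; exact/mem_set.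
Qed.

Lemma continuous_ocoord m : continuous (ocoord m : plane R -> R).
Proof.
by move=> x; rewrite /ocoord; case: (m == ord0); [exact: cvg_snd|exact: cvg_fst].
Qed.

Lemma continuous_coord m : continuous (coord m : plane R -> R).
Proof.
by move=> x; rewrite /coord; case: (m == ord0); [exact: cvg_fst|exact: cvg_snd].
Qed.

Lemma continuous_mkcoord m T (F : set_system T) {FF : Filter F} (f g : T -> R) (y z : R) :
  f @ F --> y -> g @ F --> z -> mkcoord m (f t) (g t) @[t --> F] --> mkcoord m y z.
Proof. by rewrite /mkcoord; case: (m == ord0) => fy gz; [exact: (cvg_pair gz fy)|exact: (cvg_pair fy gz)]. Qed.

Section LocalGraph.
Variables (U : set (plane R)) (gam : R -> plane R) (m : 'I_2).
Variables (sg tau a b lo hi : R).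
Hypothesis oU : open U.
Hypothesis lg : local_graph U gam m sg tau a b lo hi.
Let p s := ocoord m (gam s).
Let h s := coord m (gam s).
Let Q := gbox gam m a b lo hi.
Let pinvm : R -> R := pinv p a b.

Let gamE s : gam s = mkcoord m (p s) (h s).
Proof. by rewrite mkcoordK. Qed.

Let aab : a <= a <= b. Proof. by rewrite lexx ltW ?(lg_ab lg). Qed.
Let bab : a <= b <= b. Proof. by rewrite lexx ltW ?(lg_ab lg). Qed.

Let p_inj x y : a <= x <= b -> a <= y <= b -> p x = p y -> x = y.
Proof.
exact: (graph_inj (lg_tau lg) (lg_derivable lg) (lg_sign lg)).
Qed.

Let cont_p : continuous p.
Proof. by move=> x; apply/differentiable_continuous/derivable1_diffP; exact: (lg_derivable lg). Qed.

Lemma gbox_mkcoord s z : a <= s <= b -> Q (mkcoord m (p s) z) -> a < s < b /\ lo < z < hi.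
Proof.
move=> sab [[t tab]]; rewrite ocoord_mkcoord coord_mkcoord => pst zlh; split => //.
by have -> // : s = t by apply: p_inj => //; rewrite !ltW //; case/andP: tab.
Qed.

(** Fubini with the inner integral in the direction [m]: each slice meets [U] on one side of the
    curve and contributes [sg] times the value of [zeta] on the curve. The outer variable is then
    replaced by the curve parameter. *)
Lemma green (zeta : plane R -> R) : smooth zeta -> compactly_supported_in Q zeta ->
  \int[leb2 R]_(x in U) 'D_(ebase R m) zeta x =
  sg * \int[mu]_(s in `]a, b[) (zeta (gam s) * (tau * derive1 p s)).
Proof.
move=> sz cz.
pose dz x := 'D_(ebase R m) zeta x.
have sdz : smooth dz by exact: smooth_partial.
have czeta := smooth_continuous sz; have cdz := smooth_continuous sdz.
have csd : compactly_supported_in Q dz by exact: csupp_partial.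
have [C [cC CQ z0]] := cz; have [C' [cC' CQ' dz0]] := csd.
have zQ x : ~ Q x -> zeta x = 0 by move=> Qx; apply: z0 => /CQ.
have dzQ x : ~ Q x -> dz x = 0 by move=> Qx; apply: dz0 => /CQ'.
have mU := open_measurable_plane oU.
have intU : (leb2 R).-integrable U (EFin \o dz) by exact: csupp_integrable csd.
have intT : (leb2 R).-integrable setT (fun x => ((dz \_ U) x)%:E).
  move: intU; rewrite (integrable_mkcond _ mU); congr (integrable _ _ _).
  by apply/funext => x; rewrite !patchE; case: ifP.
(* The value of the inner integral as a function of the outer coordinate; the inverse of [p] finds
   the curve point above [y]. *)
pose Z (y : R) := sg * zeta (mkcoord m y (h (pinvm y))).
have pK s : a <= s <= b -> pinvm (p s) = s.
  by move=> sab; apply: (pinvK (lg_tau lg) (lg_derivable lg) (lg_sign lg)); rewrite in_itv.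
have inner y : (\int[mu]_z ((dz \_ U) (mkcoord m y z))%:E = ((Z \_ (p @` `[a, b])) y)%:E)%E.
  have [[s sab psy]|ny] := pselect (exists2 s, a < s < b & p s = y).
    have sab' : a <= s <= b by case/andP: sab => ? ?; rewrite !ltW.
    rewrite patchE mem_set; last by exists s => //=; rewrite in_itv.
    rewrite /Z -psy pK//.
    pose f z := zeta (mkcoord m (p s) z); pose f' z := dz (mkcoord m (p s) z).
    have H1 z : is_derive z (1 : R) f (f' z).
      apply/is_derive_line; apply: derivableP.
      exact/diff_derivable/smooth_differentiable.
    have H2 : continuous f'.
      move=> z; apply: (@continuous_comp _ _ _ (fun z => mkcoord m (p s) z) dz); last exact: cdz.
      by apply: continuous_mkcoord; [exact: cvg_cst|exact: cvg_id].
    have H3 z : ~ (lo < z < hi) -> f z = 0 /\ f' z = 0.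
      move=> nz; have nQ : ~ Q (mkcoord m (p s) z) by move=> /gbox_mkcoord - /(_ sab') [].
      by rewrite /f /f' zQ// dzQ.
    have H4 z : lo < z < hi -> (U (mkcoord m (p s) z) <-> 0 < sg * (h s - z)).
      by move=> zlh; exact: (lg_side lg).
    rewrite -(integral_supp_half (lg_sg lg) (lg_range lg sab) H1 H2 H3 H4).
    by apply: eq_integral => z _; rewrite !patchE.
  have dz0' z : dz (mkcoord m y z) = 0.
    by apply: dzQ => -[[s sab]]; rewrite ocoord_mkcoord => ys _; apply: ny; exists s.
  rewrite (_ : (fun z => _) = cst 0%E); last first.
    by apply/funext => z; rewrite patchE dz0'; case: ifP.
  (* Here [y] can only be [p a] or [p b]; the curve point then lies outside [Q], where [zeta]
     vanishes. *)
  rewrite integral0 patchE; case: ifPn => // /set_mem [s /= sab psy]; congr EFin.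
  rewrite /Z zQ ?mulr0// => -[[t tab]]; rewrite ocoord_mkcoord => yt _.
  by apply: ny; exists t.
have mI : measurable (p @` `[a, b]).
  rewrite (graph_image (lg_ab lg) (lg_tau lg) (lg_derivable lg) (lg_sign lg)).
  by case: ifP => _; exact: measurable_itv.
rewrite /Rintegral integral_mkcond.
have -> : (\int[leb2 R]_x ((fun x => (dz x)%:E) \_ U) x =
    \int[leb2 R]_x ((dz \_ U) x)%:E)%E.
  by apply: eq_integral => x _; rewrite !patchE; case: ifP.
rewrite (fubini_line m intT).
have -> : (\int[mu]_y \int[mu]_z ((dz \_ U) (mkcoord m y z))%:E =
    \int[mu]_y ((Z \_ (p @` `[a, b])) y)%:E)%E.
  by apply: eq_integral => y _; exact: inner.
have -> : (\int[mu]_y ((Z \_ (p @` `[a, b])) y)%:E = \int[mu]_(y in p @` `[a, b]) (Z y)%:E)%E.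
  by rewrite [RHS]integral_mkcond; apply: eq_integral => y _; rewrite !patchE; case: ifP.
rewrite (integral_graph (lg_ab lg) (lg_tau lg) (lg_derivable lg) (lg_continuous' lg) (lg_sign lg)); last first.
  move=> y; apply: cvgMr.
  apply: (@continuous_comp (subspace (p @` `[a, b])) _ _
    (fun y => mkcoord m y (h (pinvm y))) zeta); last exact: czeta.
  apply: continuous_mkcoord.
    exact: (@continuous_subspaceT _ _ _ id (fun x => @cvg_id _ (nbhs x))).
  apply: (@continuous_comp (subspace (p @` `[a, b])) _ _ pinvm h).
    exact: (continuous_pinv (lg_ab lg) (lg_tau lg) (lg_derivable lg) (lg_sign lg)).
  exact: (lg_continuous lg).
have cint : continuous (fun s => zeta (gam s) * (tau * derive1 p s)).
  move=> s; apply: cvgM; last by apply: cvgMr; exact: (lg_continuous' lg).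
  apply: (@continuous_comp _ _ _ gam zeta); last exact: czeta.
  rewrite (_ : gam = fun s => mkcoord m (p s) (h s)); last exact/funext.
  by apply: continuous_mkcoord; [exact: cont_p|exact: (lg_continuous lg)].
have -> : (\int[mu]_(s in `[a, b]) (Z (p s) * (tau * derive1 p s))%:E =
   \int[mu]_(s in `[a, b]) (sg * (zeta (gam s) * (tau * derive1 p s)))%:E)%E.
  apply: eq_integral => s; rewrite inE /= in_itv /= => sab.
  by rewrite /Z pK// -gamE -mulrA.
rewrite integral_itv_bndoo; last first.
  apply/measurable_EFinP; apply: measurable_funTS; apply: continuous_measurable_fun.
  by move=> x; apply: cvgMr; exact: cint.
rewrite -[LHS]/(Rintegral mu _ _) RintegralZl//.
exact: continuous_integrable_oo.
Qed.

End LocalGraph.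
End Green.

(** * Products of smooth functions and their supports *)

Section SmoothAlgebra.
Variable R : realType.
Implicit Types (f g : plane R -> R) (m : 'I_2).

Lemma Ck_weaken n f : Ck n.+1 setT f -> Ck n setT f.
Proof.
elim: n f => [|n IH] f [df Df].
  by move=> x _; apply: differentiable_continuous; exact: df.
by split => // m; exact: IH.
Qed.

Lemma CkD n f g : Ck n setT f -> Ck n setT g -> Ck n setT (fun x => f x + g x).
Proof.
elim: n f g => [|n IH] f g.
  by move=> cf cg x _; apply: cvgD; [exact: cf|exact: cg].
move=> [df Df] [dg Dg]; split.
  by move=> x _; apply: (@differentiableD _ _ _ f g); [exact: df|exact: dg].
move=> m; rewrite (_ : (fun x => _) = (fun x => 'D_(ebase R m) f x + 'D_(ebase R m) g x)).
  by apply: IH; [exact: Df|exact: Dg].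
by apply/funext => x; rewrite (@deriveD _ _ _ f g)//; apply: diff_derivable; [exact: df|exact: dg].
Qed.

Lemma CkM n f g : Ck n setT f -> Ck n setT g -> Ck n setT (fun x => f x * g x).
Proof.
elim: n f g => [|n IH] f g.
  by move=> cf cg x _; apply: cvgM; [exact: cf|exact: cg].
move=> /[dup] Cf [df Df] /[dup] Cg [dg Dg]; split.
  by move=> x _; apply: (@differentiableM _ _ f g); [exact: df|exact: dg].
move=> m; rewrite (_ : (fun x => _) =
    (fun x => f x * 'D_(ebase R m) g x + g x * 'D_(ebase R m) f x)).
  apply: CkD; apply: IH.
  - exact: Ck_weaken.
  - exact: Dg.
  - exact: Ck_weaken.
  - exact: Df.
by apply/funext => x; rewrite (@deriveM _ _ f g)//; apply: diff_derivable; [exact: df|exact: dg].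
Qed.

Lemma smoothM f g : smooth f -> smooth g -> smooth (fun x => f x * g x).
Proof. by move=> sf sg n; exact: CkM. Qed.

Lemma derive_mul f g x m : smooth f -> smooth g ->
  'D_(ebase R m) (fun x => f x * g x) x =
  f x * 'D_(ebase R m) g x + 'D_(ebase R m) f x * g x.
Proof.
move=> sf sg; rewrite (@deriveM _ _ f g); first by rewrite [X in _ + X]mulrC.
- by apply: diff_derivable; exact: smooth_differentiable.
- by apply: diff_derivable; exact: smooth_differentiable.
Qed.

Lemma csupp_mull f g U : compactly_supported_in U g ->
  compactly_supported_in U (fun x => f x * g x).
Proof. by move=> [C [cC CU g0]]; exists C; split => // x /g0 ->; rewrite mulr0. Qed.

Lemma smooth_tens m (al be : R -> R) : (forall n, nderivable n al) -> (forall n, nderivable n be) ->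
  smooth (fun x => al (ocoord m x) * be (coord m x)).
Proof.
rewrite /ocoord /coord => Da Db; case: (m == ord0); last exact: smooth_tensor.
rewrite (_ : (fun x : plane R => _) = (fun x : plane R => be x.1 * al x.2)).
  exact: smooth_tensor.
by apply/funext => x; rewrite mulrC.
Qed.

Lemma compact_rect m (a1 b1 a2 b2 : R) :
  compact [set x : plane R | a1 <= ocoord m x <= b1 /\ a2 <= coord m x <= b2].
Proof.
rewrite /ocoord /coord; case: (m == ord0).
  rewrite (_ : [set x | _] = cbox ((a2, b2), (a1, b1))); first exact: compact_cbox.
  by apply/seteqP; split => x /= [H1 H2]; (split; move: H1 H2; rewrite /= !in_itv).
rewrite (_ : [set x | _] = cbox ((a1, b1), (a2, b2))); first exact: compact_cbox.
by apply/seteqP; split => x /= [H1 H2]; (split; move: H1 H2; rewrite /= !in_itv).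
Qed.

End SmoothAlgebra.

(** * Green's formula for traces, and their uniqueness *)

Section Traces.
Variable R : realType.
Local Notation mu := (@lebesgue_measure R).
Variables (gam : R -> plane R) (m : 'I_2) (tau a b lo hi : R) (J : set R).
Let p s := ocoord m (gam s).
Let h s := coord m (gam s).
Let Q := gbox gam m a b lo hi.
Hypothesis mJ : measurable (J : set (measurableTypeR R)).
Hypothesis abJ : `]a, b[ `<=` J.

(** The volume side of Green's formula for [w * eta]. It involves [w] and its weak derivative but no
    trace, so traces from different domains can be compared through it. *)
Definition green_form (U : set (plane R)) (w eta : plane R -> R) : R :=
  \int[leb2 R]_(x in U) (w x * 'D_(ebase R m) eta x + wpart U m w x * eta x).

Lemma local_graph_continuous U sg : local_graph U gam m sg tau a b lo hi -> continuous gam.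
Proof.
move=> lg s; rewrite (_ : gam = fun s => mkcoord m (p s) (h s)); last first.
  by apply/funext => t; rewrite mkcoordK.
apply: continuous_mkcoord; last exact: (lg_continuous lg).
by apply/differentiable_continuous/derivable1_diffP; exact: (lg_derivable lg).
Qed.

(** Green's formula for the smooth approximants [phi n]; convergence in L^2 of [phi n] and its
    derivative on [U], and of its restriction on [J], passes to the limit in the three integrals. *)
Lemma trace_green U sg w g eta : open U -> local_graph U gam m sg tau a b lo hi ->
  is_trace U gam J w g -> smooth eta -> compactly_supported_in Q eta ->
  green_form U w eta =
  sg * \int[mu]_(s in `]a, b[) (g (gam s) * (eta (gam s) * (tau * derive1 p s))).
Proof.
move=> oU lg [Hw Lg [phi [sphi c0 c1 c2]]] se ce.
have mU := open_measurable_plane oU.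
have cgam := local_graph_continuous lg.
have mab : measurable (`]a, b[%classic : set (measurableTypeR R)) by exact: measurable_itv.
have sde := smooth_partial m se; have cde := csupp_partial m ce.
have Lde := csupp_L2 oU (smooth_continuous sde) cde.
have Le := csupp_L2 oU (smooth_continuous se) ce.
have mphi k : measurable_fun (U : set (mplane R)) (phi k).
  by apply: measurable_plane => // x _; exact: smooth_continuous.
have mdphi k : measurable_fun (U : set (mplane R)) (fun x => 'D_(ebase R m) (phi k) x).
  by apply: measurable_plane => // x _; apply: smooth_continuous; exact: smooth_partial.
have [Lw _] := wpartP (Hw.2 m).
have cv0 := L2_cvg_mul mU Hw.1 Lde mphi c0.
have cv1 := L2_cvg_mul mU Lw Le mdphi (c1 m).
pose W s := eta (gam s) * (tau * derive1 p s).
have cW : continuous W.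
  move=> s; apply: cvgM; last by apply: cvgMr; exact: (lg_continuous' lg).
  by apply: (@continuous_comp _ _ _ gam eta); [exact: cgam|exact: smooth_continuous].
have mW A : measurable A -> measurable_fun (A : set (measurableTypeR R)) W.
  by move=> mA; apply: measurable_funTS; exact: continuous_measurable_fun.
(* The approximants converge in L^2 on [J], not just on ]a, b[; the cut-off weight turns the curve
   integral into a pairing on all of [J]. *)
pose W' := W \_ `]a, b[.
have LW' : L2 mu J W'.
  apply: (@L2_supp _ _ _ mu J `]a, b[%classic) => //.
  - by apply: measurable_funTS; apply/(measurable_restrictT _ _).1 => //; exact: mW.
  - by move=> s _ sab; rewrite /W' patchE memNset.
  - split.
      apply: (eq_measurable_fun W); last exact: mW.
      by move=> s sab; rewrite /W' patchE sab.
    have cW2 : continuous (fun s => W s ^+ 2).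
      by move=> s; apply: (@continuous_comp _ _ _ W (fun y => y ^+ 2)); [exact: cW|exact: exprn_continuous].
    apply: eq_integrable (continuous_integrable_oo a b cW2) => //.
    by move=> s sab /=; rewrite /W' patchE sab.
have mphig k : measurable_fun (J : set (measurableTypeR R)) (fun s => phi k (gam s)).
  apply: measurable_funTS; apply: continuous_measurable_fun => s.
  by apply: (@continuous_comp _ _ _ gam (phi k)); [exact: cgam|exact: smooth_continuous].
have cv2 := L2_cvg_mul mJ Lg LW' mphig c2.
have restr (F : R -> R) : \int[mu]_(s in J) (F s * W' s) = \int[mu]_(s in `]a, b[) (F s * W s).
  transitivity (\int[mu]_(s in `]a, b[) (F s * W' s)).
    apply: Rintegral_restrict_subset => // s _ sab.
    by rewrite /W' patchE memNset ?mulr0.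
  by apply: eq_Rintegral => s sab; rewrite /W' patchE sab.
have E k : \int[leb2 R]_(x in U) (phi k x * 'D_(ebase R m) eta x) +
    \int[leb2 R]_(x in U) ('D_(ebase R m) (phi k) x * eta x) =
    sg * \int[mu]_(s in J) (phi k (gam s) * W' s).
  have cphi := smooth_continuous (sphi k); have ceta := smooth_continuous se.
  have cdphi := smooth_continuous (smooth_partial m (sphi k)).
  have cdeta := smooth_continuous sde.
  rewrite -RintegralD//.
  - rewrite restr; transitivity (\int[leb2 R]_(x in U) 'D_(ebase R m) (fun x => phi k x * eta x) x).
      by apply: eq_Rintegral => x _; rewrite derive_mul.
    rewrite (green oU lg).
    + by congr (_ * _); apply: eq_Rintegral => s _; rewrite /W -mulrA.
    + exact: smoothM.
    + exact: csupp_mull.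
  - apply: (@csupp_integrable _ (fun x => phi k x * 'D_(ebase R m) eta x) Q) => //.
      by move=> x; apply: cvgM; [exact: cphi|exact: cdeta].
    exact: csupp_mull.
  - apply: (@csupp_integrable _ (fun x => 'D_(ebase R m) (phi k) x * eta x) Q) => //.
      by move=> x; apply: cvgM; [exact: cdphi|exact: ceta].
    exact: csupp_mull.
have cvL : sg * \int[mu]_(s in J) (phi n (gam s) * W' s) @[n --> \oo] -->
    \int[leb2 R]_(x in U) (w x * 'D_(ebase R m) eta x) +
    \int[leb2 R]_(x in U) (wpart U m w x * eta x).
  rewrite (_ : (fun n => _) =
    (fun n => \int[leb2 R]_(x in U) (phi n x * 'D_(ebase R m) eta x)) +
    (fun n => \int[leb2 R]_(x in U) ('D_(ebase R m) (phi n) x * eta x))).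
    exact: cvgD cv0 cv1.
  by apply/funext => k; rewrite -E.
have cvR : sg * \int[mu]_(s in J) (phi n (gam s) * W' s) @[n --> \oo] -->
    sg * \int[mu]_(s in J) (g (gam s) * W' s) by apply: cvgMr.
rewrite /green_form RintegralD//; last 2 first.
- exact: (L2_mul_integrable mU Hw.1 Lde).
- exact: (L2_mul_integrable mU Lw Le).
rewrite -[in RHS]restr.
exact: (cvg_unique _ cvL cvR).
Qed.

(** Multiplying by [sg] isolates the curve integral, since [sg * sg = 1]. Testing with products that
    approximate, along [gam], the indicator of a parameter interval shows that (g1 - g2) times the
    positive weight [tau * derive1 p] vanishes a.e. *)
Lemma trace_uniq U1 U2 sg1 sg2 w1 w2 g1 g2 : open U1 -> open U2 ->
  local_graph U1 gam m sg1 tau a b lo hi -> local_graph U2 gam m sg2 tau a b lo hi ->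
  is_trace U1 gam J w1 g1 -> is_trace U2 gam J w2 g2 ->
  (forall eta, smooth eta -> compactly_supported_in Q eta ->
    sg1 * green_form U1 w1 eta = sg2 * green_form U2 w2 eta) ->
  {ae mu, forall s, `]a, b[%classic s -> g1 (gam s) = g2 (gam s)}.
Proof.
move=> oU1 oU2 lg1 lg2 t1 t2 H.
have ab := lg_ab lg1; have dp := lg_derivable lg1; have tau1 := lg_tau lg1.
have p'0 := lg_sign lg1; have cgam := local_graph_continuous lg1.
have mab : measurable (`]a, b[%classic : set (measurableTypeR R)) by exact: measurable_itv.
have ctp' : continuous (fun s => tau * derive1 p s).
  by move=> s; apply: cvgMr; exact: (lg_continuous' lg1).
have sgK U sg : local_graph U gam m sg tau a b lo hi -> sg * sg = 1.
  by move=> lg; case: (lg_sg lg) => ->; rewrite ?mulrNN mulr1.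
have Lab g : L2 mu J (g \o gam) -> L2 mu `]a, b[ (g \o gam) by exact: L2_sub.
have L1 : L2 mu `]a, b[ (g1 \o gam) by case: t1 => _ L1 _; exact: Lab.
have L2_ : L2 mu `]a, b[ (g2 \o gam) by case: t2 => _ L2_ _; exact: Lab.
have LC (W : R -> R) : continuous W -> L2 mu `]a, b[ W.
  move=> cW; split; first by apply: measurable_funTS; exact: continuous_measurable_fun.
  apply: continuous_integrable_oo => s.
  by apply: (@continuous_comp _ _ _ W (fun y => y ^+ 2)); [exact: cW|exact: exprn_continuous].
pose f s := (g1 (gam s) - g2 (gam s)) * (tau * derive1 p s).
have intf : mu.-integrable `]a, b[ (EFin \o f).
  by apply: L2_mul_integrable => //; [exact: L2B|exact: LC].
suff f0 : {ae mu, forall s, `]a, b[%classic s -> f s = 0}.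
  apply: ae_impl f0 => s fs /[dup] sab /fs /eqP; rewrite mulf_eq0 subr_eq0 => /orP[/eqP//|].
  by rewrite gt_eqF// p'0//; move: sab; rewrite /= in_itv /= => /andP[? ?]; rewrite !ltW.
apply: ae0_of_ocitv => // c' e'.
(* Clamping to [a, b], the only interval on which [p] is known to be monotone; on ]a, b[ it does not
   change the comparison with [c'] or [e']. *)
pose cl x := Num.min b (Num.max a x).
have clab x : a <= cl x <= b.
  by rewrite /cl le_min ge_min lexx (ltW ab) le_max lexx.
have clE s x : a < s < b -> (cl x < s) = (x < s).
  by move=> /andP[sa sb]; rewrite /cl gt_min gt_max sa ltNge (ltW sb).
have mono := graph_homo_inv tau1 dp p'0.
(* Parameter thresholds become thresholds for [tau * p], which increases with the parameter; the
   test function can thus be written in the coordinates of the plane. *)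
pose c := tau * p (cl c'); pose e := tau * p (cl e').
pose ya := Num.min (p a) (p b); pose yb := Num.max (p a) (p b).
have tauE y : (tau * p a < tau * y < tau * p b) = (ya < y < yb).
  have := mono a b; rewrite !lexx (ltW ab) ab => /(_ isT isT).
  rewrite /ya /yb; case: tau1 => ->; rewrite ?mul1r ?mulN1r ?ltrN2 => h1.
    by rewrite (min_l (ltW h1)) (max_r (ltW h1)).
  by rewrite (min_r (ltW h1)) (max_l (ltW h1)) andbC.
have yab y : ya < y < yb -> exists2 s, a < s < b & y = p s.
  by rewrite -tauE => /(graph_image_oo ab tau1 dp p'0)[s sab <-]; exists s.
have psab s : a < s < b -> ya < p s < yb.
  by move=> sab; rewrite -tauE; apply/(graph_image_oo ab tau1 dp p'0); exists s.
pose al k y := theta ya yb k y * ocstep c e k (tau * y + 0).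
pose be k z := theta lo hi k z.
pose eta k x := al k (ocoord m x) * be k (coord m x).
have Dal k n : nderivable n (al k) by apply: nderivableM; [exact: nderivable_theta|apply: nderivable_affine; exact: nderivable_ocstep].
have se k : smooth (eta k) by apply: smooth_tens => // n; exact: nderivable_theta.
have ce k : compactly_supported_in Q (eta k).
  have [a1 [b1 [s1 z1]]] := theta_itv ya yb k.
  have [a2 [b2 [s2 z2]]] := theta_itv lo hi k.
  exists [set x | a1 <= ocoord m x <= b1 /\ a2 <= coord m x <= b2]; split; first exact: compact_rect.
    move=> x /= [x1 x2]; split.
      by apply: yab; have /= := s1 (ocoord m x); rewrite !in_itv /=; exact.
    by have /= := s2 (coord m x); rewrite !in_itv /=; exact.
  move=> x /= xn; rewrite /eta /al /be.
  have [x1|x1] := boolP (ocoord m x \in `[a1, b1]); last by rewrite z1// !mul0r.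
  have [x2|x2] := boolP (coord m x \in `[a2, b2]); last by rewrite z2// mulr0.
  by exfalso; apply: xn; move: x1 x2; rewrite !in_itv.
apply: (@Rintegral_dct0 _ _ _ mu _ _ _ (fun k s => eta k (gam s))) => //.
- move=> k; apply: measurable_funTS; apply: continuous_measurable_fun => s.
  by apply: (@continuous_comp _ _ _ gam (eta k)); [exact: cgam|exact: smooth_continuous].
- by move=> k s _; apply: norm_mul_le1; [apply: norm_mul_le1|];
    [exact: norm_theta_le1|exact: norm_ocstep_le1|exact: norm_theta_le1].
- move=> s; rewrite /= in_itv /= => sab.
  have -> : (\1_(`]c', e'] : set R) s : R) = 1 * \1_(`]c, e] : set R) (tau * p s + 0) * 1.
    have sab' : a <= s <= b by case/andP: sab => ? ?; rewrite !ltW.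
    rewrite mulr1 mul1r addr0 !indicE; congr (_%:R); congr nat_of_bool.
    apply/idP/idP => /set_mem H'; apply/mem_set; move: H'; rewrite /= !in_itv /= /c /e.
      by rewrite mono// clE// leNgt (leNgt _ (tau * _)) mono// clE.
    by rewrite mono// clE// leNgt (leNgt _ e') mono// clE.
  apply: cvgM; last by apply: theta_cvg; exact: (lg_range lg1).
  apply: cvgM; last exact: ocstep_cvg.
  by apply: theta_cvg; exact: psab.
- move=> k.
  have := H _ (se k) (ce k).
  rewrite (trace_green oU1 lg1 t1 (se k) (ce k)) (trace_green oU2 lg2 t2 (se k) (ce k)).
  rewrite !mulrA (sgK _ _ lg1) (sgK _ _ lg2) !mul1r => E.
  have iW g : L2 mu `]a, b[ (g \o gam) ->
      mu.-integrable `]a, b[ (EFin \o (fun s => g (gam s) * (eta k (gam s) * (tau * derive1 p s)))).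
    move=> Lg; apply: L2_mul_integrable => //; apply: LC => s.
    apply: cvgM; last exact: ctp'.
    by apply: (@continuous_comp _ _ _ gam (eta k)); [exact: cgam|exact: smooth_continuous].
  transitivity (\int[mu]_(s in `]a, b[) (g1 (gam s) * (eta k (gam s) * (tau * derive1 p s))) -
     \int[mu]_(s in `]a, b[) (g2 (gam s) * (eta k (gam s) * (tau * derive1 p s)))).
    rewrite -RintegralB//; [|exact: iW|exact: iW].
    by apply: eq_Rintegral => s _; rewrite /f; ring.
  by rewrite E subrr.
Qed.

End Traces.

(** * Curved triangles *)

Section Barycentric.
Variables (R : realType) (T : mesh R).
Hypothesis nd : nondegenerate T.
Implicit Types (x y : plane R) (q : 'I_3).
Local Notation v := (refv T).
Local Notation i1 := (inord 1 : 'I_3).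
Local Notation i2 := (inord 2 : 'I_3).

Lemma ord3P q : [\/ q = ord0, q = i1 | q = i2].
Proof.
case: q => -[|[|[|//]]] ?; [apply: Or31|apply: Or32|apply: Or33];
  by apply: val_inj; rewrite /= ?inordK.
Qed.

Lemma sum_ord3 (V : nmodType) (f : 'I_3 -> V) : \sum_(q < 3) f q = f ord0 + f i1 + f i2.
Proof.
rewrite !big_ord_recl big_ord0 addr0 addrA; congr (_ + _ + _); congr f;
  by apply: val_inj; rewrite /= inordK.
Qed.

Let det (x y : plane R) := x.1 * y.2 - x.2 * y.1.
Let l1 x := det (x - v ord0) (v i2 - v ord0) / det (v i1 - v ord0) (v i2 - v ord0).
Let l2 x := det (v i1 - v ord0) (x - v ord0) / det (v i1 - v ord0) (v i2 - v ord0).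

(** Barycentric coordinates by Cramer's rule, defined on the whole plane so that the reference
    triangle is cut out by continuous inequalities. *)
Definition lam q x : R :=
  if q == ord0 then 1 - l1 x - l2 x else if q == i1 then l1 x else l2 x.

Let lam0 x : lam ord0 x = 1 - l1 x - l2 x. Proof. by []. Qed.
Let lam1 x : lam i1 x = l1 x.
Proof. by rewrite /lam eqxx ifF//; apply/negP => /eqP/(congr1 val); rewrite /= inordK. Qed.
Let lam2 x : lam i2 x = l2 x.
Proof.
by rewrite /lam !ifF//; apply/negP => /eqP/(congr1 val); rewrite /= ?inordK.
Qed.

Lemma sum_lam x : \sum_(q < 3) lam q x = 1.
Proof. rewrite sum_ord3 lam0 lam1 lam2; ring. Qed.

Lemma lam_decomp x : x = \sum_(q < 3) lam q x *: v q.
Proof.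
rewrite sum_ord3 lam0 lam1 lam2 /l1 /l2 /det; move: nd; rewrite /Defs.nondegenerate.
case: x (v ord0) (v i1) (v i2) => [x1 x2] [a1 a2] [b1 b2] [c1 c2] /= d0.
by congr pair; rewrite /= /GRing.scale /=; field.
Qed.

Lemma lam_comb (l : 'I_3 -> R) q : \sum_(r < 3) l r = 1 ->
  lam q (\sum_(r < 3) l r *: v r) = l q.
Proof.
rewrite !sum_ord3 => s1; have l0 : l ord0 = 1 - l i1 - l i2 by rewrite -s1; ring.
have H1 : l1 (l ord0 *: v ord0 + l i1 *: v i1 + l i2 *: v i2) = l i1.
  rewrite /l1 /det l0; move: nd; rewrite /Defs.nondegenerate.
  case: (v ord0) (v i1) (v i2) => [a1 a2] [b1 b2] [c1 c2] /= d0.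
  by rewrite /GRing.scale /=; field.
have H2 : l2 (l ord0 *: v ord0 + l i1 *: v i1 + l i2 *: v i2) = l i2.
  rewrite /l2 /det l0; move: nd; rewrite /Defs.nondegenerate.
  case: (v ord0) (v i1) (v i2) => [a1 a2] [b1 b2] [c1 c2] /= d0.
  by rewrite /GRing.scale /=; field.
have [-> | -> | ->] := ord3P q.
- by rewrite lam0 H1 H2 -l0.
- by rewrite lam1 H1.
- by rewrite lam2 H2.
Qed.

Lemma KhatP x : Khat T x <-> forall q, 0 <= lam q x.
Proof.
split=> [[l [l0 s1 ->]] q|l0]; first by rewrite lam_comb.
by exists (fun q => lam q x); split; [|exact: sum_lam|exact: lam_decomp].
Qed.

Lemma lam_affine q (s t : R) x y : s + t = 1 ->
  lam q (s *: x + t *: y) = s * lam q x + t * lam q y.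
Proof.
move=> st1; rewrite {1}(lam_decomp x) {1}(lam_decomp y) !scaler_sumr -big_split /=.
rewrite (_ : \sum_(i < 3) _ = \sum_(i < 3) (s * lam i x + t * lam i y) *: v i); last first.
  by apply: eq_bigr => i _; rewrite !scalerA -scalerDl.
by rewrite lam_comb// big_split /= -!mulr_sumr !sum_lam !mulr1.
Qed.

Lemma continuous_lam q : continuous (lam q).
Proof.
have cd (u w : plane R) (k : R) : continuous (fun x : plane R => det (x - u) w / k).
  move=> x; apply: cvgMl; apply: cvgB; apply: cvgMl.
    by apply: (@continuous_comp _ _ _ (fun x => x - u) fst); [apply: cvgB; [exact: cvg_id|exact: cvg_cst]|exact: cvg_fst].
  by apply: (@continuous_comp _ _ _ (fun x => x - u) snd); [apply: cvgB; [exact: cvg_id|exact: cvg_cst]|exact: cvg_snd].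
have c1 : continuous l1 by exact: cd.
have c2 : continuous l2.
  rewrite (_ : l2 = fun x => det (x - v ord0) (v i1 - v ord0) / - det (v i1 - v ord0) (v i2 - v ord0)).
    exact: cd.
  by apply/funext => x; rewrite invrN mulrN -mulNr /l2; congr (_ / _); rewrite /det; ring.
have [->|->|->] := ord3P q.
- by move=> x; apply: cvgB; [apply: cvgB; [exact: cvg_cst|exact: c1]|exact: c2].
- by rewrite (_ : lam i1 = l1); [exact: c1|apply/funext => x; exact: lam1].
- by rewrite (_ : lam i2 = l2); [exact: c2|apply/funext => x; exact: lam2].
Qed.

Lemma lam_le1 q x : Khat T x -> lam q x <= 1.
Proof.
move=> /KhatP l0; rewrite -(sum_lam x) (bigD1 q)//= lerDl.
by apply: sumr_ge0 => r _; exact: l0.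
Qed.

Lemma compact_sublam (C : set (plane R)) : closed C -> C `<=` Khat T -> compact C.
Proof.
move=> cC CK.
pose M := \sum_(q < 3) `|v q|.
have H x : Khat T x -> `|x| <= M.
  move=> Kx; rewrite {1}(lam_decomp x); apply: le_trans (ler_norm_sum _ _ _) _.
  apply: ler_sum => q _; rewrite normrZ ler_piMl// ger0_norm ?lam_le1//.
  by move/KhatP: Kx; exact.
apply: (@subclosed_compact _ _ (cbox ((- M, M), (- M, M)))) => //; first exact: compact_cbox.
move=> x /CK/H; rewrite prod_normE ge_max => /andP[/= x1 x2].
by split => /=; rewrite in_itv /= -ler_norml.
Qed.

Lemma closed_lam_ge0 q : closed [set x | 0 <= lam q x].
Proof.
apply: (@closed_comp _ _ (lam q) [set t | 0 <= t]); last exact: closed_ge.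
by move=> x _; exact: continuous_lam.
Qed.

Lemma closed_lam0 q : closed [set x | lam q x = 0].
Proof.
apply: (@closed_comp _ _ (lam q) [set t | t = 0]); last exact: closed_eq.
by move=> x _; exact: continuous_lam.
Qed.

Lemma closed_Khat : closed (Khat T).
Proof.
rewrite (_ : Khat T = \bigcap_(q in setT) [set x | 0 <= lam q x]).
  by apply: closed_bigI => q _; exact: closed_lam_ge0.
by apply/seteqP; split=> x; [move/KhatP => H q _; exact: H|move=> H; apply/KhatP => q; exact: H].
Qed.

Lemma nbhs_Khat x : (forall q, 0 < lam q x) -> nbhs x (Khat T).
Proof.
move=> l0.
have H q : \forall y \near x, 0 < lam q y.
  by have c := @continuous_lam q x; exact: c _ (lt_nbhsr (l0 q)).
apply: filterS3 (H ord0) (H i1) (H i2) => y y0 y1 y2; apply/KhatP => q.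
by have [-> | -> | ->] := ord3P q; exact: ltW.
Qed.

(** The vertex opposite to the edge [p]. *)
Definition third (p : 'I_3) : 'I_3 := ordS (ordS p).

Lemma third_neq p : [/\ third p != p, third p != ordS p & ordS p != p].
Proof. by case: p => -[|[|[|//]]] ?; split; apply/negP => /eqP/(congr1 val). Qed.

Lemma ord3_cases p q : [\/ q = p, q = ordS p | q = third p].
Proof.
case: p => -[|[|[|//]]] ?; case: q => -[|[|[|//]]] ?;
  by [apply: Or31; exact: val_inj|apply: Or32; exact: val_inj|apply: Or33; exact: val_inj].
Qed.

Lemma sum_ord3_at (V : nmodType) (f : 'I_3 -> V) p :
  \sum_(q < 3) f q = f p + f (ordS p) + f (third p).
Proof.
have [n1 n2 n3] := third_neq p.
rewrite (bigD1 p)//= (bigD1 (ordS p))//= (bigD1 (third p)) ?n1//= big1 ?addr0 ?addrA// => q.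
by have [->|->|->] := ord3_cases p q; rewrite ?eqxx ?andbF.
Qed.

Lemma lam_refedge p t q : lam q (refedge T p t) =
  if q == p then 1 - t else if q == ordS p then t else 0.
Proof.
have [n1 n2 n3] := third_neq p.
pose l r := if r == p then 1 - t else if r == ordS p then t else 0.
rewrite (_ : refedge T p t = \sum_(r < 3) l r *: v r).
  rewrite lam_comb// (sum_ord3_at _ p) /l eqxx (negbTE n3) eqxx (negbTE n1) (negbTE n2); ring.
by rewrite (sum_ord3_at _ p) /l eqxx (negbTE n3) eqxx (negbTE n1) (negbTE n2) scale0r addr0.
Qed.

Lemma Khat_refedge p t : 0 <= t <= 1 -> Khat T (refedge T p t).
Proof.
move=> /andP[t0 t1]; apply/KhatP => q; rewrite lam_refedge.
by case: ifP => _; [rewrite subr_ge0|case: ifP].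
Qed.

Lemma refedgeE p x : lam (third p) x = 0 -> x = refedge T p (lam (ordS p) x).
Proof.
move=> l0; rewrite {1}(lam_decomp x) (sum_ord3_at _ p) l0 scale0r addr0 /refedge.
have := sum_lam x; rewrite (sum_ord3_at _ p) l0 addr0 => <-.
by rewrite addrK.
Qed.

Lemma continuous_refedge p : continuous (refedge T p).
Proof.
move=> t; apply: cvgD; apply: cvgZl; last exact: cvg_id.
by apply: cvgB; [exact: cvg_cst|exact: cvg_id].
Qed.

End Barycentric.

(** * Euclidean inequalities and derivatives along lines *)

Section EuclideanPlane.
Variable R : realType.
Implicit Types (x y z r xi : plane R) (B : 'M[R]_2).

Lemma enorm_ge0 x : 0 <= enorm x. Proof. exact: sqrtr_ge0. Qed.

Lemma dotp_ge0 x : 0 <= dotp x x.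
Proof. by rewrite /dotp -!expr2 addr_ge0 ?sqr_ge0. Qed.

Lemma sqr_enorm x : enorm x ^+ 2 = dotp x x.
Proof. by rewrite /enorm sqr_sqrtr ?dotp_ge0. Qed.

Lemma dotp_eq0 x : dotp x x = 0 -> x = 0.
Proof.
case: x => x1 x2; rewrite /dotp /= => /eqP; rewrite -!expr2 paddr_eq0 ?sqr_ge0//.
by rewrite !sqrf_eq0 => /andP[/eqP -> /eqP ->].
Qed.

Lemma dotp_le_enorm x y : dotp x y <= enorm x * enorm y.
Proof.
apply: (le_trans (ler_norm _)); rewrite -ler_sqr ?nnegrE ?mulr_ge0 ?enorm_ge0//.
rewrite exprMn !sqr_enorm real_normK ?num_real// -subr_ge0 /dotp.
have -> : (x.1 * x.1 + x.2 * x.2) * (y.1 * y.1 + y.2 * y.2) - (x.1 * y.1 + x.2 * y.2) ^+ 2 =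
  (x.1 * y.2 - x.2 * y.1) ^+ 2 by ring.
exact: sqr_ge0.
Qed.

Lemma scale_twice (t u v w : R) :
  t *: u + t *: u + (v *: w + v *: w) = 2 * (t * u + v * w).
Proof. by rewrite /GRing.scale /=; ring. Qed.

Lemma dotpB x y : dotp x (x - y) = dotp x x - dotp x y.
Proof. by rewrite /dotp /=; ring. Qed.

Lemma enormB x y : enorm (x - y) = enorm (y - x).
Proof. by rewrite /enorm; congr Num.sqrt; rewrite /dotp /=; ring. Qed.

Lemma mulP_invK B xi : B \in unitmx -> mulP B (mulP (invmx B) xi) = xi.
Proof.
move=> /mulmxV/matrixP E; rewrite /mulP /=.
have e i j : \sum_k B i k * invmx B k j = (i == j)%:R by have := E i j; rewrite !mxE.
have := (e ord0 ord0, e ord0 ord_max, e ord_max ord0, e ord_max ord_max).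
rewrite !big_ord_recl !big_ord0 /=.
have l01 : lift ord0 ord0 = ord_max :> 'I_2 by exact: val_inj.
rewrite l01.
move=> [[[e1 e2] e3] e4]; case: xi => x1 x2 /=; congr pair.
- transitivity ((B ord0 ord0 * invmx B ord0 ord0 + (B ord0 ord_max * invmx B ord_max ord0 + 0)) * x1 +
    (B ord0 ord0 * invmx B ord0 ord_max + (B ord0 ord_max * invmx B ord_max ord_max + 0)) * x2).
    ring.
  by rewrite e1 e2 mul1r mul0r addr0.
- transitivity ((B ord_max ord0 * invmx B ord0 ord0 + (B ord_max ord_max * invmx B ord_max ord0 + 0)) * x1 +
    (B ord_max ord0 * invmx B ord0 ord_max + (B ord_max ord_max * invmx B ord_max ord_max + 0)) * x2).
    ring.
  by rewrite e3 e4 mul1r mul0r add0r.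
Qed.

Lemma mulP_Kinv B xi : B \in unitmx -> mulP (invmx B) (mulP B xi) = xi.
Proof. by move=> uB; rewrite -[in mulP B xi](invmxK B) mulP_invK// unitmx_inv. Qed.

Lemma derive_along (f : plane R -> R) z xi (t : R) : differentiable f (z + t *: xi) ->
  is_derive t (1 : R) (fun t => f (z + t *: xi)) ('d f (z + t *: xi) xi).
Proof.
move=> df; have dv : derivable f (z + t *: xi) xi by exact: diff_derivable.
have E : (fun h : R => h^-1 *: (f (z + (h *: (1 : R) + t) *: xi) - f (z + t *: xi))) =
    (fun h => h^-1 *: (f (h *: xi + (z + t *: xi)) - f (z + t *: xi))).
  apply/funext => h; congr (_ *: (f _ - _)).
  rewrite (_ : h *: (1 : R) = h); last by rewrite /GRing.scale /= mulr1.
  by rewrite scalerDl addrCA.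
apply: DeriveDef.
  by rewrite /derivable E.
by rewrite /derive E -deriveE.
Qed.

Lemma is_derive_affine (A : plane R -> plane R) z xi v :
  (forall h : R, A (h *: xi + z) - A z = h *: v) -> is_derive z xi A v.
Proof.
move=> HA.
have c : h^-1 *: (A (h *: xi + z) - A z) @[h --> (0 : R)^'] --> v.
  apply: cvg_near_cst; near=> h; rewrite HA scalerA mulVf ?scale1r//.
  by near: h; exact: nbhs_dnbhs_neq.
apply: DeriveDef; first by apply/cvg_ex; exists v.
exact/cvg_lim.
Unshelve. all: by end_near. Qed.

End EuclideanPlane.

(** * Injectivity and openness of the element maps *)

Section ElementMap.
Variables (R : realType) (T : mesh R).
Hypothesis nd : nondegenerate T.
Variable i : 'I_(nel T).
Hypothesis ct : curved_triangle i.
Local Notation F := (@Fmap R T i).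
Implicit Types (x y z r xi : plane R).

Let Fm m x := coord m (F x).

Lemma Fmap_differentiable m x : Khat T x -> differentiable (Fm m) x.
Proof.
move=> Kx; have [[U [oU KU CU]] _] := ct.
by have [dF _] := CU m; apply: dF; exact: KU.
Qed.

Let dF x xi : plane R := ('d (Fm ord0) x xi, 'd (Fm ord_max) x xi).

Let F_eta : F = fun y => (Fm ord0 y, Fm ord_max y).
Proof. by apply/funext => y; rewrite /Fm /coord /=; case: (F y). Qed.

Let dFE x : Khat T x -> differentiable F x /\ forall xi, 'd F x xi = dF x xi.
Proof.
move=> Kx; have d0 := Fmap_differentiable ord0 Kx; have d1 := Fmap_differentiable ord_max Kx.
by split=> [|xi]; rewrite F_eta ?(diff_pair d0 d1)//; exact: differentiable_pair.
Qed.

Lemma Fmap_continuous x : Khat T x -> {for x, continuous F}.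
Proof. by move=> /dFE[dFx _]; exact: differentiable_continuous. Qed.

Let dotF r z xi (t : R) : Khat T (z + t *: xi) ->
  is_derive t (1 : R) (fun t => dotp r (F (z + t *: xi))) (dotp r (dF (z + t *: xi) xi)).
Proof.
move=> Kz; have d0 := derive_along (Fmap_differentiable ord0 Kz).
have d1 := derive_along (Fmap_differentiable ord_max Kz).
exact: (is_deriveD (is_deriveZ r.1 d0) (is_deriveZ r.2 d1)).
Qed.

(* [sup |D Phi B^-1| < 1] makes [DF] positive with respect to [B]. *)
Lemma Fmap_coercive : exists B : 'M[R]_2, B \in unitmx /\
  forall z xi, Khat T z -> mulP B xi != 0 -> 0 < dotp (mulP B xi) (dF z xi).
Proof.
have [_ [B [b [uB [c [c1 H]]]]]] := ct; exists B; split => // z xi Kz Bxi.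
have := H z Kz (mulP B xi); rewrite mulP_Kinv//.
have [dFz dFzE] := dFE Kz.
pose A x := mulP B x + b.
have dA : differentiable A z.
  rewrite (_ : A = fun x => (B ord0 ord0 * x.1 + B ord0 ord_max * x.2 + b.1,
     B ord_max ord0 * x.1 + B ord_max ord_max * x.2 + b.2)); last first.
    by apply/funext => x; rewrite /A /mulP; case: (b).
  have dl (k l e : R) : differentiable (fun x : plane R => k * x.1 + l * x.2 + e) z.
    apply: (@differentiableD _ _ _ (fun x : plane R => k * x.1 + l * x.2) (cst e)) => //.
    apply: (@differentiableD _ _ _ (fun x : plane R => k * x.1) (fun x => l * x.2)).
      exact: (@differentiableZ _ _ _ (fst : plane R -> R) k _ (differentiable_fst _)).
    exact: (@differentiableZ _ _ _ (snd : plane R -> R) l _ (differentiable_snd _)).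
  exact: differentiable_pair.
have dPhi : 'd (fun x => F x - (mulP B x + b)) z xi = dF z xi - mulP B xi.
  rewrite -deriveE; last exact: (@differentiableB _ _ _ F A).
  apply: derive_val; apply: (@is_deriveB _ _ _ F A).
    by rewrite -dFzE -deriveE//; apply: derivableP; exact: diff_derivable.
  apply: is_derive_affine => h; rewrite /A /mulP.
  case: (xi) (z) (b) => [x1 x2] [z1 z2] [b1 b2]; congr pair; rewrite /= /GRing.scale /=; ring.
rewrite dPhi => le.
have Bp : 0 < dotp (mulP B xi) (mulP B xi).
  rewrite lt_neqAle dotp_ge0 andbT eq_sym; apply: contra_neq Bxi; exact: dotp_eq0.
set r := mulP B xi in le Bp *.
(* By Cauchy-Schwarz the subtracted term is at most c |r|^2, which leaves at least (1 - c) |r|^2 >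
   0. *)
have -> : dotp r (dF z xi) = dotp r r - dotp r (r - dF z xi).
  by rewrite dotpB opprB addrC subrK.
have := dotp_le_enorm r (r - dF z xi); rewrite enormB => h1.
have h2 : enorm r * enorm (dF z xi - r) <= enorm r * (c * enorm r).
  by rewrite ler_wpM2l// enorm_ge0.
have h3 : enorm r * (c * enorm r) = c * dotp r r by rewrite -sqr_enorm expr2 mulrCA.
rewrite subr_gt0; apply: le_lt_trans h1 _; apply: le_lt_trans h2 _.
by rewrite h3 gtr_pMl.
Qed.

Lemma Khat_convex x y (t : R) : Khat T x -> Khat T y -> 0 <= t <= 1 ->
  Khat T (y + t *: (x - y)).
Proof.
move=> /(KhatP nd) Kx /(KhatP nd) Ky /andP[t0 t1]; apply/(KhatP nd) => q.
have -> : y + t *: (x - y) = (1 - t) *: y + t *: x.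
  by rewrite scalerBr scalerBl scale1r; rewrite addrA addrAC.
by rewrite lam_affine ?subrK// addr_ge0 ?mulr_ge0// subr_ge0.
Qed.

(** Along the segment from [y] to [x], inside the convex reference triangle, the component of [F] in
    the direction B(x - y) has positive derivative by coercivity, so the mean value theorem forbids
    equal end values. *)
Lemma Fmap_inj x y : Khat T x -> Khat T y -> F x = F y -> x = y.
Proof.
move=> Kx Ky Fxy; have [B [uB H]] := Fmap_coercive.
pose xi := x - y; pose r := mulP B xi.
have [r0|r0] := eqVneq r 0.
  apply/eqP; rewrite -subr_eq0 -/xi -[xi](mulP_Kinv xi uB) -/r r0.
  by rewrite /mulP /= !mulr0 addr0.
pose g t := dotp r (F (y + t *: xi)).
have dg (t : R) : t \in `[0, 1] -> is_derive t (1 : R) g (dotp r (dF (y + t *: xi) xi)).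
  by rewrite in_itv => t01; apply: dotF; exact: Khat_convex.
have dg1 (t : R) : t \in `]0, 1[ -> is_derive t (1 : R) g (dotp r (dF (y + t *: xi) xi)).
  by move=> t01; apply: dg; exact: subset_itv_oo_cc.
have cg : {within `[0, 1], continuous g}.
  by apply: derivable_within_continuous => t t01; case: (dg t t01).
have [c] := MVT ltr01 dg1 cg.
move=> c01; have -> : g 1 = g 0.
  by rewrite /g scale1r scale0r addr0 /xi (addrC y) subrK Fxy.
rewrite subrr subr0 mulr1 => E.
have Kc : Khat T (y + c *: xi).
  by apply: Khat_convex => //; move: c01; rewrite in_itv /= => /andP[? ?]; rewrite !ltW.
by have := H _ _ Kc r0; rewrite -/r -/xi -E ltxx.
Qed.

Lemma compact_Fmap (C : set (plane R)) : closed C -> C `<=` Khat T -> compact (F @` C).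
Proof.
move=> cC CK; apply: continuous_compact; last exact: compact_sublam nd _ cC CK.
by apply: continuous_in_subspaceT => x /set_mem/CK; exact: Fmap_continuous.
Qed.

(* The point of a small box around [x] minimizing the distance to [y] is
   interior, and coercivity makes the critical value vanish there. *)
Lemma Fmap_open x : (forall q, 0 < lam T q x) -> nbhs (F x) (elem i).
Proof.
move=> lx; have [e e0 eK] := nbhs_obox (nbhs_Khat nd lx).
have [B [uB H]] := Fmap_coercive.
set C := cbox _ in eK.
have Kx : Khat T x by apply: nbhs_singleton; exact: nbhs_Khat.
have cC : compact C by exact: compact_cbox.
(* The frame of the box. By injectivity its compact image misses [F x], hence stays farther than
   some [d] from it in one of the coordinates. *)
pose C' := C `&` [set z | ~ obox ((x.1 - e, x.1 + e), (x.2 - e, x.2 + e)) z].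
have clC : closed C by apply: compact_closed cC; exact: norm_hausdorff.
have clC' : closed C' by apply: closedI => //; apply: open_closedC; exact: open_obox.
have FC' : closed (F @` C').
  apply: compact_closed; first exact: norm_hausdorff.
  by apply: compact_Fmap => // z [/eK].
have nFx : ~ (F @` C') (F x).
  move=> [z [Cz zn] /Fmap_inj E]; apply: zn; rewrite E//; last exact: eK.
  by split; rewrite /= in_itv /=; lra.
have : nbhs (F x) (~` (F @` C')) by apply: open_nbhs_nbhs; split => //; exact: closed_openC.
move=> /nbhs_obox [d d0 dC].
have far z : C' z -> d < `|(F z).1 - (F x).1| \/ d < `|(F z).2 - (F x).2|.
  move=> Cz; apply: contrapT => /not_orP[/negP + /negP]; rewrite -!leNgt !ler_distl => h1 h2.
  have : cbox (((F x).1 - d, (F x).1 + d), ((F x).2 - d, (F x).2 + d)) (F z).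
    by split; rewrite /= in_itv.
  by move=> /dC; apply; exists z.
(* If [y] is within d/4 of [F x] in each coordinate, its squared distance to [F x] is at most d^2/8,
   but that to the image of the frame is at least (3d/4)^2. So the minimizer does not lie on the
   frame. *)
have N : nbhs (F x) (obox (((F x).1 - d / 4, (F x).1 + d / 4), ((F x).2 - d / 4, (F x).2 + d / 4))).
  apply: open_nbhs_nbhs; split; first exact: open_obox.
  by split; rewrite /= in_itv /=; lra.
apply: filterS N => y [/= y1 y2]; rewrite !in_itv /= in y1 y2.
pose g z m := Fm m z - coord m y.
pose dist z := g z ord0 ^+ 2 + g z ord_max ^+ 2.
have cg m : {within C, continuous (g ^~ m)}.
  apply: continuous_in_subspaceT => z /set_mem/eK Kz.
  apply: cvgB; last exact: cvg_cst.
  exact/differentiable_continuous/Fmap_differentiable.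
have cdist : {within C, continuous dist}.
  by move=> z; apply: cvgD; rewrite !expr2; apply: cvgM; exact: cg.
have C0 : C !=set0 by exists x; split; rewrite /= in_itv /=; lra.
have [z /set_mem Cz zmin] := compact_EVT_min C0 cC cdist.
have Kz := eK _ Cz.
have zC' : ~ C' z.
  move=> /far zfar; have := zmin x; rewrite mem_set; last by split; rewrite /= in_itv /=; lra.
  move=> /(_ isT); apply/negP; rewrite -ltNge /dist /g /Fm /coord /=.
  have sq (u k : R) : 0 <= k -> `|u| <= k -> u ^+ 2 <= k ^+ 2.
    by move=> k0 uk; rewrite -real_normK ?num_real// lerXn2r ?nnegrE.
  have qs (u k : R) : 0 <= k -> k <= `|u| -> k ^+ 2 <= u ^+ 2.
    by move=> k0 uk; rewrite -[u ^+ 2]real_normK ?num_real// lerXn2r ?nnegrE.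
  have h1 : ((F x).1 - y.1) ^+ 2 <= (d / 4) ^+ 2 by apply: sq; [lra|rewrite ler_norml; lra].
  have h2 : ((F x).2 - y.2) ^+ 2 <= (d / 4) ^+ 2 by apply: sq; [lra|rewrite ler_norml; lra].
  have dd : 0 < d ^+ 2 by rewrite exprn_gt0.
  case: zfar => h.
    have h3 : (3 / 4 * d) ^+ 2 <= ((F z).1 - y.1) ^+ 2.
      by apply: qs; [lra|rewrite real_ler_normr ?num_real//; move: h; rewrite real_lter_normr ?num_real// => /orP[h|h]; apply/orP; [left|right]; lra].
    have h4 := sqr_ge0 ((F z).2 - y.2).
    by move: h1 h2 h3; rewrite !exprMn; lra.
  have h3 : (3 / 4 * d) ^+ 2 <= ((F z).2 - y.2) ^+ 2.
    by apply: qs; [lra|rewrite real_ler_normr ?num_real//; move: h; rewrite real_lter_normr ?num_real// => /orP[h|h]; apply/orP; [left|right]; lra].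
  have h4 := sqr_ge0 ((F z).1 - y.1).
  by move: h1 h2 h3; rewrite !exprMn; lra.
have zo : obox ((x.1 - e, x.1 + e), (x.2 - e, x.2 + e)) z.
  by apply: contrapT => zn; apply: zC'; split.
(* If the residual [r] is nonzero, the direction [xi] with B xi = r gives the squared distance the
   derivative 2 r . DF xi > 0 at an interior minimum, a contradiction. *)
pose r := F z - y; pose xi := mulP (invmx B) r.
have Bxi : mulP B xi = r by exact: mulP_invK.
have [r0|r0] := eqVneq r 0.
  by exists z => //; apply/eqP; rewrite -subr_eq0; apply/eqP.
exfalso.
have cl : {for (0 : R), continuous (fun t : R => z + t *: xi)}.
  by apply: cvgD; [exact: cvg_cst|apply: cvgZl; exact: cvg_id].
have : nbhs (0 : R) [set t : R | obox ((x.1 - e, x.1 + e), (x.2 - e, x.2 + e)) (z + t *: xi)].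
  apply: cl; rewrite scale0r addr0; apply: open_nbhs_nbhs; split => //; exact: open_obox.
move=> /nbhs_ballP [k /= k0 kC].
have inC (t : R) : t \in `](- k), k[ -> C (z + t *: xi).
  rewrite in_itv /= => tk; apply: obox_cbox; apply: kC.
  by rewrite /ball /= sub0r normrN ltr_norml.
have dg m (t : R) : t \in `](- k), k[ ->
    is_derive t (1 : R) (fun t => g (z + t *: xi) m) ('d (Fm m) (z + t *: xi) xi - 0).
  move=> tk; have d1 := derive_along (Fmap_differentiable m (eK _ (inC t tk))).
  exact: (is_deriveB d1 (is_derive_cst (coord m y) t 1)).
have ddist (t : R) : t \in `](- k), k[ ->
    is_derive t (1 : R) (fun t : R => dist (z + t *: xi))
      (2 * (g (z + t *: xi) ord0 * 'd (Fm ord0) (z + t *: xi) xi +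
            g (z + t *: xi) ord_max * 'd (Fm ord_max) (z + t *: xi) xi)).
  move=> tk; have d0' := dg ord0 t tk; have d1' := dg ord_max t tk.
  apply: (is_derive_eq (is_deriveD (is_deriveM d0' d0') (is_deriveM d1' d1'))).
  by rewrite !subr0; exact: scale_twice.
have zk : (0 : R) \in `](- k), k[ by rewrite in_itv /=; lra.
have dist_min (t : R) : t \in `](- k), k[ -> dist (z + (0 : R) *: xi) <= dist (z + t *: xi).
  by move=> tk; rewrite scale0r addr0; apply: zmin; apply/mem_set; exact: inC.
have kk : - k <= k by lra.
have ddb (t : R) : t \in `](- k), k[ -> derivable (fun t : R => dist (z + t *: xi)) t 1.
  by move=> tk; case: (ddist t tk).
have [_ E0] := derive1_at_min kk ddb zk dist_min.
have [_ E1] := ddist 0 zk.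
have := H z xi Kz; rewrite Bxi => /(_ r0).
have -> : dotp r (dF z xi) = g z ord0 * 'd (Fm ord0) z xi + g z ord_max * 'd (Fm ord_max) z xi by [].
move: E1; rewrite E0 scale0r addr0.
by move: (_ + _) => u; lra.
Qed.

End ElementMap.

(** * Windows around a point of a curve *)

Section AlmostEverywhere.
Variable R : realType.
Local Notation mu := (@lebesgue_measure R).

(** Each of the given intervals contains one with rational end points around [s], so countably many
    intervals suffice. *)
Lemma ae_local (S : set R) (P : R -> Prop) :
  (forall s, S s -> exists a b, a < s < b /\ {ae mu, forall t, `]a, b[%classic t -> P t}) ->
  {ae mu, forall s, S s -> P s}.
Proof.
move=> SP.
pose I (n : nat) : set R := if @unpickle (rat * rat)%type n is Some q then
  (if `[<{ae mu, forall t, `]ratr q.1, ratr q.2[%classic t -> P t}>]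
   then `]ratr q.1, ratr q.2[%classic else set0) else set0.
have : {ae mu, forall s, (\bigcup_n I n) s -> P s}.
  apply: ae_bigcup_in => n; rewrite /I; case: (unpickle n) => [q|]; last by apply: aeW => ? [].
  by case: asboolP => // _; apply: aeW => ? [].
apply: ae_impl => s Is Ss; apply: Is; have [a [b [/andP[sa sb] ab]]] := SP s Ss.
have [q1] := rat_in_itvoo sa; have [q2] := rat_in_itvoo sb.
rewrite !in_itv /= => /andP[h1 h2] /andP[h3 h4].
exists (pickle (q1, q2)); first by [].
rewrite /I pickleK; case: asboolP => [_|[]].
  by rewrite /= in_itv /= h4.
apply: ae_impl ab => t abt tq; apply: abt; move: tq; rewrite /= !in_itv /= => /andP[t1 t2].
by rewrite (lt_trans h3 t1) (lt_trans t2 h2).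
Qed.

Lemma ae_countable (S : set R) (P : R -> Prop) : countable S ->
  {ae mu, forall s, ~ S s -> P s} -> {ae mu, forall s, P s}.
Proof.
move=> cS SP; have mS : measurable S by exact: countable_measurable.
have S0 : mu S = 0%E by exact: countable_lebesgue_measure0.
have : {ae mu, forall s, ~ S s}.
  by exists S; split => // s /= /contrapT.
by move=> /ae_conj - /(_ _ SP); apply: ae_impl => s [/[swap]]; apply.
Qed.

Lemma fundamental_line a b (f : R -> R) : L2 mu `]a, b[ f ->
  (forall psi, (forall n, nderivable n psi) -> compactly_supported_in `]a, b[ psi ->
    \int[mu]_(s in `]a, b[) (f s * psi s) = 0) ->
  {ae mu, forall s, `]a, b[%classic s -> f s = 0}.
Proof.
move=> Lf f0.
have mab : measurable (`]a, b[%classic : set (measurableTypeR R)) by exact: measurable_itv.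
have fin : (mu `]a, b[%classic < +oo)%E.
  by rewrite lebesgue_measure_itv; case: ifP => _; rewrite ltry.
apply: ae0_of_ocitv; first exact: L2_integrable.
move=> c e; apply: (@Rintegral_dct0 _ _ _ mu _ _ _ (fun k s => theta a b k s * ocstep c e k s)) => //.
- exact: L2_integrable.
- move=> k; apply: measurable_funTS; apply: continuous_measurable_fun.
  by apply: (@nderivable_continuous _ 0); apply: nderivableM; [exact: nderivable_theta|exact: nderivable_ocstep].
- by move=> k s _; apply: norm_mul_le1; [exact: norm_theta_le1|exact: norm_ocstep_le1].
- move=> s; rewrite /= in_itv /= => sab; rewrite -[X in _ --> X]mul1r.
  by apply: cvgM; [exact: theta_cvg|exact: ocstep_cvg].
- move=> k; apply: f0 => [n|]; first by apply: nderivableM; [exact: nderivable_theta|exact: nderivable_ocstep].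
  have [a1 [b1 [s1 z1]]] := theta_itv a b k; exists `[a1, b1]%classic; split => //.
    exact: segment_compact.
  by move=> s /negP s1'; rewrite z1 ?mul0r.
Qed.

(** A vertical line is a product with a null factor; any other line meets every vertical section in
    one point. *)
Lemma ae_not_line (n : plane R) (c : R) : n != 0 -> {ae leb2 R, forall x, dotp n x <> c}.
Proof.
move=> n0.
pose D : set (plane R) := [set x | dotp n x = c].
have mD : measurable (D : set (mplane R)).
  rewrite -[D]setCK; apply: measurableC; apply: open_measurable_plane.
  apply: closed_openC; apply: (@closed_comp _ _ (dotp n) [set t | t = c]); last exact: closed_eq.
  by move=> x _; apply: cvgD; apply: cvgMr; [exact: cvg_fst|exact: cvg_snd].
exists D; split => //; last by move=> x /= /contrapT.
have [n2|n2] := eqVneq n.2 0.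
  have n1 : n.1 != 0.
    by apply: contra_neq n0 => n1; rewrite (surjective_pairing n) n1 n2.
  have -> : D = [set c / n.1] `*` setT.
    apply/seteqP; split => x; rewrite /D /setX /dotp /= n2 mul0r addr0.
      by move=> <-; split => //; rewrite mulrC mulKf.
    by move=> [-> _]; rewrite mulrC divfK.
  have m1 : measurable ([set c / n.1] : set (measurableTypeR R)) by exact: measurable_set1.
  apply: (etrans (product_measure1E _ _ m1 measurableT)).
  transitivity (0 * mu setT)%E; last exact: mul0e.
  by congr (_ * _)%E; exact: lebesgue_measure_set1.
rewrite /product_measure1 /=; apply: integral0_eq => x _ /=.
rewrite (_ : xsection D x = [set (c - n.1 * x) / n.2]); first exact: lebesgue_measure_set1.
apply/seteqP; split => y; rewrite /xsection /D /dotp /= ?in_setE /=.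
  by move=> <-; rewrite addrAC subrr add0r mulrC mulKf.
by move=> ->; rewrite mulrCA divff// mulr1 addrC subrK.
Qed.

End AlmostEverywhere.

Section GraphWindow.
Variable R : realType.
Implicit Types (gam : R -> plane R) (m : 'I_2) (N : set (plane R)).

(** The part of [local_graph] that concerns the curve alone, inside a prescribed neighbourhood [N].
    The side of the domain is added by [window_local_graph], so that two domains can share one
    window. *)
Record graph_window gam m (s0 : R) N (tau a b lo hi : R) : Prop := GraphWindow {
  gw_s0 : a < s0 < b ;
  gw_tau : tau = 1 \/ tau = -1 ;
  gw_derivable : forall s, derivable (fun s => ocoord m (gam s)) s 1 ;
  gw_continuous' : continuous (derive1 (fun s => ocoord m (gam s))) ;
  gw_continuous : continuous (fun s => coord m (gam s)) ;
  gw_sign : forall s, a <= s <= b -> 0 < tau * derive1 (fun s => ocoord m (gam s)) s ;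
  gw_range : forall s, a <= s <= b -> lo < coord m (gam s) < hi ;
  gw_sub : gbox gam m a b lo hi `<=` N
}.

Lemma window_local_graph gam m s0 N tau a b lo hi U sg :
  graph_window gam m s0 N tau a b lo hi -> sg = 1 \/ sg = -1 ->
  (forall s z, a < s < b -> lo < z < hi ->
    (U (mkcoord m (ocoord m (gam s)) z) <-> 0 < sg * (coord m (gam s) - z))) ->
  local_graph U gam m sg tau a b lo hi.
Proof.
move=> gw sg1 H; split => //.
- by case/andP: (gw_s0 gw); exact: lt_trans.
- exact: gw_tau gw.
- exact: gw_derivable gw.
- exact: gw_continuous' gw.
- exact: gw_continuous gw.
- exact: gw_sign gw.
- by move=> s /andP[sa sb]; apply: (gw_range gw); rewrite !ltW.
Qed.

Lemma gbox_curve gam m s0 N tau a b lo hi s :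
  graph_window gam m s0 N tau a b lo hi -> a < s < b -> gbox gam m a b lo hi (gam s).
Proof.
move=> gw sab; split; first by exists s.
by apply: (gw_range gw); case/andP: sab => ? ?; rewrite !ltW.
Qed.

Lemma gbox_open gam m s0 N tau a b lo hi :
  graph_window gam m s0 N tau a b lo hi -> open (gbox gam m a b lo hi).
Proof.
move=> gw; pose p s := ocoord m (gam s).
have ab : a < b by case/andP: (gw_s0 gw); exact: lt_trans.
rewrite (_ : gbox _ _ _ _ _ _ =
  ((fun x => tau * ocoord m x) @^-1` `]tau * p a, tau * p b[) `&` (coord m @^-1` `]lo, hi[)).
  apply: openI; apply: open_comp => //=; last by move=> x _; exact: continuous_coord.
  by move=> x _; apply: cvgMr; exact: continuous_ocoord.
apply/seteqP; split => x; rewrite /gbox /setI /preimage /= !in_itv /=.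
  move=> [[s sab ps] ->]; split => //.
  by apply/(graph_image_oo ab (gw_tau gw) (gw_derivable gw) (gw_sign gw)); exists s.
move=> [/(graph_image_oo ab (gw_tau gw) (gw_derivable gw) (gw_sign gw))[s sab ps] ->].
by split => //; exists s.
Qed.

Lemma gbox_nbhs gam m s0 N tau a b lo hi :
  graph_window gam m s0 N tau a b lo hi -> nbhs (gam s0) (gbox gam m a b lo hi).
Proof.
move=> gw; apply: open_nbhs_nbhs; split; first exact: gbox_open gw.
exact: gbox_curve gw (gw_s0 gw).
Qed.

Lemma graph_window_exists gam m s0 N (e : R) :
  (forall s, derivable (fun s => ocoord m (gam s)) s 1) ->
  continuous (derive1 (fun s => ocoord m (gam s))) ->
  continuous (fun s => coord m (gam s)) ->
  derive1 (fun s => ocoord m (gam s)) s0 != 0 -> nbhs (gam s0) N -> 0 < e ->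
  exists tau a b lo hi, [/\ s0 - e < a, b < s0 + e & graph_window gam m s0 N tau a b lo hi].
Proof.
move=> dp cp' ch p'0 /nbhs_obox [r r0 rN] e0.
pose p s := ocoord m (gam s); pose h s := coord m (gam s).
have cp : continuous p.
  by move=> s; apply/differentiable_continuous/derivable1_diffP; exact: dp.
have [tau tau1 taup] : exists2 tau : R, tau = 1 \/ tau = -1 & 0 < tau * derive1 p s0.
  have [lt0|gt0|eq0] := ltgtP (derive1 p s0) 0.
  - by exists (-1); [right|rewrite mulN1r oppr_gt0].
  - by exists 1; [left|rewrite mul1r].
  - by move: p'0; rewrite -/p eq0 eqxx.
have near0 : \forall s \near s0, 0 < tau * derive1 p s.
  have c : {for s0, continuous (fun s => tau * derive1 p s)} by apply: cvgMr; exact: cp'.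
  exact: c _ (lt_nbhsr taup).
have nearp : \forall s \near s0, `|p s0 - p s| < r.
  by have /cvgrPdist_lt := @cp s0; exact.
have nearh : \forall s \near s0, `|h s0 - h s| < r / 2.
  by have /cvgrPdist_lt := @ch s0; apply; rewrite divr_gt0.
have : nbhs s0 [set s | [/\ 0 < tau * derive1 p s, `|p s0 - p s| < r & `|h s0 - h s| < r / 2]].
  by apply: filterS3 near0 nearp nearh => s *; split.
move=> /nbhs_ballP [k /= k0 kH].
(* Halving places the closed parameter interval inside the ball of radius [k] and its end points
   strictly within distance [e]. *)
pose k' := Num.min k e / 2.
have k'0 : 0 < k' by rewrite divr_gt0// lt_min k0.
have [k'k k'e] : k' < k /\ k' < e.
  have : Num.min k e <= k /\ Num.min k e <= e by rewrite !ge_min !lexx orbT.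
  by rewrite /k' => -[? ?]; lra.
have H s : s0 - k' <= s <= s0 + k' ->
    [/\ 0 < tau * derive1 p s, `|p s0 - p s| < r & `|h s0 - h s| < r / 2].
  by move=> sk; apply: kH; rewrite /ball /= ltr_distl; lra.
exists tau, (s0 - k'), (s0 + k'), (h s0 - r), (h s0 + r); split; [lra|lra|].
split => //.
- lra.
- by move=> s /H[].
- by move=> s /H[_ _]; rewrite ltr_distl -/(h s); lra.
- move=> x [[s sk xs] xh]; apply: rN.
  have [_ + _] : [/\ 0 < tau * derive1 p s, `|p s0 - p s| < r & `|h s0 - h s| < r / 2].
    by apply: H; case/andP: sk => ? ?; rewrite !ltW.
  rewrite ltr_distl => ps.
  have : `|ocoord m x - p s0| < r by rewrite xs ltr_distl -/(p s); lra.
  have : `|coord m x - h s0| < r by rewrite ltr_distl.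
  rewrite /p /h /ocoord /coord; case: (m == ord0); rewrite !ltr_distl => ? ?;
    by split; rewrite /= in_itv /=; lra.
Qed.

End GraphWindow.

(** * The boundary of the domain *)

Section Domain.
Variables (R : realType) (Omega : set (plane R)) (L : R) (chi : R -> plane R).
Hypothesis hOmega : C2_domain Omega L chi.
Implicit Types (x y : plane R) (m : 'I_2).

Let oOmega : open Omega. Proof. by case: hOmega => [[]]. Qed.

Lemma bdry_notin x : bdry Omega x -> ~ Omega x.
Proof. by move=> [_]; rewrite (interior_id _).1. Qed.

Lemma bdry_closure x : bdry Omega x -> closure Omega x.
Proof. by case. Qed.

(** In a small box the partial derivative of [rho] in some direction [m] keeps the sign [sg], and
    the mean value theorem makes [rho] strictly monotone along [m]. At boundary points [rho]
    vanishes: they are outside the open [Omega], so rho >= 0, and in its closure, so rho <= 0. *)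
Lemma boundary_chart x : bdry Omega x -> exists m sg (rho : plane R -> R) e,
  [/\ sg = 1 \/ sg = -1, 0 < e, differentiable rho x /\ 'D_(ebase R m) rho x != 0,
    forall y, cbox ((x.1 - e, x.1 + e), (x.2 - e, x.2 + e)) y ->
      [/\ Omega y <-> rho y < 0, bdry Omega y -> rho y = 0 & 0 < rho y -> ~ closure Omega y] &
    forall p z1 z2, cbox ((x.1 - e, x.1 + e), (x.2 - e, x.2 + e)) (mkcoord m p z1) ->
      cbox ((x.1 - e, x.1 + e), (x.2 - e, x.2 + e)) (mkcoord m p z2) -> z1 < z2 ->
      0 < sg * (rho (mkcoord m p z2) - rho (mkcoord m p z1))].
Proof.
move=> bx; have [_ /(_ x bx)[rho [V [oV Vx Crho [m Dm] VE]]] _] := hOmega.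
have [drho Drho] := Crho.
have [sg sg1 sgD] : exists2 sg : R, sg = 1 \/ sg = -1 & 0 < sg * 'D_(ebase R m) rho x.
  have [lt0|gt0|eq0] := ltgtP ('D_(ebase R m) rho x) 0.
  - by exists (-1); [right|rewrite mulN1r oppr_gt0].
  - by exists 1; [left|rewrite mul1r].
  - by move: Dm; rewrite eq0 eqxx.
have cD : {for x, continuous (fun y => sg * 'D_(ebase R m) rho y)}.
  have cD' : {for x, continuous (fun y => 'D_(ebase R m) rho y)}.
    by apply: differentiable_continuous; have [dD _] := Drho m; exact: dD.
  by apply: cvgMr; exact: cD'.
have nV : nbhs x V by exact: open_nbhs_nbhs.
have [e e0 eV] := nbhs_obox (filterI nV (cD _ (lt_nbhsr sgD))).
set N := cbox _ in eV.
have crho y : V y -> {for y, continuous rho}.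
  by move=> Vy; exact/differentiable_continuous/drho.
have rho_ge0 y : V y -> ~ Omega y -> 0 <= rho y.
  by move=> Vy nO; rewrite leNgt; apply/negP => /(VE y Vy).2.
have rho_gt0 y : V y -> 0 < rho y -> ~ closure Omega y.
  move=> Vy rho0 cl.
  have := cl _ (filterI (open_nbhs_nbhs (conj oV Vy)) (crho y Vy _ (lt_nbhsr rho0))).
  move=> [z [Oz [Vz]]]; rewrite /= => r0.
  by have := (VE z Vz).1 Oz; rewrite ltNge (ltW r0).
exists m, sg, rho, e; split => //.
- by split => //; exact: drho.
- move=> y Ny; have [Vy _] := eV _ Ny; split; [exact: VE| |exact: rho_gt0].
  move=> by_; apply/eqP; rewrite eq_le rho_ge0 ?andbT//; last exact: bdry_notin.
  by rewrite leNgt; apply/negP => /(rho_gt0 y Vy); apply; exact: bdry_closure.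
- move=> p z1 z2 N1 N2 z12.
  have conv z : z1 <= z <= z2 -> N (mkcoord m p z).
    move: N1 N2; rewrite /N /cbox /setX /mkcoord /=; case: (m == ord0); rewrite /= !in_itv /=;
    by move=> [? ?] [? ?] ?; split; lra.
  have dr z : z \in `[z1, z2] -> is_derive z (1 : R) (fun t => rho (mkcoord m p t)) ('D_(ebase R m) rho (mkcoord m p z)).
    rewrite in_itv /= => zz; apply/is_derive_line; apply: derivableP; apply: diff_derivable.
    by apply: drho; have [] := eV _ (conv z zz).
  have dr1 z : z \in `]z1, z2[ -> is_derive z (1 : R) (fun t => rho (mkcoord m p t)) ('D_(ebase R m) rho (mkcoord m p z)).
    by move=> zz; apply: dr; exact: subset_itv_oo_cc.
  have cr : {within `[z1, z2], continuous (fun t => rho (mkcoord m p t))}.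
    by apply: derivable_within_continuous => t /dr [].
  have [c c12 ->] := MVT z12 dr1 cr.
  rewrite mulrA mulr_gt0 ?subr_gt0//.
  have : N (mkcoord m p c) by apply: conv; move: c12; rewrite in_itv /= => /andP[? ?]; rewrite !ltW.
  by move=> /eV[].
Qed.

(** A C^2 domain lies on one side of its boundary: from a boundary point, a small step [sg * k]
    along [m] leads to rho > 0, hence out of the closure. This places the interiors of the elements
    inside [Omega]. *)
Lemma interior_closure_Omega x : nbhs x (closure Omega) -> Omega x.
Proof.
move=> nx; apply: contrapT => nO.
have bx : bdry Omega x.
  by split; [exact: nbhs_singleton|rewrite (interior_id _).1].
have [m [sg [rho [e [sg1 e0 _ H1 H2]]]]] := boundary_chart bx.
have [r r0 rc] := nbhs_obox nx.
pose k := Num.min e r.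
have [ke kr] : k <= e /\ k <= r by rewrite /k !ge_min !lexx orbT.
have k0 : 0 < k by rewrite lt_min e0.
have inb (t u : R) : `|t| <= k -> k <= u ->
    cbox ((x.1 - u, x.1 + u), (x.2 - u, x.2 + u)) (mkcoord m (ocoord m x) (coord m x + t)).
  rewrite ler_norml => tk ku; rewrite /mkcoord /ocoord /coord /cbox /setX /=.
  by case: (m == ord0); rewrite /= !in_itv /=; split; lra.
have nk : `|sg * k| <= k by case: sg1 => ->; rewrite normrM ?normrN normr1 mul1r gtr0_norm.
have n0 : `|0 : R| <= k by rewrite normr0 ltW.
have E0 : mkcoord m (ocoord m x) (coord m x + 0) = x by rewrite addr0 mkcoordK.
have bx0 : cbox ((x.1 - e, x.1 + e), (x.2 - e, x.2 + e)) x by have := inb _ _ n0 ke; rewrite E0.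
have [_ rx _] := H1 x bx0.
have [_ _] := H1 _ (inb _ _ nk ke); apply; last by apply: rc; exact: inb.
have := inb _ _ nk ke; have := inb _ _ n0 ke; rewrite E0 => b0 bk.
case: sg1 bk => sgE; rewrite sgE ?mul1r ?mulN1r => bk.
  have := H2 (ocoord m x) (coord m x) (coord m x + k); rewrite mkcoordK => /(_ b0 bk).
  by rewrite ltrDl sgE mul1r (rx bx) subr0; exact.
have := H2 (ocoord m x) (coord m x - k) (coord m x); rewrite mkcoordK => /(_ bk b0).
by rewrite gtrDl oppr_lt0 sgE mulN1r (rx bx) sub0r opprK; exact.
Qed.

Lemma interior_sub_Omega (V : set (plane R)) : V `<=` closure Omega -> V° `<=` Omega.
Proof. by move=> VO x Vx; apply: interior_closure_Omega; apply: filterS Vx. Qed.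

Lemma chi_derivable m s : derivable (fun s => coord m (chi s)) s 1.
Proof. by have [_ _ [_ C2 _ _ _]] := hOmega; have [D _] := C2 m; exact: (D 0%N). Qed.

Lemma chi_continuous' m : continuous (derive1 (fun s => coord m (chi s))).
Proof. by have [_ _ [_ C2 _ _ _]] := hOmega; have [_ D] := C2 m; exact: (D 1%N). Qed.

Lemma chi_coord_continuous m : continuous (fun s => coord m (chi s)).
Proof. by move=> s; apply/differentiable_continuous/derivable1_diffP; exact: chi_derivable. Qed.

Lemma chiE : chi = fun s => (coord ord0 (chi s), coord ord_max (chi s)).
Proof. by apply/funext => t; rewrite /coord /=; case: (chi t). Qed.

Lemma chi_continuous : continuous chi.
Proof.
rewrite chiE => s; exact: (cvg_pair (@chi_coord_continuous ord0 s) (@chi_coord_continuous ord_max s)).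
Qed.

Lemma derive1_chi s : derive1 chi s =
  (derive1 (fun s => coord ord0 (chi s)) s, derive1 (fun s => coord ord_max (chi s)) s).
Proof.
have d0 := @chi_derivable ord0 s; have d1 := @chi_derivable ord_max s.
rewrite !derive1E; apply: cvg_lim => //.
rewrite (_ : (fun h : R => _) = (fun h : R =>
   (h^-1 *: (coord ord0 (chi (h *: 1 + s)) - coord ord0 (chi s)),
    h^-1 *: (coord ord_max (chi (h *: 1 + s)) - coord ord_max (chi s))))).
  exact: (cvg_pair d0 d1).
by apply/funext => h; rewrite /coord.
Qed.

Lemma chi_bdry s : bdry Omega (chi s).
Proof. by have [_ _ [_ _ _ _ [_ <-]]] := hOmega; exists s. Qed.

Lemma chi_speed s : derive1 (fun s => coord ord0 (chi s)) s ^+ 2 +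
  derive1 (fun s => coord ord_max (chi s)) s ^+ 2 = 1.
Proof.
have [_ _ [_ _ /(_ s) en _ _]] := hOmega.
have := sqr_enorm (derive1 chi s); rewrite en expr1n derive1_chi /dotp /= => ->.
by rewrite !expr2.
Qed.

(** The direction [m] of the chart also makes [chi] a graph, the other coordinate being a local
    parameter. The side of [Omega] then follows by comparing [rho] with its value [0] on the
    curve. *)
Lemma boundary_window s0 N e : nbhs (chi s0) N -> 0 < e -> exists m sg tau a b lo hi,
  [/\ sg = 1 \/ sg = -1, s0 - e < a, b < s0 + e,
    graph_window chi m s0 N tau a b lo hi &
    forall s z, a < s < b -> lo < z < hi ->
      [/\ Omega (mkcoord m (ocoord m (chi s)) z) <-> 0 < sg * (coord m (chi s) - z) &
          bdry Omega (mkcoord m (ocoord m (chi s)) z) -> z = coord m (chi s)]].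
Proof.
move=> nN e0; have [m [sg [rho [r [sg1 r0 [drho Drho] H1 H2]]]]] := boundary_chart (chi_bdry s0).
set M := cbox _ in H1 H2.
have nM : nbhs (chi s0) M.
  apply: filterS (@obox_cbox R _) _; apply: open_nbhs_nbhs; split; first exact: open_obox.
  by split; rewrite /= in_itv /=; lra.
have dp s : derivable (fun s => ocoord m (chi s)) s 1.
  rewrite /ocoord; case: (m == ord0); first exact: (@chi_derivable ord_max s).
  exact: (@chi_derivable ord0 s).
have cp' : continuous (derive1 (fun s => ocoord m (chi s))).
  rewrite /ocoord; case: (m == ord0); first exact: (@chi_continuous' ord_max).
  exact: (@chi_continuous' ord0).
have ch := @chi_coord_continuous m.
(* Otherwise the velocity of [chi] is a multiple of the basis vector of [m]. Differentiating
   rho(chi) = 0 and using that this partial derivative of [rho] is nonzero gives zero velocity,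
   against the unit speed. *)
have p'0 : derive1 (fun s => ocoord m (chi s)) s0 != 0.
  apply/negP => /eqP p0.
  have dchi : differentiable chi s0.
    by rewrite chiE; apply: differentiable_pair; apply/derivable1_diffP; exact: chi_derivable.
  have : 'D_1 (rho \o chi) s0 = 0.
    rewrite -[RHS](derive_cst (0 : R) s0 1); apply: near_eq_derive.
    have nc : \forall s \near s0, M (chi s) by exact: (@chi_continuous s0 _ nM).
    near=> s; have Ms : M (chi s) by near: s.
    rewrite /=.
    by have [_ + _] := H1 _ Ms; apply; exact: chi_bdry.
  rewrite deriveE; last exact: differentiable_comp.
  rewrite diff_comp//= -[X in 'd rho _ X]deriveE//.
  have sE (x p q : R) : x *: ((p, q) : plane R) = (x * p, x * q) by [].
  have -> : 'D_1 chi s0 = derive1 (fun s => coord m (chi s)) s0 *: ebase R m.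
    rewrite -derive1E derive1_chi; have [mE|mE] := ord2P m; move: p0; rewrite mE /ocoord /= => p0.
      by rewrite /ebase eqxx sE mulr1 mulr0; congr (_, _); exact: p0.
    by rewrite /ebase (_ : (_ == _) = false) // sE mulr1 mulr0; congr (_, _); exact: p0.
  rewrite linearZ /= -deriveE// => /eqP; rewrite mulf_eq0 (negbTE Drho) orbF => /eqP h0.
  by have := chi_speed s0; have [mE|mE] := ord2P m; move: p0 h0; rewrite mE /ocoord /= => -> ->;
    rewrite expr0n addr0 => /eqP; rewrite eq_sym oner_eq0.
have [tau [a [b [lo [hi [sa sb gw]]]]]] := graph_window_exists dp cp' ch p'0 (filterI nN nM) e0.
exists m, sg, tau, a, b, lo, hi; split => //.
  by case: gw => ? ? ? ? ? ? ? sub; split => // x /sub[].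
move=> s z sab zlh.
have gM t : gbox chi m a b lo hi t -> M t by move=> /(gw_sub gw)[].
have Ms : M (chi s) by apply: gM; exact: gbox_curve gw sab.
have Mz : M (mkcoord m (ocoord m (chi s)) z).
  by apply: gM; split; [exists s => //; rewrite ocoord_mkcoord|rewrite coord_mkcoord].
have [_ /(_ (chi_bdry s)) rs _] := H1 _ Ms; have [OE rz _] := H1 _ Mz.
have lt1 : z < coord m (chi s) -> 0 < sg * (- rho (mkcoord m (ocoord m (chi s)) z)).
  by move=> zc; have := H2 (ocoord m (chi s)) z (coord m (chi s)); rewrite mkcoordK rs sub0r; exact.
have lt2 : coord m (chi s) < z -> 0 < sg * rho (mkcoord m (ocoord m (chi s)) z).
  by move=> zc; have := H2 (ocoord m (chi s)) (coord m (chi s)) z; rewrite mkcoordK rs subr0; exact.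
have [zc|zc|zc] := ltgtP z (coord m (chi s)).
- have := lt1 zc; move: OE rz; move: (rho _) => u OE rz h; split; last first.
    by move=> /rz u0; move: h; rewrite u0 oppr0 mulr0 ltxx.
  by rewrite OE; case: sg1 h => ->; rewrite ?mul1r ?mulN1r => h; split=> ?; lra.
- have := lt2 zc; move: OE rz; move: (rho _) => u OE rz h; split; last first.
    by move=> /rz u0; move: h; rewrite u0 mulr0 ltxx.
  by rewrite OE; case: sg1 h => ->; rewrite ?mul1r ?mulN1r => h; split=> ?; lra.
- by split => //; rewrite zc mkcoordK subrr mulr0 ltxx; split => // /(bdry_notin (chi_bdry s)).
Unshelve. all: by end_near.
Qed.

End Domain.

(** * Connectedness of one side of a graph *)

Section GraphConnected.
Variable R : realType.
Implicit Types (U W : set (plane R)) (gam : R -> plane R) (m : 'I_2).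

Lemma path_connected W : (forall x y, W x -> W y -> exists g : R -> plane R,
    [/\ continuous g, g 0 = x, g 1 = y & forall r, 0 <= r <= 1 -> W (g r)]) ->
  connected W.
Proof.
move=> H; have [[x Wx]|/set0P/negP/negPn/eqP ->] := pselect (W !=set0); last exact: connected0.
suff -> : W = connected_component W x by exact: component_connected.
apply/seteqP; split => y; last exact: connected_component_sub.
move=> Wy; have [g [cg g0 g1 gW]] := H x y Wx Wy.
exists (g @` `[0, 1]); last by exists 1 => //; rewrite /= in_itv /=; lra.
split.
- by exists 0 => //; rewrite /= in_itv /=; lra.
- by move=> _ [r + <-]; rewrite /= in_itv /=; exact: gW.
- apply: connected_continuous_connected; first exact: segment_connected.
  exact: continuous_subspaceT.
Qed.

(** The points are described by a curve parameter and a fraction [th] in ]0, 1[ of the way from one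
    wall of the box to the curve. Interpolating both linearly gives a path that stays inside. *)
Lemma local_graph_connected U gam m sg tau a b lo hi :
  local_graph U gam m sg tau a b lo hi -> connected (U `&` gbox gam m a b lo hi).
Proof.
move=> lg; apply: path_connected => x y [Ux [[s sab xs] xz]] [Uy [[t tab yt] yz]].
pose h s := coord m (gam s).
have xE : mkcoord m (ocoord m (gam s)) (coord m x) = x by rewrite -xs mkcoordK.
have yE : mkcoord m (ocoord m (gam t)) (coord m y) = y by rewrite -yt mkcoordK.
have := (lg_side lg sab xz).1; rewrite xE => /(_ Ux) hx.
have := (lg_side lg tab yz).1; rewrite yE => /(_ Uy) hy.
(* The wall on the side of [U]: for [sg = 1] the domain lies below the curve, so it is [lo]. *)
pose E := if sg == 1 then lo else hi.
have cE s0 z : a < s0 < b -> lo < z < hi -> 0 < sg * (h s0 - z) ->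
    exists2 th, 0 < th < 1 & z = E + th * (h s0 - E).
  move=> /(lg_range lg); rewrite -/(h s0) => hs zz H; have hE : h s0 - E != 0.
    rewrite /E subr_eq0; apply/eqP.
    by case: ifPn => _ hE; move: hs; rewrite hE ltxx ?andbF.
  exists ((z - E) / (h s0 - E)); last by rewrite divfK// addrC subrK.
  move: hE H; rewrite /E; case: (lg_sg lg) => ->.
    rewrite eqxx mul1r => _ H; rewrite divr_gt0 ?ltr_pdivrMr//=; lra.
  rewrite ifF; last by apply/eqP; lra.
  rewrite mulN1r => _ H; rewrite -[z - hi]opprB -[h s0 - hi]opprB invrN mulrNN.
  by rewrite divr_gt0 ?ltr_pdivrMr//=; lra.
have [th1 th1b x2] := cE _ _ sab xz hx; have [th2 th2b y2] := cE _ _ tab yz hy.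
pose S r := (1 - r) * s + r * t; pose Th r := (1 - r) * th1 + r * th2.
have cl (u w : R) : continuous (fun r : R => (1 - r) * u + r * w).
  move=> r; apply: cvgD; apply: cvgMl; last exact: cvg_id.
  by apply: cvgB; [exact: cvg_cst|exact: cvg_id].
have bl (u w p q r : R) : p < u < q -> p < w < q -> 0 <= r <= 1 -> p < (1 - r) * u + r * w < q.
  move=> /andP[u1 u2] /andP[w1 w2] /andP[r0 r1].
  have [r00|r00] := eqVneq r 0; first by rewrite r00; lra.
  have rp : 0 < r by rewrite lt_neqAle eq_sym r00.
  by apply/andP; split; nra.
exists (fun r => mkcoord m (ocoord m (gam (S r))) (E + Th r * (h (S r) - E))); split.
- move=> r; have cS : S u @[u --> r] --> S r by exact: cl.
  have cp : continuous (fun s => ocoord m (gam s)).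
    by move=> v; apply/differentiable_continuous/derivable1_diffP; exact: (lg_derivable lg).
  apply: continuous_mkcoord; first exact: (cvg_comp _ _ cS (cp (S r))).
  apply: cvgD; first exact: cvg_cst.
  have ch : {for r, continuous (h \o S)} by apply: continuous_comp; [exact: cS|exact: lg_continuous lg _].
  apply: cvgM; first exact: cl.
  by apply: (cvgB ch); exact: cvg_cst.
- by rewrite /S /Th subr0 !mul1r !mul0r !addr0 -x2 xE.
- by rewrite /S /Th subrr !mul1r !mul0r !add0r -y2 yE.
- move=> r r01; have Sab := bl _ _ _ _ _ sab tab r01; have Tb := bl _ _ _ _ _ th1b th2b r01.
  rewrite -/(S r) in Sab; rewrite -/(Th r) in Tb.
  have hS := lg_range lg Sab; rewrite -/(h (S r)) in hS.
  have zz : lo < E + Th r * (h (S r) - E) < hi /\ 0 < sg * (h (S r) - (E + Th r * (h (S r) - E))).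
    move: Tb hS; rewrite /E; case: (lg_sg lg) => ->.
      by rewrite eqxx => /andP[? ?] /andP[? ?]; split; [apply/andP; split|]; nra.
    rewrite ifF; last by apply/eqP; lra.
    by move=> /andP[? ?] /andP[? ?]; split; [apply/andP; split|]; nra.
  split; first by apply/(lg_side lg Sab); [exact: zz.1|exact: zz.2].
  by split; [exists (S r) => //; rewrite ocoord_mkcoord|rewrite coord_mkcoord; exact: zz.1].
Qed.

End GraphConnected.

(** * An element and the domain near a boundary edge *)

Section BoundaryEdge.
Variables (R : realType) (Omega : set (plane R)) (L : R) (chi : R -> plane R).
Hypothesis hOmega : C2_domain Omega L chi.
Variable T : mesh R.
Hypothesis hT : exact_conforming T Omega.
Implicit Types (x y : plane R) (m : 'I_2) (i : 'I_(nel T)) (p q : 'I_3).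

Lemma mesh_nondegenerate : nondegenerate T. Proof. by case: hT => [[]]. Qed.

Lemma mesh_curved i : curved_triangle i. Proof. by case: hT => [[_ +]]. Qed.

Let nd := mesh_nondegenerate.

Lemma elem_closed i : closed (elem i).
Proof.
apply: compact_closed; first exact: norm_hausdorff.
by apply: (compact_Fmap nd (mesh_curved i)); [exact: closed_Khat|].
Qed.

Lemma elem_closure i : elem i `<=` closure Omega.
Proof. by case: hT => _ [<- _] _ _ _ x ix; exists i. Qed.

Lemma elem_interior_sub i : (elem i)° `<=` Omega.
Proof. by apply: (interior_sub_Omega hOmega); exact: elem_closure. Qed.

Lemma Fmap_open_interior i x : (forall q, 0 < lam T q x) -> (elem i)° (Fmap i x).
Proof. exact: (Fmap_open nd (mesh_curved i)). Qed.

Lemma closed_edge i p : closed (edge (i, p)).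
Proof.
apply: compact_closed; first exact: norm_hausdorff.
rewrite (_ : edge _ = Fmap i @` (refedge T p @` `[0, 1])); last first.
  apply/seteqP; split=> [_ [t t01 <-]|_ [_ [t t01 <-] <-]]; last by exists t.
  by exists (refedge T p t) => //; exists t.
apply: (compact_Fmap nd (mesh_curved i)); last first.
  by move=> _ [t t01 <-]; apply: Khat_refedge => //; rewrite -in_itv.
apply: compact_closed; first exact: norm_hausdorff.
apply: continuous_compact; last exact: segment_compact.
by apply: continuous_subspaceT; exact: continuous_refedge.
Qed.

Lemma measurable_bdry_params i p : measurable (bdry_params L chi (i, p) : set (measurableTypeR R)).
Proof.
apply: measurableI; first exact: measurable_itv.
apply: closed_measurable; apply: closed_comp; last exact: closed_edge.
by move=> x _; exact: (chi_continuous hOmega).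
Qed.

Variables (i : 'I_(nel T)) (p : 'I_3).
Hypothesis be : edge (i, p) `<=` bdry Omega.
Local Notation F := (@Fmap R T i).

Lemma boundary_edge_window s0 t0 e : 0 < t0 < 1 -> chi s0 = F (refedge T p t0) -> 0 < e ->
  exists m sg tau a b lo hi, [/\ a < s0 < b /\ (s0 - e < a /\ b < s0 + e),
    local_graph Omega chi m sg tau a b lo hi,
    local_graph (elem i)° chi m sg tau a b lo hi,
    open (gbox chi m a b lo hi) /\ Omega `&` gbox chi m a b lo hi `<=` (elem i)° &
    forall s, a < s < b -> edge (i, p) (chi s)].
Proof.
move=> t01 chis0 e0; have [n1 n2 n3] := third_neq p.
have ct := mesh_curved i; have [t0gt t0lt] := andP t01.
pose x0 := refedge T p t0.
have Kx0 : Khat T x0 by apply: Khat_refedge => //; rewrite !ltW.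
(* The other two edges. Their image is closed and, by injectivity, misses [chi s0]; a window that
   avoids it contains only points of the given edge and images of points interior to the reference
   triangle. *)
pose C := Khat T `&` ([set x | lam T p x = 0] `|` [set x | lam T (ordS p) x = 0]).
have cC : closed C.
  by apply: closedI; [exact: closed_Khat|apply: closedU; exact: closed_lam0].
have nN : nbhs (chi s0) (~` (F @` C)).
  apply: open_nbhs_nbhs; split.
    apply: closed_openC; apply: compact_closed; first exact: norm_hausdorff.
    by apply: (compact_Fmap nd ct) => // x [].
  move=> [x [Kx lx]]; rewrite chis0 => /(Fmap_inj nd ct Kx Kx0) xE.
  case: lx; rewrite xE /= lam_refedge //.
    by rewrite eqxx => ?; lra.
  by rewrite (negbTE n3) eqxx => ?; lra.
have [m [sg [tau [a [b [lo [hi [sg1 sa sb gw H]]]]]]]] := boundary_window hOmega nN e0.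
have lgO : local_graph Omega chi m sg tau a b lo hi.
  by apply: window_local_graph gw sg1 _ => s z sab zz; have [] := H s z sab zz.
set Q := gbox chi m a b lo hi.
have elemE x : Khat T x -> Q (F x) -> (exists2 t, 0 <= t <= 1 & x = refedge T p t) \/
    (forall q, 0 < lam T q x).
  move=> Kx Qx; have l0 := (KhatP nd x).1 Kx.
  have [l3|l3] := eqVneq (lam T (third p) x) 0.
    left; exists (lam T (ordS p) x); last exact: refedgeE.
    by rewrite l0 lam_le1.
  right=> q; rewrite lt_neqAle l0 andbT eq_sym; apply/eqP => lq.
  have := gw_sub gw Qx; apply; exists x => //; split => //.
  have [qE|qE|qE] := ord3_cases p q; move: lq; rewrite qE => lq.
  - by left.
  - by right.
  - by move: l3; rewrite lq eqxx.
have OQ x : Omega x -> Q x -> elem i x -> (elem i)° x.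
  move=> Ox Qx [y Ky yx]; move: Ox Qx; rewrite -yx => Ox Qx.
  have [[t t1 yE]|lq] := elemE y Ky Qx; last exact: Fmap_open_interior.
  by exfalso; apply: (bdry_notin hOmega _ Ox); apply: be; exists t; rewrite /= ?in_itv//= yE.
have Qs0 : nbhs (chi s0) Q by exact: gbox_nbhs gw.
(* The connectedness argument needs a starting point: from [x0] a short step towards the centroid
   makes all barycentric coordinates positive. *)
have [y [Oy Qy iy]] : exists y, [/\ Omega y, Q y & (elem i)° y].
  pose cen := \sum_(q < 3) 3^-1 *: refv T q.
  pose g (r : R) := x0 + r *: (cen - x0).
  have cF : {for 0, continuous (F \o g)}.
    apply: continuous_comp; last first.
      by rewrite /g scale0r addr0; exact: Fmap_continuous.
    apply: cvgD; first exact: cvg_cst.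
    by apply: cvgZl; exact: cvg_id.
  have : \forall r \near (0 : R), Q (F (g r)).
    by apply: cF; rewrite /= /g scale0r addr0 -chis0.
  move=> /nbhs_ballP[d /= d0 dQ].
  pose r := Num.min (d / 2) 1.
  have [r0 rd r1] : [/\ 0 < r, r < d & r <= 1].
    have : r <= d / 2 /\ r <= 1 by rewrite /r !ge_min !lexx orbT.
    have : 0 < r by rewrite /r lt_min; apply/andP; split; lra.
    by move=> ? [? ?]; split; lra.
  have Qr : Q (F (g r)) by apply: dQ; rewrite /ball /= sub0r normrN gtr0_norm.
  have lr q : 0 < lam T q (g r).
    have -> : g r = (1 - r) *: x0 + r *: cen.
      by rewrite /g scalerBr scalerBl scale1r addrCA addrC.
    rewrite (lam_affine nd) ?subrK// (lam_comb nd); last by rewrite sum_ord3; field.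
    have r3 : 0 < r / 3 by rewrite divr_gt0.
    by rewrite ltr_wpDl// mulr_ge0 ?subr_ge0//; exact: (KhatP nd x0).1.
  have ir := @Fmap_open_interior i _ lr.
  by exists (F (g r)); split => //; exact: elem_interior_sub ir.
have cW := local_graph_connected lgO.
(* Within the connected set, the trace of the interior of the element is open, and it coincides by
   [OQ] with the trace of the closed element. *)
have WE : Omega `&` Q `&` (elem i)° = Omega `&` Q.
  apply: cW; first by exists y.
    by exists (elem i)°; first exact: open_interior.
  exists (elem i); first exact: elem_closed.
  by apply/seteqP; split => x [[Ox Qx] ix]; split => //; [exact: interior_subset|exact: OQ].
have WS : Omega `&` Q `<=` (elem i)° by rewrite -WE => x [].
have Qm s z : a < s < b -> lo < z < hi -> Q (mkcoord m (ocoord m (chi s)) z).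
  by move=> sab zz; split; [exists s => //; rewrite ocoord_mkcoord|rewrite coord_mkcoord].
exists m, sg, tau, a, b, lo, hi; split => //.
- by split; [exact: gw_s0 gw|].
- apply: window_local_graph gw sg1 _ => s z sab zz; rewrite -(lg_side lgO sab zz).
  split; first exact: elem_interior_sub.
  by move=> Om; apply: WS; split => //; exact: Qm.
- by split; first exact: gbox_open gw.
- move=> s sab.
  (* A boundary point of [Omega] in the window is a limit of points of [Omega] in it, all in the
     element, which is closed. It is not an interior image, so it lies on the edge. *)
  have ichi : elem i (chi s).
    apply: elem_closed => N nN'.
    have nQ : nbhs (chi s) Q by exact: open_nbhs_nbhs (conj (gbox_open gw) (gbox_curve gw sab)).
    have [z [Oz [Nz Qz]]] := bdry_closure (chi_bdry hOmega s) (filterI nN' nQ).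
    by exists z; split => //; apply: interior_subset; exact: WS.
  case: ichi => x Kx xs.
  have Qx : Q (F x) by rewrite xs; exact: gbox_curve gw sab.
  have [[t t1 xE]|lx] := elemE x Kx Qx.
  + by exists t; rewrite /= ?in_itv//= -xE.
  + have := @Fmap_open_interior i _ lx; rewrite xs => /elem_interior_sub.
    by move/(bdry_notin hOmega (chi_bdry hOmega s)).
Qed.

End BoundaryEdge.

(** * Traces along a boundary edge *)

Section TraceLocality.
Variable R : realType.
Local Notation mu := (@lebesgue_measure R).
Implicit Types (U V Q : set (plane R)) (gam : R -> plane R) (m : 'I_2) (J : set R).

Lemma is_trace_sub U gam J J' w g : continuous gam ->
  measurable (J : set (measurableTypeR R)) -> measurable (J' : set (measurableTypeR R)) ->
  J' `<=` J -> is_trace U gam J w g -> is_trace U gam J' w g.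
Proof.
move=> cgam mJ mJ' J'J [Hw Lg [phi [sphi c0 c1 c2]]]; split => //.
  exact: L2_sub Lg.
exists phi; split => //.
apply: (@squeeze_cvge _ _ _ _ (cst 0%E)); [|exact: cvg_cst|exact: c2].
apply: nearW => n; apply/andP; split.
  by apply: integral_ge0 => s _; rewrite lee_fin sqr_ge0.
apply: ge0_subset_integral => //; last by move=> s _; rewrite lee_fin sqr_ge0.
apply/measurable_EFinP; apply: measurable_funX; apply: measurable_funB; last exact: Lg.1.
apply: measurable_funTS; apply: continuous_measurable_fun => s.
by apply: continuous_comp; [exact: cgam|exact: smooth_continuous].
Qed.

Lemma green_form_ext m U V w w' eta : open U -> open V -> V `<=` U -> H1 U w ->
  measurable_fun (V : set (mplane R)) w' ->
  {ae leb2 R, forall x, V x -> w x = w' x} -> smooth eta ->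
  green_form m V w' eta =
  \int[leb2 R]_(x in V) (w x * 'D_(ebase R m) eta x + wpart U m w x * eta x).
Proof.
move=> oU oV VU Hw mw' ww' se; have mV := open_measurable_plane oV.
have mU := open_measurable_plane oU.
have mw : measurable_fun (V : set (mplane R)) w by apply: measurable_funS Hw.1.1.
have me f : smooth f -> measurable_fun (V : set (mplane R)) f.
  by move=> sf; apply: measurable_plane => // x _; exact: smooth_continuous.
have meta := me _ se; have mdeta := me _ (smooth_partial m se).
have mw1 := measurable_wpart (U := V) m w'.
have mw2 : measurable_fun (V : set (mplane R)) (wpart U m w).
  exact: measurable_funS VU (measurable_wpart (U := U) m w).
apply: (@ae_eq_Rintegral _ _ _ (leb2 R)) => //.
- by apply: measurable_funD; apply: measurable_funM.
- by apply: measurable_funD; apply: measurable_funM.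
- apply: ae_impl (ae_conj ww' (wpart_local m oU oV VU mw' ww' Hw)) => x [h1 h2] Vx.
  by rewrite h1// h2.
Qed.

(** The test function sees only [U] inside [Q], which lies in [V]. This moves the volume side of
    Green's formula between the element and [Omega]. *)
Lemma green_form_sub m U V Q w w' eta : open U -> open V -> V `<=` U -> H1 U w ->
  measurable_fun (V : set (mplane R)) w' ->
  {ae leb2 R, forall x, V x -> w x = w' x} -> U `&` Q `<=` V ->
  smooth eta -> compactly_supported_in Q eta ->
  green_form m V w' eta = green_form m U w eta.
Proof.
move=> oU oV VU Hw mw' ww' UQ se [C [cC CQ eta0]].
rewrite (@green_form_ext m U V w)// /green_form (@Rintegral_restrict_subset _ _ _ (leb2 R) U V) => //.
move=> x Ux Vx; have Cx : ~ C x by move=> /CQ Qx; apply: Vx; exact: UQ.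
have clC : closed C by apply: compact_closed => //; exact: norm_hausdorff.
by rewrite (partial_out m clC eta0 Cx) (eta0 _ Cx) !mulr0 addr0.
Qed.

End TraceLocality.

(** * Compactly supported functions on the line *)

Section CompactSupportLine.
Variable R : realType.
Local Notation mu := (@lebesgue_measure R).

Lemma derive1_csupp_out (psi : R -> R) (C : set R) s : closed C ->
  (forall t, ~ C t -> psi t = 0) -> ~ C s -> derive1 psi s = 0.
Proof.
move=> cC psi0 Cs; rewrite derive1E -[RHS](derive_cst (0 : R) s (1 : R)).
apply: near_eq_derive.
have : open_nbhs s (~` C) by split => //; exact: closed_openC.
by move=> /open_nbhs_nbhs; apply: filterS => y; exact: psi0.
Qed.

Lemma nderivable2_derive1 (psi : R -> R) : nderivable 2 psi ->
  (forall s, is_derive s (1 : R) psi (derive1 psi s)) /\ continuous (derive1 psi).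
Proof.
move=> [g [dg D1]]; have gE : derive1 psi = g.
  by apply/funext => s; rewrite derive1E; exact: derive_val.
by rewrite gE; split => //; exact: (@nderivable_continuous _ 0).
Qed.

Lemma integral_derive1_csupp (psi : R -> R) a b : (forall n, nderivable n psi) ->
  compactly_supported_in `]a, b[ psi -> \int[mu]_(s in `]a, b[) derive1 psi s = 0.
Proof.
move=> D [C [cC CJ psi0]].
have [ab|ba] := ltP a b; last first.
  by rewrite set_itv_ge ?Rintegral_set0// bnd_simp -leNgt.
have clC : closed C by apply: compact_closed => //; exact: norm_hausdorff.
rewrite -(@Rintegral_restrict_subset _ _ _ mu `[a, b]%classic).
- have [dpsi cpsi1] := nderivable2_derive1 (D 2%N).
  rewrite /Rintegral (FTC_C1 (ltW ab) dpsi cpsi1) /= !psi0 ?subr0// => /CJ;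
    by rewrite /= in_itv /= ltxx ?andbF.
- exact: subset_itv_oo_cc.
- by move=> s _ ns; apply: derive1_csupp_out clC psi0 _ => /CJ.
Qed.

End CompactSupportLine.

(** * The arc derivative of the oblique derivative *)

Section BoundaryJump.
Variables (R : realType) (Omega : set (plane R)) (L : R) (chi : R -> plane R).
Local Notation mu := (@lebesgue_measure R).
Hypothesis hOmega : C2_domain Omega L chi.
Variables (T : mesh R) (ell : plane R -> plane R) (u : plane R -> R) (c : R).
Hypothesis hT : exact_conforming T Omega.
Hypothesis hell : C1_unit_field chi ell.
Hypothesis Hu : H2 Omega u.
Hypothesis hbc : oblique_const Omega L chi ell u c.

Lemma finite_fiber y : finite_set (`[0, L[ `&` chi @^-1` [set y]).
Proof.
have [_ _ [_ _ _ _ [inj _]]] := hOmega.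
have [[s [sL sy]]|/set0P/negP/negPn/eqP ->] := pselect ((`[0, L[ `&` chi @^-1` [set y]) !=set0); last exact: finite_set0.
apply: (@sub_finite_set _ _ [set s]); last exact: finite_set1.
move=> t [tL ty] /=; apply: inj; rewrite ?inE//.
by rewrite sy ty.
Qed.

(** In a window the trace of [ell . grad u] taken from the element equals [c] a.e., so the weak arc
    derivative pairs with every test function as minus [c] times the integral of its derivative,
    which is zero. *)
Lemma dot_oblique_ae0 (i : 'I_(nel T)) p h : edge (i, p) `<=` bdry Omega ->
  is_dot_oblique L chi ell (i, p) u h ->
  {ae mu, forall s, bdry_params L chi (i, p) s -> h (chi s) = 0}.
Proof.
move=> be [Lh [G [tG wG]]]; have [G' [tG' G'c]] := hbc.
have cchi := chi_continuous hOmega.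
have mB := measurable_bdry_params hOmega hT i p.
have oO : open Omega by case: hOmega => [[]].
pose V0 := Fmap i (refedge T p 0); pose V1 := Fmap i (refedge T p 1).
(* The parameter [0] has no two-sided neighbourhood within one period, and at the end points of the
   edge other edges of the element cannot be avoided. *)
apply: (@ae_countable _ ([set 0] `|` (`[0, L[ `&` chi @^-1` [set V0]) `|` (`[0, L[ `&` chi @^-1` [set V1]))).
  apply: finite_set_countable; rewrite !finite_setU; split; last exact: finite_fiber.
  by split; [exact: finite_set1|exact: finite_fiber].
suff : {ae mu, forall s, (bdry_params L chi (i, p) s /\ s != 0 /\ chi s <> V0 /\ chi s <> V1) ->
    h (chi s) = 0}.
  apply: ae_impl => s H nS Bs; apply: H; split => //; case: (Bs) => sL _; split.
    by apply/eqP => s0; apply: nS; left; left.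
  by split => sV; apply: nS; [left; right|right].
apply: ae_local => s0 [[s0L [t0 t01 Ft0]] [s00 [nV0 nV1]]].
have {}t01 : 0 < t0 < 1.
  move: t01; rewrite /= in_itv /= => /andP[t00 t11]; rewrite !lt_neqAle t00 t11 !andbT.
  apply/andP; split; apply/eqP => tE.
    by apply: nV0; rewrite -Ft0 /V0 tE.
  by apply: nV1; rewrite -Ft0 /V1 tE.
have {}s0L : 0 < s0 < L.
  by move: s0L; rewrite /= in_itv /= => /andP[? ->]; rewrite lt_neqAle eq_sym s00 andbT.
(* This radius keeps the window inside one period. *)
pose e := Num.min s0 (L - s0).
have [e0 es eL] : [/\ 0 < e, e <= s0 & e <= L - s0].
  by rewrite /e lt_min !ge_min !lexx orbT subr_gt0 andbC; case/andP: s0L => -> ->.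
have [m [sg [tau [a [b [lo [hi [[sab [ea eb]] lgO lgE [oQ OQ] abe]]]]]]]] :=
  boundary_edge_window hOmega hT be t01 (esym Ft0) e0.
exists a, b; split => //.
have mab : measurable (`]a, b[%classic : set (measurableTypeR R)) by exact: measurable_itv.
have abL : `]a, b[ `<=` `[0, L[.
  by move=> s; rewrite /= !in_itv /= => /andP[? ?]; apply/andP; split; lra.
have abB : `]a, b[ `<=` bdry_params L chi (i, p).
  by move=> s sab'; split; [exact: abL|apply: abe; move: sab'; rewrite /= in_itv].
have abI : `]a, b[ `<=` (chi @^-1` edge (i, p))°.
  rewrite -open_subsetE; last exact: interval_open.
  by move=> s /abB[].
have oE : open (elem i)° by exact: open_interior.
have EO := elem_interior_sub hOmega hT (i := i).
(* The element and [Omega] lie on the same side of the curve, with equal signs, so the equality of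
   their volume forms identifies the traces. *)
have GG k : {ae mu, forall s, `]a, b[%classic s -> coord k (G' (chi s)) = coord k (G (chi s))}.
  have tr' : is_trace Omega chi `]a, b[ (wpart Omega k u) (fun x => coord k (G' x)).
    by apply: is_trace_sub (tG' k) => //; exact: measurable_itv.
  have tr : is_trace (elem i)° chi `]a, b[ (wpart (elem i)° k u) (fun x => coord k (G x)).
    exact: is_trace_sub (tG k).
  apply: (trace_uniq mab _ oO oE lgO lgE tr' tr) => // eta se ce.
  congr (_ * _); apply/esym; apply: green_form_sub OQ se ce => //.
  - exact: Hu.2.
  - exact: measurable_wpart.
  - by apply: ae_impl (wpart_sub k oO oE EO Hu.1) => x H /H.
have Gc : {ae mu, forall s, `]a, b[%classic s -> dotp (ell (chi s)) (G (chi s)) = c}.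
  apply: ae_impl (ae_conj (ae_conj (GG ord0) (GG ord_max)) G'c) => s [[g1 g2] g3] sab'.
  rewrite -g3; last by have := abL _ sab'; rewrite /= in_itv.
  by rewrite /dotp; have := g1 sab'; have := g2 sab'; rewrite /coord /= => <- <-.
apply: fundamental_line; first exact: L2_sub Lh.
move=> psi Dpsi cpsi; have [C [cC CJ psi0]] := cpsi.
have clC : closed C by apply: compact_closed => //; exact: norm_hausdorff.
have cpsi' : compactly_supported_in (chi @^-1` edge (i, p))° psi.
  (* The weak derivative is tested on parameters of all periods; the support of [psi] reduces both
     integrals to ]a, b[. *)
  by exists C; split => //; exact: subset_trans abI.
have := wG psi (nderivable_smooth1 Dpsi) cpsi'.
have Cab s : ~ `]a, b[%classic s -> ~ C s by move=> ns /CJ.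
rewrite (@Rintegral_restrict_subset _ _ _ mu (chi @^-1` edge (i, p))° `]a, b[%classic)//; last first.
  by move=> s _ /Cab Cs; rewrite (derive1_csupp_out clC psi0 Cs) mulr0.
rewrite (@Rintegral_restrict_subset _ _ _ mu (chi @^-1` edge (i, p))° `]a, b[%classic)//; last first.
  by move=> s _ /Cab Cs; rewrite (psi0 _ Cs) mulr0.
have [_ cpsi1] := nderivable2_derive1 (Dpsi 2%N).
have mell k : measurable_fun (`]a, b[%classic : set (measurableTypeR R)) (fun s => coord k (ell (chi s))).
  apply: measurable_funTS; apply: continuous_measurable_fun.
  by have [C1 _] := hell; have [_ /(_ 0%N)] := C1 k; exact.
have mG k : measurable_fun (`]a, b[%classic : set (measurableTypeR R)) (fun s => coord k (G (chi s))).
  have [_ [mg _] _] := tG k; exact: measurable_funS mg.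
rewrite (@ae_eq_Rintegral _ _ _ mu _ _ (fun s => c * derive1 psi s)) => //; first last.
- by apply: ae_impl Gc => s H /H ->.
- apply: measurable_funM; first exact: measurable_cst.
  by apply: measurable_funTS; exact: continuous_measurable_fun.
- apply: measurable_funM; last by apply: measurable_funTS; exact: continuous_measurable_fun.
  apply: measurable_funD; apply: measurable_funM.
  + exact: (mell ord0).
  + exact: (mG ord0).
  + exact: (mell ord_max).
  + exact: (mG ord_max).
rewrite RintegralZl//; last exact: continuous_integrable_oo.
rewrite integral_derive1_csupp// mulr0 => /eqP; rewrite eq_sym oppr_eq0 => /eqP; exact.
Qed.

End BoundaryJump.

(** * Jumps across an interior edge *)

Section StraightEdges.
Variable R : realType.
Implicit Types (K V W : set (plane R)) (n t x y z : plane R) (m : 'I_2).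

(** From an interior point of the edge one can move both ways along it inside [K], so both [t] and
    [- t] have nonpositive product with the outer normal. *)
Lemma outer_normal_tangent K n t x (len s0 : R) : 0 < s0 < len ->
  (forall s, 0 < s < len -> is_outer_normal K (x + s *: t) n) -> dotp n t = 0.
Proof.
move=> s0l H.
have K0 s : 0 < s < len -> K (x + s *: t).
  by move=> /H[_ /nbhs_singleton ->]; rewrite subrr /dotp /= !mulr0 addr0.
have [_ near0] := H _ s0l.
have cl : continuous (fun s : R => x + s *: t).
  by move=> s; apply: cvgD; [exact: cvg_cst|apply: cvgZl; exact: cvg_id].
have : \forall s \near s0, dotp n ((s - s0) *: t) <= 0.
  have n1 : \forall s \near s0, K (x + s *: t) <-> dotp n (x + s *: t - (x + s0 *: t)) <= 0.
    exact: cl near0.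
  have n2 : \forall s \near s0, 0 < s < len.
    apply: filterS (near_in_itvoo _); last first.
      by rewrite in_itv /=; exact: s0l.
    by move=> s; rewrite in_itv.
  apply: filterS2 n1 n2 => s sE /K0 /sE.
  by rewrite opprD addrACA subrr add0r -scalerBl.
move=> /nbhs_ballP[e /= e0 eH].
have dE (r : R) : dotp n (r *: t) = r * dotp n t by rewrite /dotp /= /GRing.scale /=; ring.
have h1 : e / 2 * dotp n t <= 0.
  have := eH (s0 + e / 2); rewrite addrAC subrr add0r dE; apply.
  by rewrite /ball /= opprD addrA subrr add0r normrN gtr0_norm ?divr_gt0//; lra.
have h2 : - (e / 2) * dotp n t <= 0.
  have := eH (s0 - e / 2); rewrite addrAC subrr add0r dE; apply.
  by rewrite /ball /= opprB addrCA subrr addr0 gtr0_norm ?divr_gt0//; lra.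
have e20 : 0 < e / 2 by lra.
apply/eqP; rewrite eq_le; apply/andP; split.
  by move: h1; rewrite pmulr_rle0.
by move: h2; rewrite mulNr oppr_le0 pmulr_rge0.
Qed.

Lemma nbhs_shift W n y : nbhs y W -> exists2 r : R, 0 < r & W (y + r *: n).
Proof.
move=> Wy.
have cl : {for 0, continuous (fun s : R => y + s *: n)}.
  by apply: cvgD; [exact: cvg_cst|apply: cvgZl; exact: cvg_id].
have : \forall s \near (0 : R), W (y + s *: n) by apply: cl; rewrite scale0r addr0.
move=> /nbhs_ballP[e /= e0 eH]; exists (e / 2); first by rewrite divr_gt0.
by apply: eH; rewrite /ball /= sub0r normrN gtr0_norm ?divr_gt0//; lra.
Qed.

Lemma continuous_dotp n : continuous (dotp n).
Proof. by move=> x; apply: cvgD; apply: cvgMr; [exact: cvg_fst|exact: cvg_snd]. Qed.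

(** A point on the bounding line is not interior, since an arbitrarily short step along [n] leaves
    [K]. *)
Lemma interior_halfplane K n x0 W y : open W -> dotp n n = 1 ->
  (forall y, W y -> (K y <-> dotp n (y - x0) <= 0)) ->
  W y -> (K° y <-> dotp n (y - x0) < 0).
Proof.
move=> oW n1 WK Wy; split.
  move=> Ky; rewrite lt_neqAle (WK y Wy).1 ?andbT; last exact: interior_subset.
  apply/eqP => d0.
  have [r r0 [Wr Kr]] := nbhs_shift n (filterI (open_nbhs_nbhs (conj oW Wy)) Ky).
  have := (WK _ Wr).1 Kr; apply/negP; rewrite -ltNge.
  have -> : dotp n (y + r *: n - x0) = dotp n (y - x0) + r * dotp n n by rewrite /dotp /= /GRing.scale /=; ring.
  by rewrite d0 n1 mulr1 add0r.
move=> d0; have cd : {for y, continuous (fun z => dotp n (z - x0))}.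
  by apply: (@continuous_comp _ _ _ (fun z => z - x0) (dotp n)); [apply: cvgB; [exact: cvg_id|exact: cvg_cst]|exact: continuous_dotp].
have nW : nbhs y W by exact: open_nbhs_nbhs.
apply: filterS2 nW (cd _ (lt_nbhsl d0)) => z Wz; rewrite /= => dz.
by apply/(WK z Wz); exact: ltW.
Qed.

Lemma unit_orthogonal n n' t : dotp n n = 1 -> dotp n' n' = 1 -> dotp t t = 1 ->
  dotp n t = 0 -> dotp n' t = 0 -> n' = n \/ n' = - n.
Proof.
case: n n' t => [a b] [a' b'] [c d]; rewrite /dotp /= => n1 n1' t1 nt nt'.
(* The components of [n] and [n'] along (d, -c), the unit vector orthogonal to [t]; each has square
   [1]. *)
pose k := d * a - c * b; pose k' := d * a' - c * b'.
have H (x y : R) : x * c + y * d = 0 -> x = (d * x - c * y) * d /\ y = - (d * x - c * y) * c.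
  move=> xy0; split.
    rewrite -[LHS]mulr1 -t1; transitivity (c * (x * c + y * d) + (d * x - c * y) * d); first by ring.
    by rewrite xy0 mulr0 add0r.
  rewrite -[LHS]mulr1 -t1; transitivity (d * (x * c + y * d) + - (d * x - c * y) * c); first by ring.
  by rewrite xy0 mulr0 add0r.
have [aE bE] := H _ _ nt; have [aE' bE'] := H _ _ nt'; rewrite -/k in aE bE; rewrite -/k' in aE' bE'.
have k1 : k ^+ 2 = 1 by rewrite -n1 aE bE -[LHS]mulr1 -t1; ring.
have k1' : k' ^+ 2 = 1 by rewrite -n1' aE' bE' -[LHS]mulr1 -t1; ring.
have : (k' - k) * (k' + k) = 0 by rewrite -subr_sqr k1 k1' subrr.
move=> /eqP; rewrite mulf_eq0 => /orP[|]; rewrite ?subr_eq0 ?addr_eq0 => /eqP kk.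
  by left; rewrite aE bE aE' bE' kk.
by right; rewrite aE bE aE' bE' kk; congr pair; rewrite /=; ring.
Qed.

End StraightEdges.

Section InteriorJump.
Variables (R : realType) (Omega : set (plane R)).
Hypothesis oO : open Omega.
Implicit Types (n x : plane R) (m : 'I_2).

(* The two sides exhaust [Omega] near [Q] up to a null line, and Green's formula
   for the weak derivative on [Omega] has no boundary term. *)
Lemma green_form_split m w V1 V2 Q n (c : R) w1 w2 eta : n != 0 -> open V1 -> open V2 ->
  V1 `&` V2 = set0 -> V1 `<=` Omega -> V2 `<=` Omega -> Q `<=` Omega ->
  (forall x, Q x -> V1 x \/ V2 x \/ dotp n x = c) -> H1 Omega w ->
  measurable_fun (V1 : set (mplane R)) w1 -> measurable_fun (V2 : set (mplane R)) w2 ->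
  {ae leb2 R, forall x, V1 x -> w x = w1 x} -> {ae leb2 R, forall x, V2 x -> w x = w2 x} ->
  smooth eta -> compactly_supported_in Q eta ->
  green_form m V1 w1 eta + green_form m V2 w2 eta = 0.
Proof.
move=> n0 oV1 oV2 V12 VO1 VO2 QO HQ Hw mw1 mw2 ww1 ww2 se ce.
have mO := open_measurable_plane oO.
have mV1 := open_measurable_plane oV1; have mV2 := open_measurable_plane oV2.
have [C [cC CQ eta0]] := ce.
have clC : closed C by apply: compact_closed => //; exact: norm_hausdorff.
rewrite (@green_form_ext _ m Omega V1 w)// (@green_form_ext _ m Omega V2 w)//.
set f := fun x => _.
have [Lg wg] := wpartP (Hw.2 m).
have ceO := csupp_sub QO ce.
have sde := smooth_partial m se; have cde := csupp_partial m ceO.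
have Lde := csupp_L2 oO (smooth_continuous sde) cde.
have Le := csupp_L2 oO (smooth_continuous se) ceO.
have i1 := L2_mul_integrable mO Hw.1 Lde; have i2 := L2_mul_integrable mO Lg Le.
have intf : (leb2 R).-integrable Omega (EFin \o f).
  exact: (integrableD mO i1 i2).
have mf : measurable_fun (Omega : set (mplane R)) f.
  by apply/measurable_EFinP; case/integrableP: intf.
have mV : measurable (V1 `|` V2 : set (mplane R)) by exact: measurableU.
have VO : V1 `|` V2 `<=` Omega by move=> x [/VO1|/VO2].
rewrite -Rintegral_setU//; first last.
- by apply/eqP; rewrite V12.
- exact: integrableS intf.
rewrite -(@Rintegral_ae_subset _ _ _ (leb2 R) Omega)//.
  by rewrite /f RintegralD// wg// addNr.
have := ae_not_line c n0; apply: ae_impl => x nx Ox nV.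
have Cx : ~ C x by move=> /CQ /HQ [|[|//]] Vx; apply: nV; [left|right].
by rewrite /f (partial_out m clC eta0 Cx) (eta0 _ Cx) !mulr0 addr0.
Qed.

End InteriorJump.

Section EdgeParam.
Variables (R : realType) (T : mesh R).

Lemma edge_tangent_unit (e : 'I_(nel T) * 'I_3) : 0 < edge_len e ->
  dotp (edge_tangent e) (edge_tangent e) = 1.
Proof.
move=> l0; pose d := vertex e.1 (ordS e.2) - vertex e.1 e.2.
have -> : dotp (edge_tangent e) (edge_tangent e) = (edge_len e)^-1 ^+ 2 * dotp d d.
  by rewrite /edge_tangent -/d /dotp /= /GRing.scale /=; ring.
by rewrite -sqr_enorm -exprMn mulVf ?expr1n// gt_eqF.
Qed.

Lemma coord_line m (v t : plane R) :
  (forall s : R, is_derive s (1 : R) (fun s : R => coord m (v + s *: t)) (coord m t)).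
Proof.
move=> s; rewrite (_ : (fun s : R => _) = (fun s => coord m v + s * coord m t)); last first.
  by apply/funext => r; rewrite /coord; case: (m == ord0).
rewrite -[X in is_derive _ _ _ X]add0r; apply: is_deriveD.
by apply: is_derive_eq; rewrite scaler0 add0r /GRing.scale /= mulr1.
Qed.

End EdgeParam.

(** * Vanishing of the normal jump of the gradient *)

Section InteriorEdge.
Variables (R : realType) (Omega : set (plane R)) (L : R) (chi : R -> plane R).
Local Notation mu := (@lebesgue_measure R).
Hypothesis hOmega : C2_domain Omega L chi.
Variables (T : mesh R) (u : plane R -> R).
Hypothesis hT : exact_conforming T Omega.
Hypothesis Hu : H2 Omega u.

(** The outer normals in a candidate make both elements half planes with opposite normals near an
    interior edge point. The traces of the gradient then agree componentwise, and their products
    with opposite normals cancel. *)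
Lemma normal_jump_ae0 (E : ('I_(nel T) * 'I_3) * ('I_(nel T) * 'I_3)) J :
  interior_edge E -> is_normal_jump E u J ->
  {ae mu, forall s, `[0, edge_len E.1]%classic s -> J (edge_param E.1 s) = 0}.
Proof.
move=> /andP[ij _] [np [nm [Gp [Gm [N Tp Tm JE]]]]].
set len := edge_len E.1 in N Tp Tm *; set gam := edge_param E.1 in N Tp Tm *.
have oO : open Omega by case: hOmega => [[]].
have KK0 : (elem E.1.1)° `&` (elem E.2.1)° = set0.
  have [_ [_ dis] _ _ _] := hT; apply: dis.
  by apply/eqP => eE; move: ij; rewrite eE ltnn.
(* The normals describe the elements only at interior points of the edge. *)
apply: (@ae_countable _ [set 0; len]).
  by apply: finite_set_countable; rewrite finite_setU; split; exact: finite_set1.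
suff : {ae mu, forall s, (0 < s < len) -> J (gam s) = 0}.
  apply: ae_impl => s H nS; rewrite /= in_itv /= => /andP[s0 sl]; apply: H.
  rewrite !lt_neqAle s0 sl !andbT; apply/andP; split; apply/eqP => sE; apply: nS.
    by left.
  by right.
apply: ae_local => s0 s0l.
have l0 : 0 < len by case/andP: s0l; exact: lt_trans.
pose t := edge_tangent E.1; pose v := vertex E.1.1 E.1.2.
have gamE s : gam s = v + s *: t by [].
have t1 : dotp t t = 1 by exact: edge_tangent_unit.
have npt : dotp np t = 0.
  by apply: (@outer_normal_tangent R (elem E.1.1) np t v len s0) => // s /N[].
have nmt : dotp nm t = 0.
  by apply: (@outer_normal_tangent R (elem E.2.1) nm t v len s0) => // s /N[].
have [[np1 Kp] [nm1 Km]] := N _ s0l.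
have {}np1 : dotp np np = 1 by rewrite -sqr_enorm np1 expr1n.
have {}nm1 : dotp nm nm = 1 by rewrite -sqr_enorm nm1 expr1n.
set x0 := gam s0 in Kp Km.
pose B := [set y | (elem E.1.1 y <-> dotp np (y - x0) <= 0) /\
  (elem E.2.1 y <-> dotp nm (y - x0) <= 0)].
have nB : nbhs x0 B by apply: filterI.
pose W := B°.
have oW : open W by exact: open_interior.
have Wx0 : W x0 by [].
have WB y : W y -> B y by exact: interior_subset.
have ip y : W y -> ((elem E.1.1)° y <-> dotp np (y - x0) < 0).
  by apply: interior_halfplane => // z /WB[].
have im y : W y -> ((elem E.2.1)° y <-> dotp nm (y - x0) < 0).
  by apply: interior_halfplane => // z /WB[].
have dN n y : dotp (- n) y = - dotp n y by rewrite /dotp /=; ring.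
have nmE : nm = - np.
  (* Equal normals would place both interiors on the same side of the line, although they are
     disjoint. *)
  have [nn|//] := unit_orthogonal np1 nm1 t1 npt nmt.
  have [r r0 Wr] := nbhs_shift (- np) (open_nbhs_nbhs (conj oW Wx0)).
  have lt0 : dotp np (x0 + r *: - np - x0) < 0.
    have -> : dotp np (x0 + r *: - np - x0) = - (r * dotp np np).
      by rewrite /dotp /= /GRing.scale /=; ring.
    by rewrite np1 mulr1 oppr_lt0.
  have : ((elem E.1.1)° `&` (elem E.2.1)°) (x0 + r *: - np).
    by split; [apply/ip|apply/im => //; rewrite nn].
  by rewrite KK0.
(* The two closed half planes cover [W], so [W] lies in the closure of [Omega]; being open, it lies
   in [Omega]. *)
have WO : W `<=` Omega.
  rewrite -[W](interior_id _).1//; apply: (interior_sub_Omega hOmega) => y /WB [Bp Bm].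
  have [y0|y0] := leP (dotp np (y - x0)) 0.
    by apply: (elem_closure hT (i := E.1.1)); apply/Bp.
  by apply: (elem_closure hT (i := E.2.1)); apply/Bm; rewrite nmE dN oppr_le0 ltW.
(* Where [np] has a nonzero component, the line is a graph in that direction, and the tangent has a
   nonzero other coordinate. *)
have [m npm] : exists m, coord m np != 0.
  have [n0|n0] := eqVneq np.1 0; last by exists ord0.
  exists ord_max; rewrite /coord /=; apply/eqP => n2.
  by move: np1; rewrite /dotp n0 n2 !mul0r addr0 => /eqP; rewrite eq_sym oner_eq0.
have dotE n y : dotp n y = coord m n * coord m y + ocoord m n * ocoord m y.
  by rewrite /dotp /ocoord /coord; case: (m == ord0) => //=; rewrite addrC.
have otm : ocoord m t != 0.
  apply/eqP => ot; move: npt t1; rewrite !dotE ot !mulr0 !addr0 => /eqP.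
  by rewrite mulf_eq0 (negbTE npm) /= => /eqP ->; rewrite mulr0 => /eqP; rewrite eq_sym oner_eq0.
have dgam k s : is_derive s (1 : R) (fun s => coord k (gam s)) (coord k t) by exact: coord_line.
have dp s : is_derive s (1 : R) (fun s => ocoord m (gam s)) (ocoord m t).
  by rewrite /ocoord; case: (m == ord0); [exact: (dgam ord_max s)|exact: (dgam ord0 s)].
have p'E : derive1 (fun s => ocoord m (gam s)) = cst (ocoord m t).
  by apply/funext => s; rewrite derive1E; exact: derive_val.
pose e := Num.min s0 (len - s0).
have [e0 es eL] : [/\ 0 < e, e <= s0 & e <= len - s0].
  by rewrite /e lt_min !ge_min !lexx orbT subr_gt0 andbC; case/andP: s0l => -> ->.
have [tau [a [b [lo [hi [ea eb gw]]]]]] : exists tau a b lo hi,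
    [/\ s0 - e < a, b < s0 + e & graph_window gam m s0 W tau a b lo hi].
  apply: graph_window_exists => //.
  - by rewrite p'E => s; exact: cvg_cst.
  - by move=> s; apply/differentiable_continuous/derivable1_diffP; have [] := dgam m s.
  - by rewrite p'E.
  - exact: open_nbhs_nbhs.
exists a, b; split; first exact: gw_s0 gw.
set Q := gbox gam m a b lo hi.
have QW : Q `<=` W by exact: gw_sub gw.
(* If the outer normal of the first element points up in the direction [m], the element lies below
   the line. *)
pose sg : R := if 0 < coord m np then 1 else -1.
have sg1 : sg = 1 \/ sg = -1 by rewrite /sg; case: ifP => _; [left|right].
have sgn r : (0 < coord m np * r) = (0 < sg * r).
  rewrite /sg; case: ifPn => n0; first by rewrite mul1r pmulr_rgt0.
  by rewrite mulN1r oppr_gt0 nmulr_rgt0// lt_neqAle npm leNgt.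
have npE s z : dotp np (mkcoord m (ocoord m (gam s)) z - x0) = - (coord m np * (coord m (gam s) - z)).
  have -> : dotp np (mkcoord m (ocoord m (gam s)) z - x0) = dotp np (mkcoord m (ocoord m (gam s)) z - gam s) +
      (s - s0) * dotp np t.
    rewrite /x0 !gamE; rewrite /dotp /= /GRing.scale /=; ring.
  rewrite npt mulr0 addr0 dotE.
  have -> : coord m (mkcoord m (ocoord m (gam s)) z - gam s) = z - coord m (gam s).
    by rewrite -[in RHS](coord_mkcoord m (ocoord m (gam s)) z) /coord; case: (m == ord0).
  have -> : ocoord m (mkcoord m (ocoord m (gam s)) z - gam s) = 0.
    rewrite -[RHS](subrr (ocoord m (gam s))) -[in X in _ = X - _](ocoord_mkcoord m (ocoord m (gam s)) z) /ocoord.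
    by case: (m == ord0).
  by rewrite mulr0 addr0 -mulrN opprB.
have Qm s z : a < s < b -> lo < z < hi -> Q (mkcoord m (ocoord m (gam s)) z).
  by move=> sab zz; split; [exists s => //; rewrite ocoord_mkcoord|rewrite coord_mkcoord].
have lgp : local_graph (elem E.1.1)° gam m sg tau a b lo hi.
  apply: (window_local_graph gw sg1) => s z sab zz.
  by rewrite (ip _ (QW _ (Qm s z sab zz))) npE oppr_lt0 sgn.
have lgm : local_graph (elem E.2.1)° gam m (- sg) tau a b lo hi.
  apply: (window_local_graph gw) => [|s z sab zz].
    by case: sg1 => ->; [right|left; rewrite opprK].
  by rewrite (im _ (QW _ (Qm s z sab zz))) nmE dN npE opprK -oppr_gt0 -mulrN sgn mulrN mulNr.
have mJ : measurable (`[0, len]%classic : set (measurableTypeR R)) by exact: measurable_itv.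
have abJ : `]a, b[ `<=` `[0, len].
  by move=> s; rewrite /= !in_itv /= => /andP[? ?]; apply/andP; split; lra.
have oE (i : 'I_(nel T)) : open (elem i)° by exact: open_interior.
have EO i := elem_interior_sub hOmega hT (i := i).
have GG k : {ae mu, forall s, `]a, b[%classic s -> coord k (Gp (gam s)) = coord k (Gm (gam s))}.
  have tp : is_trace (elem E.1.1)° gam `[0, len] (wpart (elem E.1.1)° k u) (fun x => coord k (Gp x)) := Tp k.
  have tm : is_trace (elem E.2.1)° gam `[0, len] (wpart (elem E.2.1)° k u) (fun x => coord k (Gm x)) := Tm k.
  have oE1 := oE E.1.1; have oE2 := oE E.2.1.
  apply: (trace_uniq mJ abJ oE1 oE2 lgp lgm tp tm) => eta se ce.
  (* The signs of the two sides are opposite, so equality of the signed forms means that the two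
     forms add up to zero. *)
  rewrite mulNr -mulrN; congr (_ * _); apply/eqP; rewrite -addr_eq0; apply/eqP.
  have np0 : np != 0.
    by apply: contra_neq npm => ->; rewrite /coord; case: (m == ord0).
  apply: (@green_form_split _ _ oO m (wpart Omega k u) _ _ Q np (dotp np x0)) => //.
  - exact: subset_trans WO.
  - move=> x /QW Wx.
    have dB : dotp np (x - x0) = dotp np x - dotp np x0 by rewrite /dotp /=; ring.
    have [lt0|gt0|eq0] := ltgtP (dotp np (x - x0)) 0.
    + by left; apply/ip.
    + by right; left; apply/im => //; rewrite nmE dN oppr_lt0.
    + by right; right; apply/eqP; rewrite -subr_eq0 -dB eq0.
  - exact: Hu.2.
  - exact: measurable_wpart.
  - exact: measurable_wpart.
  - by apply: ae_impl (wpart_sub k oO oE1 (@EO _) Hu.1) => x H /H.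
  - by apply: ae_impl (wpart_sub k oO oE2 (@EO _) Hu.1) => x H /H.
apply: ae_impl (ae_conj (GG ord0) (GG ord_max)) => s [g1 g2] sab.
rewrite JE nmE /dotp; have := g1 sab; have := g2 sab; rewrite /coord /= => -> ->; ring.
Qed.

End InteriorEdge.

(** * The scheme *)

Section Volume.
Variable R : realType.

Lemma sum_ord2 (V : nmodType) (F : 'I_2 -> V) : \sum_(i < 2) F i = F ord0 + F ord_max.
Proof. by rewrite big_ord_recl big_ord1; congr (_ + F _); exact: val_inj. Qed.

(** The inverse is total: it is continuous off [0], and the singleton of [0] is treated
    separately. *)
Lemma measurable_inv : measurable_fun [set: measurableTypeR R] (@GRing.inv R).
Proof.
have o0 : open [set x : R | x != 0] by exact: open_neq.
have -> : [set: measurableTypeR R] = [set 0] `|` [set x : R | x != 0].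
  by apply/seteqP; split => // x _; have [->|x0] := eqVneq x 0; [left|right].
have m0 := open_measurable o0.
apply/measurable_funU => //; split; first exact: measurable_fun_set1.
by apply: open_continuous_measurable_fun => // x /set_mem x0; exact: inv_continuous.
Qed.

Lemma measurable_mxtrace (U : set (plane R)) (M : plane R -> 'M[R]_2) :
  (forall i j, measurable_fun (U : set (mplane R)) (fun x => M x i j)) ->
  measurable_fun (U : set (mplane R)) (fun x => \tr (M x)).
Proof.
move=> mM; rewrite (_ : (fun x => _) = (fun x => M x ord0 ord0 + M x ord_max ord_max)).
  exact: measurable_funD.
by apply/funext => x; rewrite /mxtrace sum_ord2.
Qed.

Lemma measurable_frobdot (U : set (plane R)) (M N : plane R -> 'M[R]_2) :
  (forall i j, measurable_fun (U : set (mplane R)) (fun x => M x i j)) ->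
  (forall i j, measurable_fun (U : set (mplane R)) (fun x => N x i j)) ->
  measurable_fun (U : set (mplane R)) (fun x => frobdot (M x) (N x)).
Proof.
move=> mM mN; rewrite (_ : (fun x => _) =
    (fun x => (M x ord0 ord0 * N x ord0 ord0 + M x ord0 ord_max * N x ord0 ord_max) +
              (M x ord_max ord0 * N x ord_max ord0 + M x ord_max ord_max * N x ord_max ord_max))).
  by apply: measurable_funD; apply: measurable_funD; apply: measurable_funM.
by apply/funext => x; rewrite /frobdot !sum_ord2.
Qed.

Lemma frobsqE (M : 'M[R]_2) : frobsq M = frobdot M M.
Proof. by apply: eq_bigr => i _; apply: eq_bigr => j _; rewrite expr2. Qed.

Lemma measurable_hess U (w : plane R -> R) i j :
  measurable_fun (U : set (mplane R)) (fun x => hess U w x i j).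
Proof.
rewrite (_ : (fun x => _) = wpart U j (wpart U i w)); first exact: measurable_wpart.
by apply/funext => x; rewrite mxE.
Qed.

End Volume.

Theorem lemma4p1 (R : realType)
    (Omega : set (plane R)) (L : R) (chi : R -> plane R)
    (ell : plane R -> plane R)
    (A : plane R -> 'M[R]_2) (nu_lo nu_hi eps : R) (f : plane R -> R)
    (T : mesh R) (k : nat) (u : plane R -> R) (c : R)
    (hOmega : C2_domain Omega L chi)
    (hell : C1_unit_field chi ell)
    (hA : forall i j : 'I_2, Linfty Omega (fun x => A x i j))
    (hellip : uniformly_elliptic Omega A nu_lo nu_hi)
    (heps : 0 < eps <= 1)
    (hcordes : cordes Omega A eps)
    (hf : L2 (leb2 R) Omega f)
    (hT : exact_conforming T Omega)
    (hk : (3 <= k)%N)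
    (hu : H2ell0 Omega L chi ell u)
    (hpde : {ae leb2 R, forall x, Omega x ->
               frobdot (A x) (hess Omega u x) = f x})
    (hbc : oblique_const Omega L chi ell u c)
    (hmean : \int[leb2 R]_(x in Omega) u x = 0) :
  forall v, Vhell0 T Omega ell k v ->
    b_h T Omega L chi ell A eps u v = l_h T A f v.
Proof.
move=> v _; have [Hu _ _] := hu.
have oO : open Omega by case: hOmega => [[]].
have -> : b_h T Omega L chi ell A eps u v = l_h T A f v +
    (2 - Num.sqrt (1 - eps)) / 2 * s_h T Omega L chi ell u v.
  congr (_ + _); apply: eq_bigr => i _.
  have oE : open (elem i)° by exact: open_interior.
  have EO : (elem i)° `<=` Omega := (elem_interior_sub hOmega hT (i := i)).
  have mE := open_measurable_plane oE; have mO := open_measurable_plane oO.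
  have mA j l : measurable_fun ((elem i)° : set (mplane R)) (fun x => A x j l).
    by have [mA _] := hA j l; exact: measurable_funS mA.
  have mg : measurable_fun ((elem i)° : set (mplane R)) (gamma_coef A).
    apply: measurable_funM; first exact: measurable_mxtrace.
    apply: (@measurableT_comp _ _ _ _ _ _ (@GRing.inv R)); first exact: measurable_inv.
    rewrite (_ : (fun x => _) = (fun x => frobdot (A x) (A x))).
      exact: measurable_frobdot.
    by apply/funext => x; rewrite frobsqE.
  have mh w : measurable_fun ((elem i)° : set (mplane R)) (fun x => \tr (hess (elem i)° w x)).
    by apply: measurable_mxtrace => j l; exact: measurable_hess.
  have mf : measurable_fun ((elem i)° : set (mplane R)) f by apply: measurable_funS hf.1.
  apply: (@ae_eq_Rintegral _ _ _ (leb2 R)) => //.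
  - apply: measurable_funM => //; apply: measurable_funM => //; apply: measurable_frobdot => // j l.
    exact: measurable_hess.
  - by apply: measurable_funM => //; apply: measurable_funM.
  - apply: ae_impl (ae_conj (hess_sub oO oE EO Hu) hpde) => x [h1 h2] Ex.
    by rewrite h1// h2//; exact: EO.
suff -> : s_h T Omega L chi ell u v = 0 by rewrite mulr0 addr0.
rewrite /s_h big1 ?big1 ?mulr0 ?addr0//.
(* The chosen value is either a candidate, which vanishes a.e., or the default [0]; the other factor
   is irrelevant in both cases. *)
- move=> [i p] /asboolP be; apply: Rintegral_ae0; rewrite /dot_oblique.
  case: xgetP => [h _ hh|_]; last by apply: aeW => s _; rewrite mul0r.
  by apply: ae_impl (dot_oblique_ae0 hOmega hT hell Hu hbc be hh) => s H /H ->; rewrite mul0r.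
- move=> E iE; apply: Rintegral_ae0; rewrite /normal_jump.
  case: xgetP => [J _ JJ|_]; last by apply: aeW => s _; rewrite mul0r.
  by apply: ae_impl (normal_jump_ae0 hOmega hT Hu iE JJ) => s H /H ->; rewrite mul0r.
Qed.
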